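(* Let $(M,F)$ be a Finsler surface with indicatrix bundle $\Sigma$ and coframe $\omega^1,\omega^2,\omega^3$, and consider the functional $$\Phi:\mathcal V(\mathcal I,\omega^1)\to\mathbb R,\qquad \Phi(\hat\gamma^\perp)=\int_{\hat\gamma^\perp}\omega^1,\qquad \mathcal I=\{\omega^2\}.$$ The Euler-Lagrange equation $$(I_3\circ\hat\gamma^\perp+1)\,k_T^{(N)}=(I_1\circ\hat\gamma^\perp)\,\sigma^2$$ is a necessary and sufficient condition for $\hat\gamma^\perp\in\mathcal V(\mathcal I,\omega^1)$ to be an extremal of $\Phi$.
   Context: Finsler surface: $M$ is a smooth (oriented) surface and $F:TM\to[0,\infty)$ is smooth on $TM\setminus\{0\}$ and restricts to a Minkowski norm on each $T_xM$; $g_{ij}(x,y)=\frac12\frac{\partial^2F^2}{\partial y^i\partial y^j}$, and for $0\neq N\in T_xM$, $g_N(U,V)=g_{ij}(x,N)U^iV^j$. $\Sigma=\{F=1\}\subset TM$ is the indicatrix bundle, a 3-manifold. It carries the coframe $\omega^1,\omega^2,\omega^3$, where $\omega^1=\frac{\sqrt{g}}{F}(y^2dx^1-y^1dx^2)$ (with $g=\det(g_{ij})$), $\omega^2=\frac{\partial F}{\partial y^1}dx^1+\frac{\partial F}{\partial y^2}dx^2$, and $\omega^3$ is determined by the structure equations $d\omega^1=-I\omega^1\wedge\omega^3+\omega^2\wedge\omega^3$, $d\omega^2=-\omega^1\wedge\omega^3$, $d\omega^3=K\omega^1\wedge\omega^2-J\omega^1\wedge\omega^3$, with $I$ (the Cartan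 scalar), $J$, $K$ smooth functions on $\Sigma$. For a function $f$ on $\Sigma$, $f_1,f_2,f_3$ are defined by $df=f_1\omega^1+f_2\omega^2+f_3\omega^3$. $\mathcal V(\mathcal I,\omega^1)$ is the set of smooth curves $\hat\gamma^\perp:(a,b)\to\Sigma$ with $\hat\gamma^{\perp*}\omega^2=0$ and $\hat\gamma^{\perp*}\omega^1\neq0$ (nowhere zero), curves differing only by parameterization being identified. Such a curve has the form $\hat\gamma^\perp(t)=(\gamma(t),N(t))$ with $\gamma$ its projection to $M$, $T=\dot\gamma$, $g_N(N,N)=1$, $g_N(N,T)=0$; that is, it is the normal lift of $\gamma$. Put $\sigma=\omega^1(\dot{\hat\gamma}^\perp)$, so $\sigma^2=g_N(T,T)$. With $(D_T^{(N)}U)^i=\frac{dU^i}{dt}+T^jU^k\Gamma^i_{jk}(\gamma,N)$, $\Gamma^i_{jk}$ the Chern connection coefficients, the $N$-parallel curvature $k_T^{(N)}$ is defined by $D_T^{(N)}N=-\frac{k_T^{(N)}}{\sigma^2}T$; equivalently $\omega^3(\dot{\hat\gamma}^\perp)=-\frac{k_T^{(N)}}{\sigma}$. An extremal of $\Phi$ is a curve $\hat\gamma^\perp\in\mathcal V(\mathcal I,\omega^1)$ such that $\frac{d}{du}\big|_{u=0}\int_{\hat\gamma_u}\omega^1=0$ for every compactly supported smooth variation $\hat\gamma_u\in\mathcal V(\mathcal I,\omega^1)$ with $\hat\gamma_0=\hat\gamma^\perp$ (compactly supported: $\hat\gamma_u(t)=\hat\gamma^\perp(t)$ for $t$ outside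 a compact subset of $(a,b)$). *)

(* Defs.v *)
From HB Require Import structures.
From mathcomp Require Import all_boot all_order all_algebra.
From mathcomp Require Import all_classical all_reals all_analysis.
Set Implicit Arguments.
Unset Strict Implicit.
Unset Printing Implicit Defensive.
Import Order.TTheory GRing.Theory Num.Theory.
Import numFieldNormedType.Exports.
Local Open Scope classical_set_scope.
Local Open Scope ring_scope.

Section Smooth.
Context {R : realType} {V W : normedModType R}.

(* C^k on an open set U, for V finite-dimensional. *)
Fixpoint Ck (k : nat) (U : set V) (f : V -> W) : Prop :=
  match k with
  | 0 => forall x, U x -> {for x, continuous f}
  | k'.+1 => (forall x, U x -> differentiable f x) /\
             forall v, Ck k' U (fun x => 'D_v f x)
  end.

Definition smooth_on (U : set V) (f : V -> W) : Prop := forall k, Ck k U f.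

End Smooth.

(* A smooth oriented surface: an oriented atlas on a Hausdorff second-countable
   space. [chart i] is only meaningful on [dom i], and [chartV i] on
   [chart i @` dom i]. *)
Record surface (R : realType) (M : topologicalType) := Surface {
  idx : Type;
  dom : idx -> set M;
  chart : idx -> M -> 'rV[R]_2;
  chartV : idx -> 'rV[R]_2 -> M;
  surface_hausdorff : hausdorff_space M;
  surface_second_countable : @second_countable M;
  dom_open : forall i, open (dom i);
  dom_cover : forall p, exists i, dom i p;
  img_open : forall i, open (chart i @` dom i);
  chartK : forall i p, dom i p -> chartV i (chart i p) = p;
  chart_continuous : forall i p, dom i p -> {for p, continuous (chart i)};
  chartV_continuous : forall i x, (chart i @` dom i) x ->
    {for x, continuous (chartV i)};
  trans_smooth : forall i j,
    smooth_on (chart i @` (dom i `&` dom j)) (chart j \o chartV i);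
  trans_oriented : forall i j p, dom i p -> dom j p ->
    0 < \det (jacobian (chart j \o chartV i) (chart i p))
}.

(* T_p M is identified with R^2 through the chart [chart_at p]; the total space
   carries no topology of its own, its smooth structure being read through
   [tcoord] below. *)
Definition TM (R : realType) (M : topologicalType) (S : surface R M) : Type :=
  (M * 'rV[R]_2)%type.

Section FinslerSurface.
Context {R : realType} {M : topologicalType} {S : surface R M}.

Local Notation R2 := 'rV[R]_2.
Local Notation R4 := ('rV[R]_2 * 'rV[R]_2)%type.
Local Notation TM := (TM S).

Definition trans (i j : idx S) : R2 -> R2 := chart j \o chartV i.

Definition chart_at (p : M) : idx S := projT1 (cid (dom_cover S p)).

(* The coordinates (x, y) of TM induced by the chart i, and their inverse. *)
Definition tcoord (i : idx S) (P : TM) : R4 :=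
  let j := chart_at P.1 in (chart i P.1, 'D_(P.2) (trans j i) (chart j P.1)).

Definition tpoint (i : idx S) (z : R4) : TM :=
  let p := chartV i z.1 in (p, 'D_(z.2) (trans i (chart_at p)) z.1).

Definition ttrans (i j : idx S) (z : R4) : R4 :=
  (trans i j z.1, 'D_(z.2) (trans i j) z.1).

(* The coordinate domain of TM minus its zero section. *)
Definition tdom (i : idx S) : set R4 :=
  [set z | (chart i @` dom i) z.1 /\ z.2 != 0].

Definition loc (i : idx S) (f : TM -> R) (z : R4) : R := f (tpoint i z).

Definition smooth_fun (f : TM -> R) : Prop :=
  forall i, smooth_on (tdom i) (loc i f).

Definition smooth_map (V : normedModType R) (U : set V) (G : V -> TM) : Prop :=
  (forall x, U x -> {for x, continuous (fun x' => (G x').1)}) /\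
  forall i, smooth_on (U `&` [set x | dom i (G x).1]) (tcoord i \o G).

(* One-forms on TM minus the zero section, by their local expressions
   [w i z : R4 -> R] at the point of coordinates z. A form (function) on the
   indicatrix bundle is given by any extension: only values at points of, and
   on vectors tangent to, the indicatrix bundle are used. *)
Definition one_form : Type := idx S -> R4 -> R4 -> R.

Definition is_one_form (w : one_form) : Prop :=
  [/\ forall i z, tdom i z -> linear (w i z : R4 -> R^o),
      forall i v, smooth_on (tdom i) (fun z => w i z v)
    & forall i j z v, tdom i z -> dom j (chartV i z.1) ->
        w i z v = w j (ttrans i j z) ('D_v (ttrans i j) z)].

(* [wedge_form] and [ext_d] are both normalized without the factor 1/2. *)
Definition wedge_form (w w' : one_form) (i : idx S) (z u v : R4) : R :=
  w i z u * w' i z v - w i z v * w' i z u.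

Definition ext_d (w : one_form) (i : idx S) (z u v : R4) : R :=
  'D_u (fun z' => w i z' v) z - 'D_v (fun z' => w i z' u) z.

Definition pullback (w : one_form) (c : R -> TM) (t : R) : R :=
  let i := chart_at (c t).1 in
  w i (tcoord i (c t)) (derive1 (fun s => tcoord i (c s)) t).

Definition dx (k : 'I_2) (f : R4 -> R) (z : R4) : R :=
  'D_((delta_mx 0 k, 0) : R4) f z.

Definition dy (k : 'I_2) (f : R4 -> R) (z : R4) : R :=
  'D_((0, delta_mx 0 k) : R4) f z.

Section Metric.
Variable F : TM -> R.

Definition gmx (i : idx S) (z : R4) : 'M[R]_2 :=
  \matrix_(a, b) (2^-1 * dy a (dy b (fun z' => loc i F z' ^+ 2)) z).

Record finsler : Prop := {
  finsler_ge0 : forall P, 0 <= F P;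
  finsler_smooth : smooth_fun F;
  finsler_homog : forall p (c : R) v, 0 < c -> F (p, c *: v) = c * F (p, v);
  finsler_convex : forall i z, tdom i z ->
    forall v : R2, v != 0 -> 0 < (v *m gmx i z *m v^T) 0 0
}.

Definition omega1 : one_form := fun i z v =>
  Num.sqrt (\det (gmx i z)) / loc i F z *
  (z.2 0 1 * v.1 0 0 - z.2 0 0 * v.1 0 1).

Definition omega2 : one_form := fun i z v =>
  \sum_(a < 2) dy a (loc i F) z * v.1 0 a.

Definition indicatrix (i : idx S) : set R4 :=
  [set z | tdom i z /\ loc i F z = 1].

Definition indicatrix_tangent (i : idx S) (z : R4) : set R4 :=
  [set u | 'D_u (loc i F) z = 0].

Record finsler_coframe (w3 : one_form) (I J K : TM -> R) : Prop := {
  coframe_form : is_one_form w3;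
  coframe_smooth : [/\ smooth_fun I, smooth_fun J & smooth_fun K];
  coframe_free : forall i z u, indicatrix i z -> indicatrix_tangent i z u ->
    omega1 i z u = 0 -> omega2 i z u = 0 -> w3 i z u = 0 -> u = 0;
  coframe_d1 : forall i z u v, indicatrix i z ->
    indicatrix_tangent i z u -> indicatrix_tangent i z v ->
    ext_d omega1 i z u v =
      - loc i I z * wedge_form omega1 w3 i z u v + wedge_form omega2 w3 i z u v;
  coframe_d2 : forall i z u v, indicatrix i z ->
    indicatrix_tangent i z u -> indicatrix_tangent i z v ->
    ext_d omega2 i z u v = - wedge_form omega1 w3 i z u v;
  coframe_d3 : forall i z u v, indicatrix i z ->
    indicatrix_tangent i z u -> indicatrix_tangent i z v ->
    ext_d w3 i z u v =
      loc i K z * wedge_form omega1 omega2 i z u v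
      - loc i J z * wedge_form omega1 w3 i z u v
}.

(* df = f1 w1 + f2 w2 + f3 w3 on the indicatrix bundle. *)
Definition coframe_derivatives (w3 : one_form) (f f1 f2 f3 : TM -> R) : Prop :=
  forall i z u, indicatrix i z -> indicatrix_tangent i z u ->
    'D_u (loc i f) z =
      loc i f1 z * omega1 i z u + loc i f2 z * omega2 i z u
      + loc i f3 z * w3 i z u.

(* Chern connection coefficients:
     C_{abc} = (1/4) d^3(F^2)/dy^a dy^b dy^c = (1/2) dg_{ab}/dy^c,
     gamma^a_{bc} = the formal Christoffel symbols of g_{ab}(x, y),
     N^a_b = gamma^a_{bc} y^c - C^a_{bc} gamma^c_{rs} y^r y^s,
     delta/delta x^c = d/dx^c - N^m_c d/dy^m,
   and Gamma^a_{bc} is gamma^a_{bc} with d/dx replaced by delta/delta x. *)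
Definition gij (i : idx S) (a b : 'I_2) (z : R4) : R := gmx i z a b.

Definition ginv (i : idx S) (a b : 'I_2) (z : R4) : R := invmx (gmx i z) a b.

Definition cartan (i : idx S) (a b c : 'I_2) (z : R4) : R :=
  \sum_(l < 2) ginv i a l z * (2^-1 * dy c (gij i l b) z).

Definition christoffel (i : idx S) (a b c : 'I_2) (z : R4) : R :=
  \sum_(l < 2) 2^-1 * ginv i a l z *
    (dx c (gij i l b) z + dx b (gij i l c) z - dx l (gij i b c) z).

Definition nonlinear_conn (i : idx S) (a b : 'I_2) (z : R4) : R :=
  \sum_(c < 2) christoffel i a b c z * z.2 0 c
  - \sum_(c < 2) \sum_(r < 2) \sum_(s < 2)
      cartan i a b c z * christoffel i c r s z * z.2 0 r * z.2 0 s.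

Definition delta_x (i : idx S) (c : 'I_2) (f : R4 -> R) (z : R4) : R :=
  dx c f z - \sum_(m < 2) nonlinear_conn i m c z * dy m f z.

Definition chern (i : idx S) (a b c : 'I_2) (z : R4) : R :=
  \sum_(l < 2) 2^-1 * ginv i a l z *
    (delta_x i c (gij i l b) z + delta_x i b (gij i l c) z
     - delta_x i l (gij i b c) z).

(* For c = (gamma, N) : R -> TM, the velocity T of gamma, and D_T^(N) U for U a
   vector field along gamma, both as elements of T_{gamma(t)} M. *)
Definition velocity (c : R -> TM) (t : R) : R2 :=
  derive1 (fun s => chart (chart_at (c t).1) (c s).1) t.

Definition cov_deriv (c : R -> TM) (U : R -> R2) (t : R) : R2 :=
  let i := chart_at (c t).1 in
  let Ui := fun s => (tcoord i ((c s).1, U s)).2 in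
  \row_a (derive1 Ui t 0 a
    + \sum_(j < 2) \sum_(k < 2)
        velocity c t 0 j * Ui t 0 k * chern i a j k (tcoord i (c t))).

Definition sigma (c : R -> TM) : R -> R := pullback omega1 c.

Definition parallel_curvature (a b : R) (c : R -> TM) (k : R -> R) : Prop :=
  forall t, a < t < b ->
    cov_deriv c (fun s => (c s).2) t = - (k t / sigma c t ^+ 2) *: velocity c t.

(* The parametrized curves (a, b) -> Sigma representing elements of V(I, w1). *)
Record admissible (a b : R) (c : R -> TM) : Prop := {
  admissible_smooth : smooth_map `]a, b[ c;
  admissible_unit : forall t, a < t < b -> F (c t) = 1;
  admissible_omega2 : forall t, a < t < b -> pullback omega2 c t = 0;
  admissible_omega1 : forall t, a < t < b -> pullback omega1 c t != 0
}.

(* The functional restricted to a compact parameter interval. *)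
Definition Phi (t0 t1 : R) (c : R -> TM) : R :=
  \int[lebesgue_measure]_(t in `[t0, t1]) pullback omega1 c t.

(* Variations (u, t) |-> G u t, for |u| < e, supported in [t0, t1]. *)
Record smooth_variation (a b : R) (c : R -> TM) (e t0 t1 : R) (G : R -> R -> TM)
    : Prop := {
  variation_smooth : smooth_map
    [set ut : R * R | `|ut.1| < e /\ a < ut.2 < b] (fun ut => G ut.1 ut.2);
  variation_admissible : forall u, `|u| < e -> admissible a b (G u);
  variation_init : forall t, a < t < b -> G 0 t = c t;
  variation_support : forall u t, `|u| < e -> a < t < b ->
    ~~ (t0 <= t <= t1) -> G u t = c t
}.

(* The integral over (a, b) may diverge; since the variation is constant outside
   [t0, t1], only the integral over [t0, t1] varies. *)
Definition extremal (a b : R) (c : R -> TM) : Prop :=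
  forall (e t0 t1 : R) (G : R -> R -> TM),
    0 < e -> a < t0 -> t0 < t1 -> t1 < b -> smooth_variation a b c e t0 t1 G ->
    is_derive (0 : R) 1 (fun u => Phi t0 t1 (G u)) 0.

End Metric.
End FinslerSurface.

Arguments one_form {R M} S.

(* Main.v *)
(** Let V be the variation field of a family of curves c annihilated by omega2.
    Cartan's formula for omega1 and omega2 and the structure equations give
      V(omega1(c')) = (omega1(V) - I omega2(V))' + omega2(V) E,
      E = (I o c)' + omega3(c'),
    so the first variation of the functional is the integral of omega2(V) E.
    Moreover E = I1 sigma + (I3 + 1) omega3(c') with omega3(c') = - k / sigma,
    the latter by evaluating d omega1 and d omega2 on c' and the geodesic spray
    (on which omega1 = 0 and omega2 = 1, hence omega3 = 0). This settles
    sufficiency. For necessity, a curve annihilated by omega2 is recovered from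
    its projection to M by the implicit function theorem; lifting
    gamma + u phi N, with phi a bump function, gives a variation with
    omega2(V) = phi, hence E = 0. *)

From HB Require Import structures.
Require Import Defs.
From mathcomp Require Import all_boot all_order all_algebra.
From mathcomp Require Import all_classical all_reals all_analysis.
From mathcomp Require Import ring lra.
Set Implicit Arguments.
Unset Strict Implicit.
Unset Printing Implicit Defensive.
Import Order.TTheory GRing.Theory Num.Theory.
Import numFieldNormedType.Exports.
Local Open Scope classical_set_scope.
Local Open Scope ring_scope.

(** * Smooth maps between normed spaces *)

(** The necessity part is shaped by the constraint: omega2 must vanish on every curve of a
    variation, which couples the base curve with N, so a curve cannot be bent freely inside the
    indicatrix bundle. The projected curve is therefore the free datum. For a given velocity T, N is
    sought on a line N0 + s T0; the s-derivative of omega2 at the start is g_N0(T0, T0) > 0 by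
    strict convexity, so an implicit function theorem with one scalar unknown, based on
    monotonicity, is enough. The other obstacle is that omega3 is known only through the structure
    equations, while k comes from the Chern connection. They meet on the spray S: d omega2(., S) = 0
    is the geodesic equation of F^2/2, and d omega1(S, u) = lam omega1(u), when D_T N = lam T, rests
    on the two-dimensional identity tr(C) y^T = (Cy)^T + y^(CT), where C is the Chern connection
    contracted with y and tr(C) is the logarithmic derivative along S of the coefficient of omega1.
    Since [Ck] differentiates in fixed directions and [chart_at] jumps from point to point, moving
    directions are expanded over a basis and a chart is frozen before each differentiation. *)

Section Differentials.
Context {R : realType}.
Implicit Types V W X : normedModType R.

(** The small-o condition as an explicit estimate against a candidate differential [L]. The implicit
    function, and [flat] at 0, are differentiated through it. *)
Lemma diffP_eps V W (f : V -> W) (x : V) (L : {linear V -> W}) :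
  continuous L ->
  (forall e : R, 0 < e -> \forall h \near 0,
     `|f (h + x) - f x - L h| <= e * `|h|) ->
  differentiable f x /\ 'd f x = L :> (V -> W).
Proof.
move=> Lc H.
have E : f \o shift x = cst (f x) + L +o_ 0 id.
  apply/eqaddoP => e e0; near=> h.
  rewrite /= !fctE opprD addrA; near: h; exact: H.
have dE := diff_unique Lc E.
split=> //; apply/diff_locallyP; rewrite dE; split=> //.
Unshelve. all: by end_near. Qed.

Lemma near_eq_differentiable V W (f g : V -> W) (x : V) :
  (\forall y \near x, f y = g y) -> differentiable g x ->
  differentiable f x.
Proof.
move=> fg dg.
have [H _] : differentiable f x /\ 'd f x = 'd g x :> (V -> W); last exact: H.
apply: (diffP_eps (L := 'd g x)) => [|e e0]; first exact: diff_continuous.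
have /eqaddoP/(_ e e0) H := diff_locally dg.
rewrite (nbhs_singleton fg).
have : \forall h \near (0:V), f (h + x) = g (h + x).
  by move: fg; rewrite (near_shift 0 x) /= ; apply: filterS => h; rewrite /= subr0.
move=> H2; near=> h; rewrite (near H2 h) //.
have : `|(g \o shift x - (cst (g x) + 'd g x)) h| <= e * `|id h| by near: h.
by rewrite !fctE /= opprD addrA.
Unshelve. all: by end_near. Qed.

Lemma derive_linear_post V W X (L : {linear W -> X}) (f : V -> W) x v :
  continuous L -> differentiable f x ->
  differentiable (L \o f) x /\ 'D_v (L \o f) x = L ('D_v f x).
Proof.
move=> Lc df.
have dL : differentiable L (f x) by apply: linear_differentiable.
have dc : differentiable (L \o f) x by apply: differentiable_comp.
split; first exact: dc.
by rewrite (deriveE _ dc) (deriveE _ df) (diff_comp df dL) /= (diff_lin _ Lc).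
Qed.

Lemma derive_linear V W (L : {linear V -> W}) x v :
  continuous L -> 'D_v L x = L v.
Proof.
move=> Lc; by rewrite (deriveE _ (linear_differentiable x Lc)) (diff_lin _ Lc).
Qed.

Lemma derive_comp V W X (f : V -> W) (g : W -> X) x v :
  differentiable f x -> differentiable g (f x) ->
  'D_v (g \o f) x = 'D_('D_v f x) g (f x).
Proof.
move=> df dg.
by rewrite (deriveE _ (differentiable_comp df dg)) (deriveE _ df) (deriveE _ dg) (diff_comp df dg).
Qed.

End Differentials.

Section Findim.
Context {R : realType}.

(** A normed module carries no dimension, so finite dimension is a reconstruction formula with
    continuous coordinates. This form passes to products and lets a derivative in a moving direction
    be expanded over the fixed directions [e i]. *)
Definition findim (V : normedModType R) :=
  exists n (e : 'I_n -> V) (l : 'I_n -> {linear V -> R}),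
    (forall i, continuous (l i)) /\ forall v, v = \sum_i l i v *: e i.

Lemma findimR : findim (R : normedModType R).
Proof.
exists 1, (fun=> 1), (fun=> idfun); split=> [i|v]; first by move=> x; exact: cvg_id.
by rewrite big_ord1 /= /GRing.scale /= mulr1.
Qed.

Definition coord_lin n (j : 'I_n.+1) (v : 'rV[R]_n.+1) : R := v 0 j.

Lemma coord_lin_linear n j : linear (@coord_lin n j).
Proof. by move=> a u v; rewrite /coord_lin !mxE. Qed.

HB.instance Definition _ n j :=
  GRing.isLinear.Build R 'rV[R]_n.+1 R _ (@coord_lin n j) (@coord_lin_linear n j).

Lemma findim_rV n : findim 'rV[R]_n.+1.
Proof.
exists n.+1, (fun j => delta_mx 0 j), (fun j => @coord_lin n j); split.
  by move=> i x; exact: coord_continuous.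
by move=> v; rewrite [LHS]row_sum_delta.
Qed.

Lemma findim_prod (V W : normedModType R) :
  findim V -> findim W -> findim (V * W)%type.
Proof.
move=> [n [e [l [lc lE]]]] [m [e' [l' [lc' lE']]]].
exists (n + m)%N, (fun i => match fintype.split i with inl j => (e j, 0) | inr j => (0, e' j) end).
exists (fun i => match fintype.split i with inl j => (l j \o fst) : {linear _ -> _} | inr j => (l' j \o snd)  : {linear _ -> _} end).
split.
  move=> i; case: (fintype.split i) => j x /=.
    apply: continuous_comp; [exact: cvg_fst|exact: lc].
  apply: continuous_comp; [exact: cvg_snd|exact: lc'].
move=> [v w]; rewrite big_split_ord /=.
under eq_bigr => i _ do rewrite (unsplitK (inl i)) /=.
under [X in _ + X]eq_bigr => i _ do rewrite (unsplitK (inr i)) /=.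
have -> : \sum_(i < n) l i v *: ((e i, 0) : V * W) = (v, 0).
  rewrite [in RHS](lE v); elim/big_ind2: _ => //=.
    by move=> x1 _ y1 _ -> ->; congr pair; rewrite /= addr0.
  by move=> i _; congr pair; rewrite /= scaler0.
have -> : \sum_(i < m) l' i w *: ((0, e' i) : V * W) = (0, w).
  rewrite [in RHS](lE' w); elim/big_ind2: _ => //=.
    by move=> x1 _ y1 _ -> ->; congr pair; rewrite /= addr0.
  by move=> i _; congr pair; rewrite /= scaler0.
by congr pair; rewrite /= ?addr0 ?add0r.
Qed.

End Findim.

Section CkCalculus.
Context {R : realType}.
Implicit Types V W X : normedModType R.

Lemma CkS V W k (U : set V) (f : V -> W) :
  Ck k.+1 U f <-> (forall x, U x -> differentiable f x) /\
    forall v, Ck k U (fun x => 'D_v f x).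
Proof. by []. Qed.

(** The induction on [k] goes through because functions equal on an open set have equal directional
    derivatives there. Passing between charts and gluing pieces of a variation both rest on this
    lemma. *)
Lemma Ck_local V W k (U : set V) (f : V -> W) :
  (forall x, U x -> exists A (g : V -> W),
     [/\ open A, A x, Ck k A g & forall y, A y -> f y = g y]) ->
  Ck k U f.
Proof.
elim: k f => [|k IH] f H.
  move=> x /H [A [g [oA Ax gc fg]]].
  have nfg : \forall y \near x, g y = f y.
    by apply: filterS (open_nbhs_nbhs (conj oA Ax)) => y /fg.
  rewrite /prop_for /continuous_at (fg _ Ax); apply: cvg_trans (gc _ Ax).
  exact: near_eq_cvg.
apply/CkS; split.
  move=> x /H [A [g [oA Ax /CkS[gd _] fg]]].
  apply: (near_eq_differentiable (g := g)); last exact: gd.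
  by apply: filterS (open_nbhs_nbhs (conj oA Ax)) => y /fg.
move=> v; apply: IH => x /H [A [g [oA Ax /CkS[_ gd] fg]]].
exists A, (fun x => 'D_v g x); split => // y Ay.
apply: near_eq_derive.
by apply: filterS (open_nbhs_nbhs (conj oA Ay)) => z /fg.
Qed.

Lemma Ck_sub V W k (A U : set V) (f : V -> W) : A `<=` U -> Ck k U f -> Ck k A f.
Proof.
move=> AU; elim: k f => [|k IH] f; first by move=> H x /AU /H.
by move=> /CkS[d H]; apply/CkS; split=> [x /AU /d //|v]; exact: IH.
Qed.

Lemma Ck_eq V W k (U : set V) (f g : V -> W) :
  open U -> (forall x, U x -> f x = g x) -> Ck k U g -> Ck k U f.
Proof. by move=> oU fg gk; apply: Ck_local => x Ux; exists U, g. Qed.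

Lemma CkW V W k (U : set V) (f : V -> W) : Ck k.+1 U f -> Ck k U f.
Proof.
elim: k f => [|k IH] f.
  by move=> /CkS[d _] x /d dx; exact: differentiable_continuous dx.
by move=> /CkS[d H]; apply/CkS; split=> // v; apply: IH.
Qed.

Lemma Ck_differentiable V W k (U : set V) (f : V -> W) x :
  Ck k.+1 U f -> U x -> differentiable f x.
Proof. by move=> /CkS[H _] /H. Qed.

Lemma Ck_derive V W k (U : set V) (f : V -> W) v :
  Ck k.+1 U f -> Ck k U (fun x => 'D_v f x).
Proof. by move=> /CkS[]. Qed.

Lemma Ck_cst V W k (U : set V) (c : W) : Ck k U (fun=> c).
Proof.
elim: k c => [|k IH] c; first by move=> x _; exact: cst_continuous.
apply/CkS; split=> [x _|v]; first exact: differentiable_cst.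
have -> : (fun x : V => 'D_v (fun=> c) x) = (fun=> 0).
  by apply/funext => x; exact: derive_cst.
exact: IH.
Qed.

Lemma Ck_linear V W k (U : set V) (L : {linear V -> W}) :
  continuous L -> Ck k U L.
Proof.
move=> Lc; case: k => [|k]; first by move=> x _; exact: Lc.
apply/CkS; split=> [x _|v]; first exact: linear_differentiable.
have -> : (fun x : V => 'D_v L x) = (fun=> L v).
  by apply/funext => x; exact: derive_linear.
exact: Ck_cst.
Qed.

Lemma Ck_post V W X k (U : set V) (L : {linear W -> X}) (f : V -> W) :
  open U -> continuous L -> Ck k U f -> Ck k U (fun x => L (f x)).
Proof.
move=> oU Lc; elim: k f => [|k IH] f.
  by move=> fc x Ux; apply: continuous_comp; [exact: fc|exact: Lc].
move=> /CkS[d H]; apply/CkS; split.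
  by move=> x Ux; have [] := derive_linear_post 0 Lc (d _ Ux).
move=> v; apply: (Ck_eq oU _ (IH _ (H v))) => x Ux.
by have [_ ->] := derive_linear_post v Lc (d _ Ux).
Qed.

Lemma Ck_add V W k (U : set V) (f g : V -> W) :
  open U -> Ck k U f -> Ck k U g -> Ck k U (fun x => f x + g x).
Proof.
move=> oU; elim: k f g => [|k IH] f g.
  by move=> fc gc x Ux; apply: continuousD; [exact: fc|exact: gc].
move=> /CkS[df Hf] /CkS[dg Hg]; apply/CkS; split.
  by move=> x Ux; apply: differentiableD; [exact: df|exact: dg].
move=> v; apply: (Ck_eq oU _ (IH _ _ (Hf v) (Hg v))) => x Ux.
by rewrite deriveD //; apply: diff_derivable; [exact: df|exact: dg].
Qed.

Lemma Ck_sum V W k (U : set V) n (f : 'I_n -> V -> W) :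
  open U -> (forall i, Ck k U (f i)) -> Ck k U (fun x => \sum_i f i x).
Proof.
move=> oU; elim: n f => [|n IH] f H.
  apply: (Ck_eq oU _ (Ck_cst k U 0)) => x _; by rewrite big_ord0.
apply: (Ck_eq oU _ (Ck_add oU (IH _ (fun i => H (widen_ord (leqnSn n) i))) (H ord_max))) => x _.
by rewrite big_ord_recr.
Qed.

Lemma Ck_mul V k (U : set V) (f g : V -> R) :
  open U -> Ck k U f -> Ck k U g -> Ck k U (fun x => f x * g x).
Proof.
move=> oU; elim: k f g => [|k IH] f g.
  by move=> fc gc x Ux; apply: continuousM; [exact: fc|exact: gc].
move=> fk gk; have /CkS[df Hf] := fk; have /CkS[dg Hg] := gk; apply/CkS; split.
  by move=> x Ux; apply: differentiableM; [exact: df|exact: dg].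
move=> v; apply: (Ck_eq oU _ (Ck_add oU (IH _ _ (CkW fk) (Hg v)) (IH _ _ (CkW gk) (Hf v)))) => x Ux.
by rewrite [LHS]deriveM //; apply: diff_derivable; [exact: df|exact: dg].
Qed.

Lemma Ck_scale V W k (U : set V) (f : V -> R) (w : W) :
  open U -> Ck k U f -> Ck k U (fun x => f x *: w).
Proof.
move=> oU; elim: k f => [|k IH] f.
  move=> fc x Ux; apply: (@continuous_comp _ _ _ f (fun r : R => r *: w)); [exact: fc|exact: scalel_continuous].
move=> /CkS[d H]; apply/CkS; split=> [x Ux|v]; first by apply: differentiableZl; exact: d.
apply: (Ck_eq oU _ (IH _ (H v))) => x Ux.
rewrite (deriveE _ (differentiableZl w (d _ Ux))) (deriveE _ (d _ Ux)).
by rewrite diffZl //; exact: d.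
Qed.

Lemma Ck_opp V k (U : set V) (f : V -> R) :
  open U -> Ck k U f -> Ck k U (fun x => - f x).
Proof.
move=> oU fk; apply: (Ck_eq oU (g := fun x => -1 * f x)).
  by move=> x _; rewrite mulN1r.
by apply: Ck_mul => //; exact: Ck_cst.
Qed.

Lemma Ck_sub_fun V k (U : set V) (f g : V -> R) :
  open U -> Ck k U f -> Ck k U g -> Ck k U (fun x => f x - g x).
Proof. by move=> oU fk gk; apply: Ck_add => //; apply: Ck_opp. Qed.

Lemma Ck_exp V k (U : set V) (f : V -> R) n :
  open U -> Ck k U f -> Ck k U (fun x => f x ^+ n).
Proof.
move=> oU fk; elim: n => [|n IH].
  apply: (Ck_eq oU (g := fun=> (1 : R))); last exact: Ck_cst.
  by move=> x _; rewrite expr0.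
apply: (Ck_eq oU (g := fun x => f x * f x ^+ n)); last exact: Ck_mul.
by move=> x _; rewrite exprS.
Qed.

Lemma Ck_coords V W k (U : set V) (f : V -> W) :
  findim W -> open U ->
  (forall L : {linear W -> R}, continuous L -> Ck k U (fun x => L (f x))) ->
  Ck k U f.
Proof.
move=> [n [e [l [lc lE]]]] oU H.
apply: (Ck_eq oU (g := fun x => \sum_i l i (f x) *: e i)); first by move=> x _.
by apply: Ck_sum => // i; apply: Ck_scale => //; apply: H.
Qed.

(** The chain rule differentiates [g] in the direction 'D_v f x, which moves with [x], whereas [Ck]
    controls fixed directions only. Expanding 'D_v f x over the [e i] restores fixed directions and
    closes the induction. *)
Lemma Ck_compR V W k (U : set V) (A : set W) (f : V -> W) (g : W -> R) :
  findim W -> open U -> (forall x, U x -> A (f x)) ->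
  Ck k U f -> Ck k A g -> Ck k U (fun x => g (f x)).
Proof.
move=> [n [e [l [lc lE]]]] oU UA; elim: k g => [|k IH] g.
  move=> fc gc x Ux; apply: continuous_comp; [exact: fc|apply: gc; exact: UA].
move=> fk gk; have /CkS[df Hf] := fk; have /CkS[dg Hg] := gk; apply/CkS; split.
  move=> x Ux; apply: differentiable_comp; [exact: df|apply: dg; exact: UA].
move=> v; apply: (Ck_eq oU (g := fun x => \sum_i l i ('D_v f x) * 'D_(e i) g (f x))).
  move=> x Ux; have dgx := dg _ (UA _ Ux).
  rewrite [LHS](derive_comp v (df _ Ux) dgx).
  rewrite (deriveE _ dgx) {1}(lE ('D_v f x)) linear_sum.
  apply: eq_bigr => i _; by rewrite linearZ (deriveE _ dgx).
apply: Ck_sum => // i; apply: Ck_mul => //.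
  by apply: Ck_post => //; exact: Hf.
apply: (IH (fun y => 'D_(e i) g y)); [exact: CkW|exact: Hg].
Qed.

Lemma Ck_comp V W X k (U : set V) (A : set W) (f : V -> W) (g : W -> X) :
  findim W -> findim X -> open U -> open A -> (forall x, U x -> A (f x)) ->
  Ck k U f -> Ck k A g -> Ck k U (fun x => g (f x)).
Proof.
move=> fW fX oU oA UA fk gk; apply: (Ck_coords fX oU) => L Lc.
by apply: (@Ck_compR _ _ _ _ A f (fun y => L (g y))) => //; exact: Ck_post.
Qed.

Lemma Ck_id V k (U : set V) : Ck k U (fun x : V => x).
Proof. by apply: (@Ck_linear _ _ k U idfun) => x; exact: cvg_id. Qed.

Lemma Ck_pair V W X k (U : set V) (f : V -> W) (g : V -> X) :
  findim W -> findim X ->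
  open U -> Ck k U f -> Ck k U g -> Ck k U (fun x => (f x, g x)).
Proof.
move=> fW fX oU fk gk; apply: Ck_coords => //; first exact: findim_prod.
move=> L Lc.
(* A functional on the product splits as L(w, x) = L(w, 0) + L(0, x). *)
pose lf (w : W) : R := L (w, 0).
pose lg (w : X) : R := L (0, w).
have lfl : linear lf.
  move=> a u v; rewrite /lf -linearP; congr (L _); congr pair => /=.
  by rewrite scaler0 addr0.
have lgl : linear lg.
  move=> a u v; rewrite /lg -linearP; congr (L _); congr pair => /=.
  by rewrite scaler0 addr0.
pose Lf : {linear W -> R} := HB.pack lf (GRing.isLinear.Build _ _ _ _ _ lfl).
pose Lg : {linear X -> R} := HB.pack lg (GRing.isLinear.Build _ _ _ _ _ lgl).
apply: (Ck_eq oU (g := fun x => Lf (f x) + Lg (g x))).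
  move=> x _; rewrite -[RHS](linearD L); congr (L _); congr pair => /=.
    by rewrite addr0.
  by rewrite add0r.
apply: Ck_add => //; apply: Ck_post => //.
  move=> x; apply: continuous_comp; last exact: Lc.
  by apply: cvg_pair; [exact: cvg_id|exact: cvg_cst].
move=> x; apply: continuous_comp; last exact: Lc.
by apply: cvg_pair; [exact: cvg_cst|exact: cvg_id].
Qed.

Lemma Ck_fst V W X k (U : set V) (f : V -> W * X) :
  open U -> Ck k U f -> Ck k U (fun x => (f x).1).
Proof.
move=> oU fk; apply: (@Ck_post _ _ _ k U fst) => // x; exact: cvg_fst.
Qed.

Lemma Ck_snd V W X k (U : set V) (f : V -> W * X) :
  open U -> Ck k U f -> Ck k U (fun x => (f x).2).
Proof.
move=> oU fk; apply: (@Ck_post _ _ _ k U snd) => // x; exact: cvg_snd.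
Qed.

Lemma Ck_coord V n k (U : set V) (f : V -> 'rV[R]_n.+1) j :
  open U -> Ck k U f -> Ck k U (fun x => f x 0 j).
Proof.
move=> oU fk; apply: (@Ck_post _ _ _ k U (@coord_lin R n j)) => // x.
exact: coord_continuous.
Qed.

Lemma Ck_rV V n k (U : set V) (f : V -> 'rV[R]_n.+1) :
  open U -> (forall j, Ck k U (fun x => f x 0 j)) -> Ck k U f.
Proof.
move=> oU H; apply: (Ck_eq oU (g := fun x => \sum_j f x 0 j *: delta_mx 0 j)).
  by move=> x _; rewrite -row_sum_delta.
by apply: Ck_sum => // j; apply: Ck_scale.
Qed.

End CkCalculus.

Section CkMore.
Context {R : realType}.
Implicit Types V W X : normedModType R.

Lemma Ck_inv V k (U : set V) (f : V -> R) :
  open U -> (forall x, U x -> f x != 0) -> Ck k U f -> Ck k U (fun x => (f x)^-1).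
Proof.
move=> oU f0; elim: k => [|k IH].
  by move=> fc x Ux; apply: continuousV; [exact: f0|exact: fc].
move=> fk; have /CkS[df Hf] := fk; apply/CkS; split.
  by move=> x Ux; apply: differentiableV; [exact: df|exact: f0].
move=> v; apply: (Ck_eq oU (g := fun x => - ((f x)^-1 ^+ 2) * 'D_v f x)).
  move=> x Ux; rewrite [LHS](deriveV (f0 _ Ux)); last by apply: diff_derivable; exact: df.
  by rewrite exprVn.
by apply: Ck_mul => //; apply: Ck_opp => //; apply: Ck_exp => //; apply: IH; exact: CkW.
Qed.

Lemma differentiable_line V (p v : V) s : differentiable (fun s : R => p + s *: v) s.
Proof.
apply: differentiableD; first exact: differentiable_cst.
by apply: differentiableZl; exact: ex_diff.
Qed.

Lemma derive_line V (p v : V) s : 'D_1 (fun s : R => p + s *: v) s = v.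
Proof.
rewrite deriveD; [|exact: derivable_cst|]; last first.
  by apply: diff_derivable; apply: differentiableZl; exact: ex_diff.
rewrite derive_cst add0r deriveE; last by apply: differentiableZl; exact: ex_diff.
by rewrite diffZl; [rewrite diff_val scale1r|exact: ex_diff].
Qed.

Lemma is_derive_line V (f : V -> R) (p v : V) (s : R) :
  differentiable f (p + s *: v) ->
  is_derive s 1 (fun s : R => f (p + s *: v)) ('D_v f (p + s *: v)).
Proof.
move=> df; have dl := differentiable_line p v s.
have dc : differentiable (fun s : R => f (p + s *: v)) s.
  exact: (differentiable_comp (g := f) dl df).
apply: DeriveDef; first exact: diff_derivable.
by rewrite [LHS](derive_comp (V := R) (g := f) 1 dl df) derive_line.
Qed.

Lemma mvt_line V (f : V -> R) (p v : V) (h : R) : 0 < h ->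
  (forall s : R, 0 <= s <= h -> differentiable f (p + s *: v)) ->
  exists2 s : R, 0 <= s <= h & f (p + h *: v) - f p = 'D_v f (p + s *: v) * h.
Proof.
move=> h0 df.
have D s : s \in `[0, h] -> is_derive s 1 (fun s : R => f (p + s *: v)) ('D_v f (p + s *: v)).
  by rewrite in_itv /= => sh; apply: is_derive_line; exact: df.
have [|s sh E] := MVT h0 (fun s sh => D s (subset_itv_oo_cc sh)).
  apply: derivable_within_continuous => s sh; have [] := D s sh; by [].
exists s; first by move/subset_itv_oo_cc: sh; rewrite in_itv.
by move: E; rewrite subr0 scale0r addr0.
Qed.

(** Two mean value theorems: in direction [u] for the increment f(y + h v) - f(y), then in direction
    [v] for 'D_u f. The second difference on the left is symmetric in [u] and [v], which is the
    source of Schwarz's theorem. *)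
Lemma schwarz_increment V (f : V -> R) (U : set V) (p u v : V) (h : R) :
  Ck 2 U f -> 0 < h ->
  (forall s t : R, 0 <= s <= h -> 0 <= t <= h -> U (p + s *: u + t *: v)) ->
  exists s t : R, [/\ 0 <= s <= h, 0 <= t <= h &
    f (p + h *: u + h *: v) - f (p + h *: u) - f (p + h *: v) + f p =
    'D_v (fun y => 'D_u f y) (p + s *: u + t *: v) * h ^+ 2].
Proof.
move=> fk h0 HU; have /CkS[df /(_ u)/CkS[ddf _]] := fk.
have h00 : (0:R) <= 0 <= h by rewrite lexx ltW.
have hhh : 0 <= h <= h by rewrite lexx ltW.
pose g y := f (y + h *: v) - f y.
have dsh y : differentiable (fun y : V => y + h *: v) y.
  by apply: differentiableD; [exact: ex_diff|exact: differentiable_cst].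
have Dsh y : 'D_u (fun y : V => y + h *: v) y = u.
  rewrite deriveD; [|exact: derivable_id|exact: derivable_cst].
  by rewrite derive_id derive_cst addr0.
have dg s : 0 <= s <= h -> differentiable (fun y => f (y + h *: v)) (p + s *: u) /\ differentiable f (p + s *: u).
  move=> sh; split; last by apply: df; have := HU s 0 sh h00; rewrite scale0r addr0.
  by apply: (differentiable_comp (g := f) (dsh _)); apply: df; exact: HU.
have [s sh Es] : exists2 s, 0 <= s <= h & g (p + h *: u) - g p = 'D_u g (p + s *: u) * h.
  apply: (mvt_line h0) => s sh; have [d1 d2] := dg _ sh.
  exact: differentiableB d1 d2.
have Dg : 'D_u g (p + s *: u) = 'D_u f (p + s *: u + h *: v) - 'D_u f (p + s *: u).
  have [d1 d2] := dg _ sh.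
  rewrite /g [LHS]deriveB; [|exact: diff_derivable d1|exact: diff_derivable d2].
  congr (_ - _); rewrite [LHS](derive_comp (g := f) u (dsh _)) ?Dsh //.
  by apply: df; exact: HU.
have [t th Et] : exists2 t, 0 <= t <= h & 'D_u f (p + s *: u + h *: v) - 'D_u f (p + s *: u) =
   'D_v (fun y => 'D_u f y) (p + s *: u + t *: v) * h.
  by apply: (mvt_line (f := fun y => 'D_u f y) (p := p + s *: u) (v := v) h0) => t th; apply: ddf; exact: HU.
exists s, t; split => //.
rewrite expr2 mulrA -Et -Dg -Es /g; ring.
Qed.

Lemma near_continuous2 V (f g : V -> R) (U : set V) (x : V) (e : R) :
  0 < e -> nbhs x U -> {for x, continuous f} -> {for x, continuous g} ->
  \forall y \near x, [/\ U y, `|f x - f y| < e & `|g x - g y| < e].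
Proof.
move=> e0 NU /cvgrPdist_lt/(_ _ e0) N2 /cvgrPdist_lt/(_ _ e0) N3.
by apply: filterS3 NU N2 N3.
Qed.

Lemma dist_half_triangle (a b c e : R) :
  `|a - c| < e / 2 -> `|b - c| < e / 2 -> `|a - b| <= e.
Proof.
move=> H1 H2; rewrite [e]splitr (le_trans (ler_distD c _ _)) // lerD ?(ltW H1) //.
by rewrite distrC ltW.
Qed.

Lemma schwarz V (f : V -> R) (U : set V) (x u v : V) :
  open U -> U x -> Ck 2 U f ->
  'D_u (fun y => 'D_v f y) x = 'D_v (fun y => 'D_u f y) x.
Proof.
move=> oU Ux fk.
have cont w w' : {for x, continuous (fun y => 'D_w (fun z => 'D_w' f z) y)}.
  have /CkS[_ /(_ w')/CkS[_ /(_ w) H]] := fk; exact: H.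
apply/eqP; rewrite -subr_eq0 -normr_le0; apply/ler_addgt0Pr => e e0; rewrite add0r.
have e2 : 0 < e / 2 by rewrite divr_gt0.
have N := near_continuous2 e2 (open_nbhs_nbhs (conj oU Ux)) (cont u v) (cont v u).
have /nbhs_ballP[d /= d0 Hd] := N.
(* Keeps the parallelogram spanned by h u and h v within d of x; the summand 1 makes the denominator
   positive even for u = v = 0. *)
pose h := d / (2 * (`|u| + `|v| + 1)).
have uv0 : 0 < `|u| + `|v| + 1 by rewrite ltr_pwDr // addr_ge0.
have h0 : 0 < h by rewrite divr_gt0 // mulr_gt0.
have B w w' s t : `|w| + `|w'| = `|u| + `|v| -> 0 <= s <= h -> 0 <= t <= h -> ball x d (x + s *: w + t *: w').
  move=> ww /andP[s0 sh] /andP[t0 th]; rewrite -ball_normE /ball_ /=.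
  rewrite -addrA opprD addrA subrr sub0r normrN.
  apply: le_lt_trans (ler_normD _ _) _; rewrite !normrZ !ger0_norm //.
  apply: (@le_lt_trans _ _ (h * (`|u| + `|v|))).
    by rewrite -ww mulrDr lerD // ler_wpM2r.
  apply: (@lt_trans _ _ (h * (`|u| + `|v| + 1))).
    by rewrite ltr_pM2l // ltrDl.
  rewrite /h invfM mulrA mulfVK ?gt_eqF //; lra.
have Buv s t := B u v s t erefl.
have Bvu s t := B v u s t (addrC _ _).
have [s [t [sh th E1]]] := schwarz_increment fk h0
  (fun s t sh th => let: And3 H _ _ := Hd _ (Buv s t sh th) in H).
have [s' [t' [sh' th' E2]]] := schwarz_increment fk h0
  (fun s t sh th => let: And3 H _ _ := Hd _ (Bvu s t sh th) in H).
have [_ _ N1] := Hd _ (Buv s t sh th).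
have [_ N2 _] := Hd _ (Bvu s' t' sh' th').
(* Both sides times h^2 are the same second difference. The two mixed derivatives thus agree at two
   points near x, and continuity carries the equality to x. *)
have EE : 'D_v (fun z => 'D_u f z) (x + s *: u + t *: v) = 'D_u (fun z => 'D_v f z) (x + s' *: v + t' *: u).
  have h20 : h ^+ 2 != 0 by rewrite expf_neq0 // gt_eqF.
  have E3 : f (x + h *: u + h *: v) - f (x + h *: u) - f (x + h *: v) + f x =
      f (x + h *: v + h *: u) - f (x + h *: v) - f (x + h *: u) + f x.
    by rewrite (addrAC x) [X in X + _]addrAC.
  exact: (mulIf h20 (etrans (esym E1) (etrans E3 E2))).
move: N1 N2; rewrite EE => N1 N2.
exact: dist_half_triangle N2 N1.
Qed.

End CkMore.

Section CkScalar.
Context {R : realType}.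
Implicit Types V W X : normedModType R.

Lemma for_continuous_pair V W X (f : V -> W) (g : V -> X) x :
  {for x, continuous f} -> {for x, continuous g} ->
  {for x, continuous (fun y => (f y, g y))}.
Proof. by move=> fc gc; apply: cvg_pair. Qed.

Lemma near_lt_continuous V (f : V -> R) x c :
  {for x, continuous f} -> f x < c -> \forall y \near x, f y < c.
Proof. by move=> fc fx; apply: cvgr_lt fc _ fx. Qed.

Lemma near_gt_continuous V (f : V -> R) x c :
  {for x, continuous f} -> c < f x -> \forall y \near x, c < f y.
Proof. by move=> fc fx; apply: cvgr_gt fc _ fx. Qed.

Lemma derive_comp_scalar V (g : R -> R) (f : V -> R) x v :
  derivable g (f x) 1 -> differentiable f x ->
  'D_v (fun y => g (f y)) x = 'D_1 g (f x) * 'D_v f x.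
Proof.
move=> /derivable1_diffP dg df.
rewrite [LHS](derive_comp v df dg) !(deriveE _ dg).
by rewrite -[X in 'd _ _ X]mulr1 [LHS]linearZ mulrC.
Qed.

Lemma Ck_deriv k (U : set R) (f : R -> R) :
  open U -> (forall x, U x -> derivable f x 1) ->
  Ck k U (fun x => 'D_1 f x) -> Ck k.+1 U f.
Proof.
move=> oU df fk; apply/CkS; split.
  by move=> x Ux; apply/derivable1_diffP; exact: df.
move=> v; apply: (Ck_eq oU (g := fun x => 'D_1 f x * v)).
  move=> x Ux; have /derivable1_diffP d := df _ Ux.
  by rewrite !(deriveE _ d) -[X in 'd _ _ X]mulr1 [LHS]linearZ mulrC.
by apply: Ck_mul => //; exact: Ck_cst.
Qed.

Lemma Ck_sqrt V k (U : set V) (f : V -> R) :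
  open U -> (forall x, U x -> 0 < f x) -> Ck k U f -> Ck k U (fun x => Num.sqrt (f x)).
Proof.
move=> oU f0; elim: k => [|k IH].
  move=> fc x Ux; apply: (@continuous_comp _ _ _ f (@Num.sqrt R)); first exact: fc.
  exact: sqrt_continuous.
move=> fk; have /CkS[df Hf] := fk.
have ds x : U x -> derivable (@Num.sqrt R) (f x) 1.
  by move=> Ux; have [] := is_derive1_sqrt (f0 _ Ux).
apply/CkS; split.
  move=> x Ux; apply: differentiable_comp; first exact: df.
  by apply/derivable1_diffP; exact: ds.
move=> v; apply: (Ck_eq oU (g := fun x => (2 * Num.sqrt (f x))^-1 * 'D_v f x)).
  move=> x Ux; rewrite (derive_comp_scalar v (ds _ Ux) (df _ Ux)).
  by have [_ ->] := is_derive1_sqrt (f0 _ Ux).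
apply: Ck_mul => //; apply: Ck_inv => //.
  by move=> x Ux; rewrite mulf_neq0 // gt_eqF // sqrtr_gt0 f0.
by apply: Ck_mul => //; [exact: Ck_cst|apply: IH; exact: CkW].
Qed.

End CkScalar.

(** * The implicit function theorem with a scalar unknown *)

Section ImplicitFunction.
Context {R : realType} {V : normedModType R}.
Variables (h : V * R -> R) (D : set (V * R)).
Hypotheses (fV : findim V) (oD : open D) (hs : smooth_on D h).

Lemma implicit_differentiable (g : V -> R) (x : V) :
  {for x, continuous g} -> D (x, g x) -> 'D_((0, 1) : V * R) h (x, g x) != 0 ->
  (\forall y \near x, h (y, g y) = 0) ->
  differentiable g x /\ forall v, 'D_v g x =
    - 'D_((v, 0) : V * R) h (x, g x) / 'D_((0, 1) : V * R) h (x, g x).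
Proof.
move=> gc Dx; set p := 'D_(0, 1) h _ => p0 near0.
have dh : differentiable h (x, g x) by apply: (Ck_differentiable (hs 1)).
pose L := 'd h (x, g x).
have Lc : continuous L by exact: diff_continuous.
have pE : p = L (0, 1) by rewrite /p (deriveE _ dh).
have LE (v : V) (r : R) : L (v, r) = L (v, 0) + r * p.
  rewrite pE -[RHS](_ : L ((v, 0) + r *: (0, 1)) = _).
    by congr (L _); congr pair; rewrite /= ?scaler0 ?addr0 // /GRing.scale /= mulr1 add0r.
  by rewrite linearD linearZ.
(* The differential forced by linearizing h(y, g y) = 0, that is, L(v, 0) + p G(v) = 0. *)
pose G (v : V) : R := - L (v, 0) / p.
have Glin : linear G.
  move=> a u v; rewrite /G.
  have -> : L (a *: u + v, 0) = a * L (u, 0) + L (v, 0).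
    rewrite -[RHS]linearP; congr (L _); congr pair.
    by rewrite /= scaler0 addr0.
  by rewrite [in RHS]/GRing.scale /=; field.
pose GL : {linear V -> R} := HB.pack G (GRing.isLinear.Build _ _ _ _ _ Glin).
have Gc : continuous GL.
  move=> v; suff : {for v, continuous (fun v => - L (v, 0) * p^-1)} by [].
  apply: continuousM; last exact: cst_continuous.
  apply: continuousN; apply: (@continuous_comp _ _ _ (fun v : V => (v, 0 : R)) L).
    by apply: for_continuous_pair => //; exact: cst_continuous.
  exact: Lc.
have [C C0 CG] := linear_lipschitz Gc.
suff [dg dgE] : differentiable g x /\ 'd g x = GL :> (V -> R).
  by split=> // v; rewrite (deriveE _ dg) dgE /= /G !(deriveE _ dh).
apply: (diffP_eps Gc) => e e0.
have pp : 0 < `|p| by rewrite normr_gt0.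
(* With d the increment of [g], the error |d - G y| |p| is at most e1 (|y| + |d|). The bound |p|/2
   absorbs |d| and yields |d| <= (2C + 1)|y|; the second bound then turns e1 (2C + 2)|y| into e |p|
   |y|. *)
pose e1 := Num.min (`|p| / 2) (e * `|p| / (2 * C + 2)).
have C2 : 0 < 2 * C + 2 by lra.
have e10 : 0 < e1 by rewrite lt_min !divr_gt0 // mulr_gt0.
have /eqaddoP/(_ e1 e10) Ho := diff_locally dh.
have Hlim : (y, g (y + x) - g x) @[y --> (0 : V)] --> ((0, 0) : V * R).
  have : {for 0, continuous (fun y : V => (y, g (y + x) - g x))}.
    apply: for_continuous_pair => //; apply: continuousB; last exact: cst_continuous.
    apply: (@continuous_comp _ _ _ (fun y : V => y + x) g); last by rewrite add0r.
    by apply: continuousD => //; exact: cst_continuous.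
  by rewrite /prop_for /continuous_at add0r subrr.
have Ho' : \forall y \near (0 : V),
    `|h ((y, g (y + x) - g x) + (x, g x)) - (h (x, g x) + L (y, g (y + x) - g x))|
    <= e1 * `|((y, g (y + x) - g x) : V * R)| := Hlim _ Ho.
have near0' : \forall y \near (0 : V), h (y + x, g (y + x)) = 0.
  by move: near0; rewrite (near_shift 0 x) /=; apply: filterS => y; rewrite /= subr0.
have hx0 := nbhs_singleton near0.
apply: filterS2 Ho' near0' => y.
move=> H1 H2.
have {}H1 : `|L (y, g (y + x) - g x)| <= e1 * Num.max `|y| `|g (y + x) - g x|.
  move: H1.
  have -> : ((y, g (y + x) - g x) + (x, g x) : V * R) = (y + x, g (y + x)).
    by congr pair; rewrite /= subrK.
  by rewrite H2 hx0 !add0r normrN.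
move: H1; rewrite LE; set d := g (y + x) - g x.
have -> : L (y, 0) = - (G y * p) by rewrite /G divfK // opprK.
have := CG y; rewrite /= -/d.
set Gy := G y; move: (normr_ge0 y); set ny := `|y|.
clearbody d Gy ny; move=> ny0 HG H1.
have H3 : `|d - Gy| * `|p| <= e1 * Num.max ny `|d|.
  by rewrite -normrM; apply: le_trans H1; rewrite mulrBl addrC.
have m1 : Num.max ny `|d| <= ny + `|d|.
  by rewrite ge_max; apply/andP; split; [rewrite lerDl|rewrite lerDr].
have H4 : `|d - Gy| * `|p| <= e1 * (ny + `|d|).
  by apply: le_trans H3 _; rewrite ler_wpM2l // ltW.
have H5 : `|d| <= `|d - Gy| + `|Gy|.
  by rewrite -[in leLHS](subrK Gy d) ler_normD.
have e1a : e1 <= `|p| / 2 by rewrite ge_min lexx.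
have e1b : e1 * (2 * C + 2) <= e * `|p|.
  by rewrite -ler_pdivlMr // ge_min lexx orbT.
have dd0 := normr_ge0 d.
have H6 : `|d - Gy| <= (ny + `|d|) / 2.
  rewrite -(ler_pM2r pp); apply: le_trans H4 _.
  by rewrite -[leRHS]mulrA (mulrC 2^-1) [leRHS]mulrC ler_wpM2r // addr_ge0.
have H7 : `|d| <= (2 * C + 1) * ny.
  move: HG H5 H6; set A := `|d - Gy|; set B := `|Gy|; set E := `|d|.
  clearbody A B E; lra.
rewrite -(ler_pM2r pp); apply: le_trans H4 _.
apply: (@le_trans _ _ (e1 * ((2 * C + 2) * ny))).
  by rewrite ler_wpM2l ?(ltW e10) //; move: H7; set E := `|d|; clearbody E; lra.
by rewrite mulrA (mulrAC e) ler_wpM2r.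
Qed.

(** Bootstrap: the derivative of [g] is a quotient of derivatives of [h] evaluated at (x, g x), so
    it is C^k as soon as [g] is, and then [g] is C^(k+1). *)
Lemma implicit_smooth (A : set V) (g : V -> R) : open A ->
  (forall x, A x -> [/\ {for x, continuous g}, D (x, g x), h (x, g x) = 0 &
     'D_((0, 1) : V * R) h (x, g x) != 0]) ->
  smooth_on A g.
Proof.
move=> oA H.
have IF x : A x -> differentiable g x /\ forall v, 'D_v g x =
    - 'D_((v, 0) : V * R) h (x, g x) / 'D_((0, 1) : V * R) h (x, g x).
  move=> Ax; have [gc Dx _ p0] := H _ Ax; apply: implicit_differentiable => //.
  by apply: filterS (open_nbhs_nbhs (conj oA Ax)) => y /H[].
have fVR : findim (V * R)%type := findim_prod fV (@findimR R).
elim=> [|k IH]; first by move=> x /H[].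
apply/CkS; split=> [x /IF[]//|v].
have gp : Ck k A (fun x => (x, g x) : V * R).
  by apply: Ck_pair => //; [exact: findimR|exact: Ck_id].
have hc w : Ck k A (fun x => 'D_w h (x, g x)).
  apply: (@Ck_compR _ _ _ _ _ D _ (fun z => 'D_w h z)) => //; first by move=> x /H[].
  exact: (Ck_derive w (hs k.+1)).
apply: (Ck_eq oA (g := fun x => - 'D_((v, 0) : V * R) h (x, g x) * ('D_((0, 1) : V * R) h (x, g x))^-1)).
  by move=> x /IF[_ ->].
apply: Ck_mul => //; first by apply: Ck_opp.
by apply: Ck_inv => // x /H[].
Qed.

Lemma pair_line (x : V) (s r : R) : (x, s) + r *: ((0, 1) : V * R) = (x, s + r).
Proof. by congr pair; rewrite /= ?scaler0 ?addr0 // /GRing.scale /= mulr1. Qed.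

Lemma increasing_vertical (x : V) (s s' : R) : s < s' ->
  (forall r, s <= r <= s' -> D (x, r) /\ 0 < 'D_((0, 1) : V * R) h (x, r)) ->
  h (x, s) < h (x, s').
Proof.
move=> ss' H.
have [||r rs] := @mvt_line _ _ h (x, s) (0, 1) (s' - s).
- by rewrite subr_gt0.
- move=> r /andP[r0 rs]; rewrite pair_line; apply: (Ck_differentiable (hs 1)).
  by apply: (H _ _).1; rewrite lerDl r0 /=; lra.
rewrite !pair_line (addrC s) subrK -(subr_gt0 (h _)) => ->.
move: rs => /andP[r0 rs]; rewrite mulr_gt0 ?subr_gt0 //.
by apply: (H _ _).2; rewrite lerDl r0 /=; lra.
Qed.

Lemma continuous_horizontal (x : V) (s : R) :
  D (x, s) -> {for x, continuous (fun x => h (x, s))}.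
Proof.
move=> Dx; apply: (@continuous_comp _ _ _ (fun x => (x, s) : V * R) h).
  by apply: for_continuous_pair => //; exact: cst_continuous.
exact: (hs 0).
Qed.

(* [h] is increasing in the scalar unknown, so the intermediate value theorem gives
   the solution and its uniqueness. *)
Lemma implicit_function (x0 : V) (s0 : R) :
  D (x0, s0) -> h (x0, s0) = 0 -> 0 < 'D_((0, 1) : V * R) h (x0, s0) ->
  exists A (g : V -> R) e, [/\ open A, A x0, 0 < e, smooth_on A g &
    forall x, A x -> [/\ `|g x - s0| < e, D (x, g x), h (x, g x) = 0 &
      forall s, `|s - s0| < e -> h (x, s) = 0 -> s = g x]].
Proof.
move=> D0 h0 p0.
have : \forall z \near (x0, s0), D z /\ 0 < 'D_((0, 1) : V * R) h z.
  have N1 := open_nbhs_nbhs (conj oD D0).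
  have c : {for (x0, s0), continuous (fun z => 'D_((0, 1) : V * R) h z)}.
    exact: (Ck_derive _ (hs 1)).
  have N2 : \forall z \near (x0, s0), 0 < 'D_((0, 1) : V * R) h z by exact: near_gt_continuous c p0.
  by apply: filterS2 N1 N2.
move=> /nbhs_ballP[d /= d0 Hd].
pose e := d / 2; have e0 : 0 < e by rewrite divr_gt0.
have ed : e < d by rewrite /e; lra.
have HB x s : ball x0 d x -> `|s - s0| <= e ->
    D (x, s) /\ 0 < 'D_((0, 1) : V * R) h (x, s).
  move=> xB se; apply: Hd; split=> //=; rewrite -ball_normE /= distrC.
  exact: le_lt_trans se ed.
have mono x s s' : ball x0 d x -> `|s - s0| <= e -> `|s' - s0| <= e -> s < s' ->
    h (x, s) < h (x, s').
  move=> xB se se' ss; apply: increasing_vertical => // r /andP[r1 r2].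
  by apply: HB => //; move: se se'; rewrite !ler_norml; lra.
have lo_e : `|s0 - e - s0| <= e by rewrite addrAC subrr add0r normrN gtr0_norm.
have hi_e : `|s0 + e - s0| <= e by rewrite addrAC subrr add0r gtr0_norm.
have s_e : `|s0 - s0| <= e by rewrite subrr normr0 ltW.
(* The sign change needed by the intermediate value theorem; it holds at x0 by monotonicity and
   persists nearby because [h] is continuous in x. *)
pose A' := [set x | ball x0 d x /\ h (x, s0 - e) < 0 < h (x, s0 + e)].
have bx0 : ball x0 d x0 by exact: ballxx.
have A'0 : nbhs x0 A'.
  have N1 : nbhs x0 (ball x0 d) by exact: nbhsx_ballx.
  have hm : h (x0, s0 - e) < 0 by rewrite -h0; apply: mono => //; rewrite ltrBlDr ltrDl.
  have hp : 0 < h (x0, s0 + e) by rewrite -h0; apply: mono => //; rewrite ltrDl.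
  have N2 := near_lt_continuous (continuous_horizontal (HB _ _ bx0 lo_e).1) hm.
  have N3 := near_gt_continuous (continuous_horizontal (HB _ _ bx0 hi_e).1) hp.
  by apply: filterS3 N1 N2 N3 => x ? ? ?; split=> //; apply/andP.
pose A := interior A'.
(* The default [s0] is returned only where no root exists, which does not occur on A'. *)
pose g x := xget s0 [set s | `|s - s0| < e /\ h (x, s) = 0].
have gP x : A' x -> `|g x - s0| < e /\ h (x, g x) = 0.
  move=> [xB /andP[hm hp]].
  have [|||s sI hs0] := @IVT R (fun s => h (x, s)) (s0 - e) (s0 + e) 0.
  - by rewrite lerBlDr -addrA lerDl addr_ge0 // ltW.
  - apply: derivable_within_continuous => s; rewrite in_itv /= => sI.
    have [|Ds _] := HB x s xB; first by rewrite ler_norml; lra.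
    have dh : differentiable h ((x, 0) + s *: ((0, 1) : V * R)).
      by rewrite pair_line add0r; apply: (Ck_differentiable (hs 1)).
    have -> : (fun s => h (x, s)) = (fun s : R => h ((x, 0) + s *: ((0, 1) : V * R))).
      by apply/funext => r; rewrite pair_line add0r.
    by have [] := is_derive_line dh.
  - by rewrite ge_min le_max (ltW hm) (ltW hp) orbT.
  have : exists s, `|s - s0| < e /\ h (x, s) = 0.
    exists s; split=> //; move: sI; rewrite in_itv /= => /andP[s1 s2].
    have : s != s0 - e by apply: contraTneq hm => <-; rewrite hs0 ltxx.
    have : s != s0 + e by apply: contraTneq hp => <-; rewrite hs0 ltxx.
    rewrite ltr_norml => n1 n2.
    have : s < s0 + e by rewrite lt_neqAle n1.
    have : s0 - e < s by rewrite lt_neqAle eq_sym n2.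
    lra.
  exact: xgetPex.
have uniq x s : A' x -> `|s - s0| < e -> h (x, s) = 0 -> s = g x.
  move=> A'x se hs0; have [ge hg0] := gP _ A'x; have [xB _] := A'x.
  have [lt|lt|//] := ltgtP s (g x).
    by have := mono x _ _ xB (ltW se) (ltW ge) lt; rewrite hs0 hg0 ltxx.
  by have := mono x _ _ xB (ltW ge) (ltW se) lt; rewrite hs0 hg0 ltxx.
have AA' x : A x -> A' x by exact: nbhs_singleton.
have oA : open A by exact: open_interior.
exists A, g, e; split => //.
  apply: implicit_smooth => // x Ax; have A'x := AA' _ Ax.
  have [ge hg0] := gP _ A'x; have [xB _] := A'x.
  have [Dg pg] := HB _ _ xB (ltW ge).
  split=> //; last by rewrite gt_eqF.
  apply/cvgrPdist_lt => r r0.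
  (* Below r, and small enough that g x - r' and g x + r' stay in the interval of monotonicity.
     There [h] has opposite signs; these persist for y near x and trap g y between the two
     values. *)
  pose r' := Num.min (r / 2) ((e - `|g x - s0|) / 2).
  have r'0 : 0 < r' by rewrite lt_min !divr_gt0 // subr_gt0.
  have r'1 : r' <= r / 2 by rewrite ge_min lexx.
  have r'2 : r' <= (e - `|g x - s0|) / 2 by rewrite ge_min lexx orbT.
  have eg : 0 < e - `|g x - s0| by rewrite subr_gt0.
  have lo : `|g x - r' - s0| <= e.
    rewrite addrAC; apply: le_trans (ler_normB _ _) _; rewrite (gtr0_norm r'0).
    by move: r'2 eg; set q := `|_|; clearbody q r'; lra.
  have hi : `|g x + r' - s0| <= e.
    rewrite addrAC; apply: le_trans (ler_normD _ _) _; rewrite (gtr0_norm r'0).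
    by move: r'2 eg; set q := `|_|; clearbody q r'; lra.
  have hlo : h (x, g x - r') < 0.
    by rewrite -hg0; apply: mono => //; [exact: ltW|rewrite ltrBlDr ltrDl].
  have hhi : 0 < h (x, g x + r').
    by rewrite -hg0; apply: mono => //; [exact: ltW|rewrite ltrDl].
  have N1 := open_nbhs_nbhs (conj oA Ax).
  have N2 := near_lt_continuous (continuous_horizontal (HB _ _ xB lo).1) hlo.
  have N3 := near_gt_continuous (continuous_horizontal (HB _ _ xB hi).1) hhi.
  apply: filterS3 N1 N2 N3 => y Ay ylo yhi.
  have A'y := AA' _ Ay; have [gye hgy0] := gP _ A'y; have [yB _] := A'y.
  apply: (@le_lt_trans _ _ r'); last by move: r'1 r0; clearbody r'; lra.
  rewrite distrC ler_norml; apply/andP; split; rewrite leNgt; apply/negP => lt.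
    have := mono y (g y) (g x - r') yB (ltW gye) lo; rewrite hgy0.
    have -> : g y < g x - r' by move: lt; clearbody r'; lra.
    by move=> /(_ isT) /lt_trans/(_ ylo); rewrite ltxx.
  have := mono y (g x + r') (g y) yB hi (ltW gye); rewrite hgy0.
  have -> : g x + r' < g y by move: lt; clearbody r'; lra.
  by move=> /(_ isT) /(lt_trans yhi); rewrite ltxx.
move=> x Ax; have A'x := AA' _ Ax; have [ge hg0] := gP _ A'x; have [xB _] := A'x.
split=> //; first exact: (HB _ _ xB (ltW ge)).1.
by move=> s; exact: uniq.
Qed.

End ImplicitFunction.

(** * Smooth bump functions *)

Section Bump.
Context {R : realType}.

(* The factor x^-n makes the family stable under differentiation. *)
Definition flat (n : nat) (x : R) : R :=
  if 0 < x then x^-1 ^+ n * expR (- x^-1) else 0.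

Lemma flat_ge0 n x : 0 <= flat n x.
Proof.
rewrite /flat; case: ifP => // x0.
by rewrite mulr_ge0 ?expR_ge0 // exprn_ge0 // invr_ge0 ltW.
Qed.

Lemma flat_gt0 n x : 0 < x -> 0 < flat n x.
Proof. by move=> x0; rewrite /flat x0 mulr_gt0 ?expR_gt0 // exprn_gt0 // invr_gt0. Qed.

Lemma flat_le0 n x : x <= 0 -> flat n x = 0.
Proof. by rewrite /flat ltNge => ->. Qed.

(** One term of the exponential series: exp(1/x) >= (1/x)^(n+2) / (n+2)!. The two powers beyond n
    leave the factor x^2, which forces a zero derivative at 0. *)
Lemma flat_quadratic n x : flat n x <= n.+2`!%:R * x ^+ 2.
Proof.
rewrite /flat; case: ifPn => [x0|_]; last by rewrite mulr_ge0 // sqr_ge0.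
have y0 : 0 < x^-1 by rewrite invr_gt0.
have m0 : (0 : R) < n.+2`!%:R by rewrite ltr0n fact_gt0.
have H : x^-1 ^+ n.+2 / n.+2`!%:R <= expR x^-1.
  by apply: le_trans (expR_ge1Dxn n.+1 (ltW y0)); rewrite lerDr.
rewrite expRN ler_pdivrMr ?expR_gt0 //.
apply: le_trans (ler_wpM2l _ H); last by rewrite mulr_ge0 ?sqr_ge0 // ltW.
rewrite (mulrC (_ ^+ n.+2)) mulrACA divff ?gt_eqF // mul1r.
have -> : x ^+ 2 * x^-1 ^+ n.+2 = x^-1 ^+ n; last by [].
by rewrite (exprD x^-1 2 n) mulrA exprVn divff ?mul1r // expf_neq0 // gt_eqF.
Qed.

Lemma flat_derive0 n : derivable (flat n) 0 1 /\ 'D_1 (flat n) 0 = 0.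
Proof.
have zc : continuous (\0 : {linear R -> R}) by move=> x; exact: cst_continuous.
have [|df dE] := diffP_eps (f := flat n) (x := 0) zc.
  move=> e e0; pose C : R := n.+2`!%:R.
  have C0 : 0 < C by rewrite ltr0n fact_gt0.
  have : \forall h \near (0 : R), `|h| < e / C.
    have /nbhs_ballP : nbhs (0 : R) (ball 0 (e / C)) by apply: nbhsx_ballx; rewrite divr_gt0.
    by move=> [r r0 H]; apply/nbhs_ballP; exists r => // y /H; rewrite -ball_normE /= sub0r normrN.
  apply: filterS => h hC; rewrite /= addr0 (flat_le0 n (lexx 0)) !subr0.
  rewrite ger0_norm ?flat_ge0 //; apply: le_trans (flat_quadratic _ _) _.
  rewrite -/C -real_normK ?num_real // expr2 mulrA ler_wpM2r //.
  by rewrite mulrC -ler_pdivlMr // ltW.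
split; first exact: diff_derivable.
by rewrite deriveE // dE.
Qed.

(** The product rule for x^-n exp(-1/x), with i = 1/x and E = exp(-1/x). The case n = 0 is split off
    because [n.-1] is truncated there; its coefficient is then 0. *)
Lemma flat_identity n (i E : R) :
  i ^+ n * (E * i ^+ 2) + E * (n%:R * i ^+ n.-1 * - i ^+ 2) =
  i ^+ n.+2 * E - n%:R * (i ^+ n.+1 * E).
Proof. case: n => [|n]; rewrite ?mul0r ?subr0 !exprS /=; ring. Qed.

Lemma flat_derive n x : derivable (flat n) x 1 /\
  'D_1 (flat n) x = flat n.+2 x - n%:R * flat n.+1 x.
Proof.
have [x0|x0|->] := ltgtP x 0.
- have near0 : \forall y \near x, cst 0 y = flat n y.
    have : nbhs x [set y | y < 0] by exact: lt_nbhsl.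
    by apply: filterS => y /ltW y0; rewrite flat_le0.
  have [d dE] := near_eq_is_derive near0 (is_derive_cst (0 : R) x (1 : R)).
  by split=> //; rewrite dE !flat_le0 ?(ltW x0) // mulr0 subr0.
- have near0 : \forall y \near x, y^-1 ^+ n * expR (- y^-1) = flat n y.
    have : nbhs x [set y | 0 < y] by exact: lt_nbhsr.
    by apply: filterS => y /= y0; rewrite /flat y0.
  have xn0 : x != 0 by rewrite gt_eqF.
  have di : is_derive x 1 (fun y : R => y^-1) (- x ^- 2).
    have [d dE] := is_derive_id x (1 : R).
    apply: DeriveDef; first by apply: (@derivableV _ _ id).
    by rewrite (@deriveV _ _ id) // derive_id /GRing.scale /= mulr1.
  have de : is_derive x 1 (fun y : R => expR (- y^-1)) (expR (- x^-1) * x ^- 2).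
    have dN : is_derive x 1 (fun y : R => - y^-1) (x ^- 2).
      by rewrite -[X in is_derive _ _ _ X]opprK; exact: is_deriveN di.
    exact (@is_derive1_comp R expR (fun y => - y^-1) x _ _ (is_derive_expR (- x^-1)) dN).
  have dX : is_derive x 1 (fun y : R => y^-1 ^+ n) ((n%:R * x^-1 ^+ n.-1) *: (- x ^- 2)).
    have -> : (fun y : R => y^-1 ^+ n) = (fun y : R => y^-1) ^+ n.
      by apply/funext => y; rewrite exprfctE.
    exact: is_deriveX.
  have dM := is_deriveM dX de.
  have [d dE] := near_eq_is_derive near0 dM.
  split=> //; rewrite dE /flat x0 /= /GRing.scale /=.
  by have := flat_identity n x^-1 (expR (- x^-1)); rewrite (exprVn x 2).
have [d ->] := flat_derive0 n.
by split=> //; rewrite !(flat_le0 _ (lexx _)) mulr0 subr0.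
Qed.

Lemma flat_smooth n : smooth_on setT (flat n).
Proof.
move=> k; elim: k n => [|k IH] n.
  move=> x _; apply: differentiable_continuous; apply/derivable1_diffP.
  exact: (flat_derive n x).1.
apply: Ck_deriv; [exact: openT|by move=> x _; exact: (flat_derive n x).1|].
apply: (Ck_eq openT (g := fun x => flat n.+2 x - n%:R * flat n.+1 x)).
  by move=> x _; rewrite (flat_derive n x).2.
apply: Ck_sub_fun; [exact: openT|exact: IH|].
by apply: Ck_mul; [exact: openT|exact: Ck_cst|exact: IH].
Qed.

Definition smooth_bump (r s x : R) : R := flat 0 (x - r) * flat 0 (s - x).

Lemma bump_ge0 r s x : 0 <= smooth_bump r s x.
Proof. by rewrite mulr_ge0 ?flat_ge0. Qed.

Lemma bump_gt0 r s x : r < x < s -> 0 < smooth_bump r s x.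
Proof. by move=> /andP[rx xs]; rewrite mulr_gt0 // flat_gt0 ?subr_gt0. Qed.

Lemma bump_eq0 r s x : ~~ (r < x < s) -> smooth_bump r s x = 0.
Proof.
rewrite negb_and -!leNgt /smooth_bump => /orP[H|H].
  by rewrite flat_le0 ?mul0r // subr_le0.
by rewrite [X in _ * X]flat_le0 ?mulr0 // subr_le0.
Qed.

Lemma bump_smooth r s : smooth_on setT (smooth_bump r s).
Proof.
move=> k; apply: Ck_mul; first exact: openT.
  apply: (@Ck_compR _ _ _ _ _ setT (fun x => x - r) (flat 0)) => //.
  - exact: findimR.
  - exact: openT.
  - by apply: Ck_add; [exact: openT|exact: Ck_id|exact: Ck_cst].
  - exact: flat_smooth.
apply: (@Ck_compR _ _ _ _ _ setT (fun x => s - x) (flat 0)) => //.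
- exact: findimR.
- exact: openT.
- by apply: Ck_sub_fun; [exact: openT|exact: Ck_cst|exact: Ck_id].
- exact: flat_smooth.
Qed.

End Bump.

(** * Charts of the tangent bundle *)

Lemma near_open (T : topologicalType) (U : set T) (x : T) (Q : T -> Prop) :
  open U -> U x -> (forall y, U y -> Q y) -> \forall y \near x, Q y.
Proof. by move=> oU Ux UQ; apply: filterS (open_nbhs_nbhs (conj oU Ux)). Qed.

Section LineDerivatives.
Context {R : realType}.
Implicit Types V W X : normedModType R.

(** A directional derivative sees only the germ of the function on one line, so functions on
    different spaces can be compared: a curve with a two-parameter family, a fibre with its image in
    another chart. *)
Lemma derive_near_line V (V' : normedModType R) W (f : V -> W) (g : V' -> W) x v y w :
  (\forall h \near (0 : R), f (h *: v + x) = g (h *: w + y)) ->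
  'D_v f x = 'D_w g y.
Proof.
move=> H; have := nbhs_singleton H; rewrite !scale0r !add0r => fg.
have N : \forall h \near (0 : R), h^-1 *: (f (h *: v + x) - f x) = h^-1 *: (g (h *: w + y) - g y).
  by apply: filterS H => h ->; rewrite fg.
rewrite /derive; congr (lim _); rewrite eqEsubset; split; apply/near_eq_cvg/cvg_within => //.
by apply: filterS N => h ->.
Qed.

Lemma derive_same_line V (V' : normedModType R) W (f : V -> W) (g : V' -> W) x v y w :
  (forall h : R, f (h *: v + x) = g (h *: w + y)) -> 'D_v f x = 'D_w g y.
Proof. by move=> H; apply: derive_near_line; near=> h.
Unshelve. all: by end_near. Qed.

Lemma derive_affine V W (f : V -> W) x v w :
  (\forall h \near (0 : R), f (h *: v + x) = f x + h *: w) -> 'D_v f x = w.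
Proof.
move=> H; have -> : 'D_v f x = 'D_(1 : R) (fun s : R => f x + s *: w) 0.
  by apply: derive_near_line; apply: filterS H => h ->; rewrite addr0 /GRing.scale /= mulr1.
exact: derive_line.
Qed.

Lemma derive_pair V W X (f : V -> W * X) x v : differentiable f x ->
  'D_v f x = ('D_v (fun y => (f y).1) x, 'D_v (fun y => (f y).2) x).
Proof.
move=> df.
have cf : continuous (fst : W * X -> W) by move=> z; exact: cvg_fst.
have cs : continuous (snd : W * X -> X) by move=> z; exact: cvg_snd.
have [_ E1] := derive_linear_post (L := fst) v cf df.
have [_ E2] := derive_linear_post (L := snd) v cs df.
rewrite [LHS]surjective_pairing; congr pair; [exact: (esym E1)|exact: (esym E2)].
Qed.

Lemma deriveDdir V W (f : V -> W) x u v : differentiable f x ->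
  'D_(u + v) f x = 'D_u f x + 'D_v f x.
Proof. by move=> df; rewrite !(deriveE _ df) linearD. Qed.

Lemma deriveZdir V W (f : V -> W) x a v : differentiable f x ->
  'D_(a *: v) f x = a *: 'D_v f x.
Proof. by move=> df; rewrite !(deriveE _ df) linearZ. Qed.

Lemma derive_sumdir V W (f : V -> W) x n (v : 'I_n -> V) : differentiable f x ->
  'D_(\sum_i v i) f x = \sum_i 'D_(v i) f x.
Proof.
move=> df; rewrite (deriveE _ df) linear_sum; apply: eq_bigr => i _.
by rewrite (deriveE _ df).
Qed.

Lemma derive_rV n W (f : 'rV[R]_n.+1 -> W) x v : differentiable f x ->
  'D_v f x = \sum_j v 0 j *: 'D_(delta_mx 0 j) f x.
Proof.
move=> df; rewrite [in LHS](row_sum_delta v) derive_sumdir //.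
by apply: eq_bigr => j _; rewrite deriveZdir.
Qed.

End LineDerivatives.

Section Charts.
Context {R : realType} {M : topologicalType} (S : surface R M).
Local Notation R2 := 'rV[R]_2.
Local Notation R4 := ('rV[R]_2 * 'rV[R]_2)%type.
Implicit Types (i j k : idx S) (x v w : R2) (z : R4) (p : M) (P : TM S).

Lemma findim4 : findim (R4 : normedModType R).
Proof. exact: findim_prod (findim_rV _) (findim_rV _). Qed.

Definition overlap i j : set R2 := chart i @` (dom i `&` dom j).

Lemma img_chart i p : dom i p -> (chart i @` dom i) (chart i p).
Proof. by exists p. Qed.

Lemma dom_chartV i x : (chart i @` dom i) x -> dom i (chartV i x).
Proof. by move=> [p ip <-]; rewrite chartK. Qed.

Lemma chartVK i x : (chart i @` dom i) x -> chart i (chartV i x) = x.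
Proof. by move=> [p ip <-]; rewrite chartK. Qed.

Lemma overlapP i j x : overlap i j x <-> (chart i @` dom i) x /\ dom j (chartV i x).
Proof.
split=> [[p [ip jp] <-]|[ix jx]].
  by rewrite chartK //; split=> //; exact: img_chart.
by exists (chartV i x); [split=> //; exact: dom_chartV|exact: chartVK].
Qed.

Lemma overlap_chart i j p : dom i p -> dom j p -> overlap i j (chart i p).
Proof. by move=> ip jp; exists p. Qed.

Lemma open_overlap i j : open (overlap i j).
Proof.
rewrite openE => x /overlapP[ix jx].
have N1 : nbhs x (chart i @` dom i) by apply: open_nbhs_nbhs; split=> //; exact: img_open.
have N2 : nbhs x (chartV i @^-1` dom j).
  apply: (chartV_continuous ix); apply: open_nbhs_nbhs; split=> //; exact: dom_open.
by apply: filterS2 N1 N2 => y iy jy; apply/overlapP.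
Qed.

Arguments open_overlap : clear implicits.

Lemma trans_dom i j x : overlap i j x -> (chart j @` dom j) (trans i j x).
Proof. by move=> /overlapP[ix jx]; exists (chartV i x). Qed.

Lemma chartV_trans i j x : overlap i j x -> chartV j (trans i j x) = chartV i x.
Proof. by move=> /overlapP[ix jx]; rewrite /trans /= chartK. Qed.

Lemma trans_overlap i j k x : overlap i j x -> overlap i k x -> overlap j k (trans i j x).
Proof.
move=> ij /overlapP[_ kx]; apply/overlapP; split; first exact: trans_dom.
by rewrite chartV_trans.
Qed.

Lemma overlap_refl i x : (chart i @` dom i) x -> overlap i i x.
Proof. by move=> ix; apply/overlapP; split=> //; exact: dom_chartV. Qed.

Lemma trans_trans i j k x : overlap i j x ->
  trans j k (trans i j x) = trans i k x.
Proof. by move=> ij; rewrite /trans /= -/(trans i j x) chartV_trans. Qed.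

Lemma trans_chart i j p : dom i p -> trans i j (chart i p) = chart j p.
Proof. by move=> ip; rewrite /trans /= chartK. Qed.

Lemma trans_id i x : (chart i @` dom i) x -> trans i i x = x.
Proof. by move=> ix; rewrite /trans /= chartVK. Qed.

Lemma trans_diff i j x : overlap i j x -> differentiable (trans i j) x.
Proof. by move=> ij; apply: (Ck_differentiable (trans_smooth i j 1)). Qed.

(** The cocycle rule for differentials of transition maps. A tangent vector at p is stored in the
    coordinates of [chart_at p], so passing between [tpoint] and [tcoord], or between two charts,
    always composes such differentials. *)
Lemma derive_trans_trans i j k x v : overlap i j x -> overlap i k x ->
  'D_('D_v (trans i j) x) (trans j k) (trans i j x) = 'D_v (trans i k) x.
Proof.
move=> ij ik; have d1 := trans_diff ij.
have d2 := trans_diff (trans_overlap ij ik).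
rewrite -(derive_comp v d1 d2); apply: near_eq_derive.
by apply: near_open (open_overlap i j) ij _ => y; exact: trans_trans.
Qed.

Lemma derive_trans_id i x v : (chart i @` dom i) x -> 'D_v (trans i i) x = v.
Proof.
move=> ix; rewrite -[RHS](derive_id x v); apply: near_eq_derive.
by apply: near_open (@img_open _ _ S i) ix _ => y; exact: trans_id.
Qed.

Lemma derive_trans_neq0 i j x v : overlap i j x -> v != 0 -> 'D_v (trans i j) x != 0.
Proof.
move=> ij v0; have ix := (overlapP i j x).1 ij.
apply: contraNneq v0 => E; rewrite -(derive_trans_id v ix.1).
by rewrite -(derive_trans_trans v ij (overlap_refl ix.1)) E derive0.
Qed.

Lemma dom_chart_at p : dom (@chart_at _ _ S p) p.
Proof. by rewrite /chart_at; case: cid. Qed.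

Lemma tpointK i z : (chart i @` dom i) z.1 -> tcoord i (tpoint i z) = z.
Proof.
move=> iz; rewrite /tcoord /tpoint /= chartVK //.
set j := chart_at _; have jd : dom j (chartV i z.1) by exact: dom_chart_at.
have ij : overlap i j z.1 by apply/overlapP.
rewrite -[chart j _]/(trans i j z.1) derive_trans_trans //; last exact: overlap_refl.
by rewrite derive_trans_id // -surjective_pairing.
Qed.

Lemma tcoordK i P : dom i P.1 -> tpoint i (tcoord i P) = P.
Proof.
move=> iP; rewrite /tcoord /tpoint /= chartK //.
set j := chart_at _; have jd : dom j P.1 by exact: dom_chart_at.
have ji := overlap_chart jd iP.
rewrite -(trans_chart i jd) derive_trans_trans //; last exact: overlap_chart.
by rewrite derive_trans_id -?surjective_pairing //; exact: img_chart.
Qed.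

Lemma tcoord_img i P : dom i P.1 -> (chart i @` dom i) (tcoord i P).1.
Proof. exact: img_chart. Qed.

Lemma tcoord_ttrans i j P : dom i P.1 -> dom j P.1 ->
  tcoord j P = ttrans i j (tcoord i P).
Proof.
move=> iP jP; rewrite /ttrans /tcoord /= (trans_chart _ iP).
set l := chart_at _; have ld : dom l P.1 by exact: dom_chart_at.
have E : 'D_('D_(P.2) (trans l i) (chart l P.1)) (trans i j) (chart i P.1) =
    'D_(P.2) (trans l j) (chart l P.1).
  by rewrite -(trans_chart i ld) derive_trans_trans //; exact: overlap_chart.
by rewrite E.
Qed.

Lemma tpoint_ttrans i j z : overlap i j z.1 -> tpoint j (ttrans i j z) = tpoint i z.
Proof.
move=> ij; have [iz jz] := (overlapP i j z.1).1 ij.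
rewrite /tpoint /ttrans /= (chartV_trans ij); set l := chart_at _.
have il : overlap i l z.1 by apply/overlapP; split=> //; exact: dom_chart_at.
have E : 'D_('D_(z.2) (trans i j) z.1) (trans j l) (trans i j z.1) =
    'D_(z.2) (trans i l) z.1 by rewrite derive_trans_trans.
by rewrite E.
Qed.

Lemma loc_ttrans i j (f : TM S -> R) z : overlap i j z.1 ->
  loc i f z = loc j f (ttrans i j z).
Proof. by move=> ij; rewrite /loc tpoint_ttrans. Qed.

Lemma tpoint_dom i z : (chart i @` dom i) z.1 -> dom i (tpoint i z).1.
Proof. exact: dom_chartV. Qed.

Lemma open_fst_preimage (U : set R2) : open U -> open [set z : R4 | U z.1].
Proof. by move=> oU; apply: (open_comp (f := fst)) => // z _; exact: cvg_fst. Qed.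

Lemma open_tdom i : open (@tdom R M S i).
Proof.
apply: openI; first by apply: open_fst_preimage; exact: img_open.
have o0 : open [set v : R2 | v != 0].
  rewrite openE => v v0; apply/nbhs_ballP; exists `|v|; first by rewrite /= normr_gt0.
  by move=> u; rewrite -ball_normE /=; apply: contraTneq => ->; rewrite subr0 ltxx.
by apply: (open_comp (f := snd)) o0 => z _; exact: cvg_snd.
Qed.

Lemma tdom_ttrans i j z : overlap i j z.1 -> tdom i z -> tdom j (ttrans i j z).
Proof.
move=> ij [_ z0]; split; first exact: trans_dom.
exact: derive_trans_neq0.
Qed.

(** The fibre component differentiates [trans] in the direction z.2, which varies with z; the
    expansion over basis vectors makes the smoothness of [trans] applicable. *)
Lemma ttransE i j z : overlap i j z.1 ->
  ttrans i j z = (trans i j z.1, \sum_a z.2 0 a *: 'D_(delta_mx 0 a) (trans i j) z.1).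
Proof. by move=> ij; rewrite /ttrans -derive_rV //; exact: trans_diff. Qed.

Lemma ttrans_smooth i j : smooth_on [set z : R4 | overlap i j z.1] (@ttrans R M S i j).
Proof.
have oU := open_fst_preimage (open_overlap i j).
move=> k; apply: (Ck_eq oU (fun z zU => ttransE zU)).
have fst_k : Ck k [set z : R4 | overlap i j z.1] (fun z => z.1).
  by apply: Ck_fst => //; exact: Ck_id.
apply: Ck_pair => //; try exact: findim_rV.
  apply: (Ck_comp (A := overlap i j)) fst_k _ => //; try exact: findim_rV.
  - exact: open_overlap.
  - exact: trans_smooth.
apply: Ck_rV => // b.
apply: (Ck_eq oU (g := fun z => \sum_a z.2 0 a * ('D_(delta_mx 0 a) (trans i j) z.1) 0 b)).
  by move=> z _; rewrite summxE; apply: eq_bigr => a _; rewrite mxE.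
apply: Ck_sum => // a; apply: Ck_mul => //.
  by apply: Ck_coord => //; apply: Ck_snd => //; exact: Ck_id.
apply: (@Ck_compR _ _ _ _ _ (overlap i j) (fun z : R4 => z.1) (fun x => ('D_(delta_mx 0 a) (trans i j) x) 0 b)) => //.
  exact: findim_rV.
apply: Ck_coord; first exact: open_overlap.
exact: (Ck_derive _ (trans_smooth i j k.+1)).
Qed.

Lemma ttrans_diff i j z : overlap i j z.1 -> differentiable (ttrans i j) z.
Proof. by move=> ij; apply: (Ck_differentiable (ttrans_smooth i j 1)). Qed.

Lemma derive_ttrans1 i j z (v : R4) : overlap i j z.1 ->
  ('D_v (ttrans i j) z).1 = 'D_(v.1) (trans i j) z.1.
Proof.
move=> ij; rewrite derive_pair /=; last exact: ttrans_diff.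
exact: derive_same_line.
Qed.

(** Exact for every [h], because a change of charts is linear on fibres. Vertical derivatives
    therefore transform with no second derivative of [trans]. *)
Lemma ttrans_vertical i j z w (h : R) : overlap i j z.1 ->
  ttrans i j (h *: (0, w) + z) = h *: (0, 'D_w (trans i j) z.1) + ttrans i j z.
Proof.
move=> ij; rewrite /ttrans /= scaler0 add0r; congr pair => /=.
  by rewrite scaler0 add0r.
by rewrite deriveDdir ?deriveZdir //; exact: trans_diff.
Qed.

Lemma derive_vertical_ttrans i j (f g : R4 -> R) z w : overlap i j z.1 ->
  (forall y, overlap i j y.1 -> f y = g (ttrans i j y)) ->
  'D_((0, w) : R4) f z = 'D_((0, 'D_w (trans i j) z.1) : R4) g (ttrans i j z).
Proof.
move=> ij fg; apply: derive_same_line => h.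
by rewrite fg ?ttrans_vertical //= scaler0 add0r.
Qed.

End Charts.

(** * The Chern connection and the geodesic spray *)

Lemma sum2 (V : nmodType) (f : 'I_2 -> V) : \sum_(a < 2) f a = f 0 + f 1.
Proof. by rewrite big_ord_recl big_ord1; congr (_ + f _); apply: val_inj. Qed.

Lemma forall_ord2 (Q : 'I_2 -> Prop) : Q 0 -> Q 1 -> forall a, Q a.
Proof.
move=> Q0 Q1 a; case: (eqVneq a 0) => [->//|a0].
have -> : a = 1; last by [].
by case: a a0 => [[|[|n]] //= ?] _; apply: val_inj.
Qed.

Section ChernAlgebra.
Context {R : realFieldType}.
Variables (g gi : 'I_2 -> 'I_2 -> R) (gx gy : 'I_2 -> 'I_2 -> 'I_2 -> R) (y : 'I_2 -> R).

Hypothesis g_sym : g 1 0 = g 0 1.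
Hypothesis gx_sym : forall c, gx c 1 0 = gx c 0 1.
Hypothesis gy_sym : forall c, gy c 1 0 = gy c 0 1.
Hypothesis gy_y : forall c a, gy c a 0 * y 0 + gy c a 1 * y 1 = 0.
Let d := g 0 0 * g 1 1 - g 0 1 * g 0 1.
Hypothesis d_neq0 : d != 0.
Hypothesis gi00 : gi 0 0 = g 1 1 / d.
Hypothesis gi01 : gi 0 1 = - g 0 1 / d.
Hypothesis gi10 : gi 1 0 = - g 0 1 / d.
Hypothesis gi11 : gi 1 1 = g 0 0 / d.

(* [gi], [gx c a b] and [gy c a b] stand for the inverse of g and for dg_{ab}/dx^c
   and dg_{ab}/dy^c; the definitions below mirror those of the Chern connection. *)
Definition cartan_ a b c := \sum_(l < 2) gi a l * (2^-1 * gy c l b).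
Definition christoffel_ a b c := \sum_(l < 2) 2^-1 * gi a l *
  (gx c l b + gx b l c - gx l b c).
Definition nonlinear_ a b := \sum_(c < 2) christoffel_ a b c * y c
  - \sum_(c < 2) \sum_(r < 2) \sum_(s < 2)
      cartan_ a b c * christoffel_ c r s * y r * y s.
Definition delta_ c a b := gx c a b - \sum_(m < 2) nonlinear_ m c * gy m a b.
Definition chern_ a b c := \sum_(l < 2) 2^-1 * gi a l *
    (delta_ c l b + delta_ b l c - delta_ l b c).
(** The vertical coefficients, up to sign, of the geodesic spray y^c delta/delta x^c = y^c d/dx^c -
    N^a_c y^c d/dy^a. *)
Definition spray_ a := \sum_(c < 2) nonlinear_ a c * y c.

Lemma cartan_y a c : cartan_ a 0 c * y 0 + cartan_ a 1 c * y 1 = 0.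
Proof.
rewrite /cartan_ !sum2.
transitivity (gi a 0 * 2^-1 * (gy c 0 0 * y 0 + gy c 0 1 * y 1) +
  gi a 1 * 2^-1 * (gy c 1 0 * y 0 + gy c 1 1 * y 1)); first by ring.
by rewrite !gy_y !mulr0 addr0.
Qed.

(** Contracting N with y contracts the Cartan tensor with y, which gives 0 by homogeneity; only the
    formal Christoffel symbols survive. *)
Lemma spray_christoffel a :
  spray_ a = \sum_(b < 2) \sum_(c < 2) christoffel_ a b c * y b * y c.
Proof.
rewrite /spray_ /nonlinear_ !sum2.
set K0 := christoffel_ 0; set K1 := christoffel_ 1; set Ka := christoffel_ a.
transitivity (Ka 0 0 * y 0 * y 0 + Ka 0 1 * y 0 * y 1 + (Ka 1 0 * y 1 * y 0 + Ka 1 1 * y 1 * y 1)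
 - (cartan_ a 0 0 * y 0 + cartan_ a 1 0 * y 1) *
   (K0 0 0 * y 0 * y 0 + K0 0 1 * y 0 * y 1 + K0 1 0 * y 1 * y 0 + K0 1 1 * y 1 * y 1)
 - (cartan_ a 0 1 * y 0 + cartan_ a 1 1 * y 1) *
   (K1 0 0 * y 0 * y 0 + K1 0 1 * y 0 * y 1 + K1 1 0 * y 1 * y 0 + K1 1 1 * y 1 * y 1)).
  by ring.
by rewrite !cartan_y !mul0r !subr0.
Qed.

Lemma delta_yr l k : delta_ k l 0 * y 0 + delta_ k l 1 * y 1 = gx k l 0 * y 0 + gx k l 1 * y 1.
Proof.
rewrite /delta_ !sum2.
transitivity (gx k l 0 * y 0 + gx k l 1 * y 1
  - nonlinear_ 0 k * (gy 0 l 0 * y 0 + gy 0 l 1 * y 1)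
  - nonlinear_ 1 k * (gy 1 l 0 * y 0 + gy 1 l 1 * y 1)); first by ring.
by rewrite !gy_y !mulr0 !subr0.
Qed.

(** Each of the three terms contracts y with an index of g, where delta/delta x and d/dx agree by
    [delta_yr]. The Chern and the Christoffel symbols thus have the same quadratic form in y. *)
Lemma chern_spray a :
  \sum_(j < 2) \sum_(k < 2) chern_ a j k * y j * y k = spray_ a.
Proof.
rewrite spray_christoffel /chern_ /christoffel_ !sum2.
transitivity (\sum_(l < 2) 2^-1 * gi a l * (
   (delta_ 0 l 0 * y 0 + delta_ 0 l 1 * y 1) * (2 * y 0)
 + (delta_ 1 l 0 * y 0 + delta_ 1 l 1 * y 1) * (2 * y 1)
 - (delta_ l 0 0 * y 0 + delta_ l 0 1 * y 1) * y 0
 - (delta_ l 1 0 * y 0 + delta_ l 1 1 * y 1) * y 1)).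
  by rewrite !sum2; ring.
by rewrite !sum2 !delta_yr; ring.
Qed.

Definition spray_g a b := \sum_(c < 2) y c * gx c a b - \sum_(m < 2) spray_ m * gy m a b.

Lemma spray_delta a b : spray_g a b = y 0 * delta_ 0 a b + y 1 * delta_ 1 a b.
Proof. by rewrite /spray_g /delta_ /spray_ !sum2; ring. Qed.

Lemma delta_sym c : delta_ c 1 0 = delta_ c 0 1.
Proof. by rewrite /delta_ !sum2 gx_sym !gy_sym. Qed.

(* In dimension two the trace of the Chern connection along the spray is the
   logarithmic derivative of sqrt(det g) along the spray. *)
Lemma spray_det :
  spray_g 0 0 * g 1 1 + g 0 0 * spray_g 1 1
    - (spray_g 0 1 * g 1 0 + g 0 1 * spray_g 1 0) =
  2 * d * \sum_(a < 2) \sum_(k < 2) chern_ a a k * y k.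
Proof.
rewrite !spray_delta /chern_ !sum2 !delta_sym g_sym gi00 gi01 gi10 gi11.
set D000 := delta_ 0 0 0; set D001 := delta_ 0 0 1; set D011 := delta_ 0 1 1.
set D100 := delta_ 1 0 0; set D101 := delta_ 1 0 1; set D111 := delta_ 1 1 1.
clearbody D000 D001 D011 D100 D101 D111.
by field; exact: d_neq0.
Qed.

(* [q a] and [qx c a] stand for dL/dy^a and d^2L/dx^c dy^a, with L = F^2/2. *)
Variables (q : 'I_2 -> R) (qx : 'I_2 -> 'I_2 -> R) (Lx : 'I_2 -> R).
Hypothesis q_g : forall a, g a 0 * y 0 + g a 1 * y 1 = q a.
Hypothesis gx_y : forall c a, gx c a 0 * y 0 + gx c a 1 * y 1 = qx c a.
Hypothesis qx_y : forall c, qx c 0 * y 0 + qx c 1 * y 1 = 2 * Lx c.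

(** The geodesic equation: with y' = - [spray_], it reads (dL/dy^a)' = dL/dx^a for L = F^2/2. *)
Lemma g_spray a : g a 0 * spray_ 0 + g a 1 * spray_ 1 =
  qx 0 a * y 0 + qx 1 a * y 1 - Lx a.
Proof.
have E : 2 * Lx a = (gx a 0 0 * y 0 + gx a 0 1 * y 1) * y 0 + (gx a 1 0 * y 0 + gx a 1 1 * y 1) * y 1.
  by rewrite !gx_y qx_y.
have -> : Lx a = 2^-1 * (2 * Lx a) by field.
rewrite E -!gx_y !spray_christoffel /christoffel_ !sum2 !gi00 !gi01 !gi10 !gi11.
move: a E; apply: forall_ord2 => _; rewrite ?g_sym ?gx_sym /d; by field; exact: d_neq0.
Qed.

(** Conservation of energy: [g_spray] contracted with y, together with Euler's identity for dL/dx,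
    which is homogeneous of degree 2. It makes the spray tangent to the indicatrix bundle. *)
Lemma spray_L : Lx 0 * y 0 + Lx 1 * y 1 - (q 0 * spray_ 0 + q 1 * spray_ 1) = 0.
Proof.
rewrite -!q_g g_sym.
transitivity (Lx 0 * y 0 + Lx 1 * y 1 - ((g 0 0 * spray_ 0 + g 0 1 * spray_ 1) * y 0
  + (g 1 0 * spray_ 0 + g 1 1 * spray_ 1) * y 1)); first by rewrite g_sym; ring.
rewrite !g_spray.
transitivity (2 * (Lx 0 * y 0 + Lx 1 * y 1) - ((qx 0 0 * y 0 + qx 0 1 * y 1) * y 0
  + (qx 1 0 * y 0 + qx 1 1 * y 1) * y 1)); first by ring.
by rewrite !qx_y; ring.
Qed.

End ChernAlgebra.

(** * Homogeneity and positivity of the metric in a chart *)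

Section ChartFinsler.
Context {R : realType} {M : topologicalType} (S : surface R M).
Local Notation R2 := 'rV[R]_2.
Local Notation R4 := ('rV[R]_2 * 'rV[R]_2)%type.
Variables (F : TM S -> R) (HF : finsler F) (i : idx S).
Local Notation D := (@tdom R M S i).
Local Notation f := (loc i F).

Let oD : open D := @open_tdom R M S i.
Arguments oD : clear implicits.

Lemma near_line (V : normedModType R) (U : set V) (x v : V) : open U -> U x ->
  \forall h \near (0 : R), U (h *: v + x).
Proof.
move=> oU Ux.
have c : {for (0 : R), continuous (fun h : R => h *: v + x)}.
  by apply: continuousD; [exact: scalel_continuous|exact: cst_continuous].
have : nbhs (0 *: v + x) U by rewrite scale0r add0r; exact: open_nbhs_nbhs.
exact: c.
Qed.

Lemma locF_smooth : smooth_on D f.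
Proof. exact: finsler_smooth HF i. Qed.

Lemma locF_ge0 z : 0 <= f z.
Proof. exact: finsler_ge0 HF _. Qed.

Lemma locF_homog (z : R4) c : (chart i @` dom i) z.1 -> 0 < c ->
  f (z.1, c *: z.2) = c * f z.
Proof.
move=> iz c0; rewrite /loc /tpoint /= deriveZdir ?(finsler_homog HF) //.
apply: trans_diff; apply/overlapP; split=> //; exact: dom_chart_at.
Qed.

Definition homogeneous n (h : R4 -> R) :=
  forall z c, D z -> 0 < c -> h (z.1, c *: z.2) = c ^+ n * h z.

Lemma tdomZ z c : D z -> 0 < c -> D (z.1, c *: z.2).
Proof. by move=> [iz z0] c0; split=> //=; rewrite scaler_eq0 negb_or z0 gt_eqF. Qed.

Lemma euler n h z : homogeneous n h -> D z -> 'D_((0, z.2) : R4) h z = n%:R * h z.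
Proof.
move=> hh Dz.
have -> : 'D_((0, z.2) : R4) h z = 'D_(1 : R) (fun s : R => s ^+ n * h z) 1.
  apply: derive_near_line.
  have : \forall t \near (0 : R), 0 < t + 1.
    apply: near_gt_continuous; last by rewrite add0r.
    by apply: continuousD => //; exact: cst_continuous.
  apply: filterS => t t0; rewrite /GRing.scale /= mulr1 -hh //; congr (h _).
  by congr pair; rewrite /= ?scaler0 ?add0r // scalerDl scale1r.
have -> : (fun s : R => s ^+ n * h z) = (fun s => h z *: (s ^+ n)).
  by apply/funext => s; rewrite [LHS]mulrC.
have [d E] := is_deriveX n (is_derive_id (1 : R) (1 : R)).
have -> : (fun s : R => h z *: s ^+ n) = h z \*: (id ^+ n).
  by apply/funext => s /=; rewrite exprfctE.
rewrite deriveZ // E expr1n mulr1 /GRing.scale /= mulr1; exact: mulrC.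
Qed.

Lemma homogeneous_dy n h a : smooth_on D h -> homogeneous n.+1 h ->
  homogeneous n (dy a h).
Proof.
move=> hs hh z c Dz c0; rewrite /dy.
have dh : differentiable h z by apply: (Ck_differentiable (hs 1)).
have -> : 'D_((0, delta_mx 0 a) : R4) h (z.1, c *: z.2) =
    'D_(c^-1 *: ((0, delta_mx 0 a) : R4)) (fun w => c ^+ n.+1 *: h w) z.
  apply: derive_near_line.
  apply: filterS (near_line (c^-1 *: ((0, delta_mx 0 a) : R4)) oD Dz) => t Dt.
  rewrite [RHS](_ : _ = c ^+ n.+1 * h (t *: (c^-1 *: ((0, delta_mx 0 a) : R4)) + z)) // -hh //.
  congr (h _); congr pair; rewrite /= ?scaler0 ?add0r //.
  by rewrite scalerDr !scalerA mulrCA divff ?mulr1 // gt_eqF.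
have -> : (fun w => c ^+ n.+1 *: h w) = c ^+ n.+1 \*: h by [].
rewrite deriveZ; last by apply: diff_derivable.
by rewrite deriveZdir // scalerA exprS mulrAC divff ?mul1r // gt_eqF.
Qed.

Lemma homogeneous_dx n h a : smooth_on D h -> homogeneous n h ->
  homogeneous n (dx a h).
Proof.
move=> hs hh z c Dz c0; rewrite /dx.
have dh : differentiable h z by apply: (Ck_differentiable (hs 1)).
have -> : 'D_((delta_mx 0 a, 0) : R4) h (z.1, c *: z.2) =
    'D_((delta_mx 0 a, 0) : R4) (fun w => c ^+ n *: h w) z.
  apply: derive_near_line.
  apply: filterS (near_line ((delta_mx 0 a, 0) : R4) oD Dz) => t Dt.
  rewrite [RHS](_ : _ = c ^+ n * h (t *: ((delta_mx 0 a, 0) : R4) + z)) // -hh //.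
  by congr (h _); congr pair; rewrite /= ?scaler0 ?add0r.
have -> : (fun w => c ^+ n *: h w) = c ^+ n \*: h by [].
by rewrite deriveZ //; apply: diff_derivable.
Qed.

Lemma smooth_dy h a : smooth_on D h -> smooth_on D (dy a h).
Proof. by move=> hs k; exact: (Ck_derive _ (hs k.+1)). Qed.

Lemma smooth_dx h a : smooth_on D h -> smooth_on D (dx a h).
Proof. by move=> hs k; exact: (Ck_derive _ (hs k.+1)). Qed.

Lemma dydyC h a b z : smooth_on D h -> D z -> dy a (dy b h) z = dy b (dy a h) z.
Proof. by move=> hs Dz; exact: (schwarz _ _ oD Dz (hs 2)). Qed.

Lemma dxdyC h a b z : smooth_on D h -> D z -> dx a (dy b h) z = dy b (dx a h) z.
Proof. by move=> hs Dz; exact: (schwarz _ _ oD Dz (hs 2)). Qed.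

Lemma dy_eq h h' a z : (forall y, D y -> h y = h' y) -> D z -> dy a h z = dy a h' z.
Proof. by move=> E Dz; apply: near_eq_derive; exact: near_open oD Dz _. Qed.

Lemma dx_eq h h' a z : (forall y, D y -> h y = h' y) -> D z -> dx a h z = dx a h' z.
Proof. by move=> E Dz; apply: near_eq_derive; exact: near_open oD Dz _. Qed.

Lemma derive_dxdy h z (v : R4) : differentiable h z ->
  'D_v h z = \sum_(a < 2) v.1 0 a * dx a h z + \sum_(a < 2) v.2 0 a * dy a h z.
Proof.
move=> dh; have -> : v = (v.1, 0) + (0, v.2).
  by rewrite [LHS]surjective_pairing; congr pair; rewrite /= ?addr0 ?add0r.
rewrite deriveDdir //=; congr (_ + _).
  have -> : (v.1, 0) = \sum_a (v.1 0 a *: ((delta_mx 0 a, 0) : R4)).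
    rewrite [in LHS](row_sum_delta v.1) !sum2.
    by congr pair; rewrite /= ?scaler0 ?addr0.
  rewrite derive_sumdir //; apply: eq_bigr => a _.
  by rewrite deriveZdir // addr0.
have -> : (0, v.2) = \sum_a (v.2 0 a *: ((0, delta_mx 0 a) : R4)).
  rewrite [in LHS](row_sum_delta v.2) !sum2.
  by congr pair; rewrite /= ?scaler0 ?addr0.
rewrite derive_sumdir //; apply: eq_bigr => a _.
by rewrite deriveZdir // add0r.
Qed.

Lemma derive_dy h z (w : R2) : differentiable h z ->
  'D_((0, w) : R4) h z = \sum_(a < 2) w 0 a * dy a h z.
Proof.
move=> dh; rewrite derive_dxdy // [X in X + _]big1 ?add0r // => a _ /=.
by rewrite mxE mul0r.
Qed.

Lemma smooth_diff (h : R4 -> R) z : smooth_on D h -> D z -> differentiable h z.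
Proof. by move=> hs Dz; apply: (Ck_differentiable (hs 1)). Qed.

Lemma euler_dy n h z : smooth_on D h -> homogeneous n h -> D z ->
  dy 0 h z * z.2 0 0 + dy 1 h z * z.2 0 1 = n%:R * h z.
Proof.
move=> hs hh Dz; rewrite -(euler hh Dz) derive_dy ?sum2; last exact: smooth_diff.
by rewrite mulrC [X in _ + X]mulrC.
Qed.

Definition energy (z : R4) : R := f z ^+ 2.

Lemma energy_smooth : smooth_on D energy.
Proof. by move=> k; apply: Ck_exp; [exact: oD|exact: locF_smooth]. Qed.

Lemma energy_homogeneous : homogeneous 2 energy.
Proof. by move=> z c [iz _] c0; rewrite /energy locF_homog // exprMn. Qed.

Lemma gmxE z a b : gmx F i z a b = 2^-1 * dy a (dy b energy) z.
Proof. by rewrite /gmx mxE. Qed.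

Lemma gij_smooth a b : smooth_on D (gij F i a b).
Proof.
move=> k; apply: (Ck_eq oD (fun z _ => gmxE z a b)).
apply: Ck_mul; [exact: oD|exact: Ck_cst|].
by apply: smooth_dy; apply: smooth_dy; exact: energy_smooth.
Qed.

Lemma gmx_sym z a b : D z -> gmx F i z a b = gmx F i z b a.
Proof. by move=> Dz; rewrite !gmxE dydyC //; exact: energy_smooth. Qed.

Lemma quad2 (A : 'M[R]_2) (v : R2) : (v *m A *m v^T) 0 0 =
  v 0 0 * v 0 0 * A 0 0 + v 0 0 * v 0 1 * (A 0 1 + A 1 0) + v 0 1 * v 0 1 * A 1 1.
Proof. by rewrite !mxE !sum2 !mxE !sum2; ring. Qed.

Lemma det2 (A : 'M[R]_2) : \det A = A 0 0 * A 1 1 - A 0 1 * A 1 0.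
Proof.
rewrite (expand_det_row _ 0) sum2 /cofactor !det_mx11 !mxE /=.
have -> : lift 0 0 = 1 :> 'I_2 by apply: val_inj.
have -> : lift 1 0 = 0 :> 'I_2 by apply: val_inj.
by rewrite expr0 expr1; ring.
Qed.

Lemma gmx00_gt0 z : D z -> 0 < gmx F i z 0 0.
Proof.
move=> Dz; have := finsler_convex HF Dz (v := delta_mx 0 0).
rewrite quad2 !mxE /= !mulr0 !mul0r !addr0 !mul1r; apply.
by apply/negP => /eqP/matrixP/(_ 0 0)/eqP; rewrite !mxE /= oner_eq0.
Qed.

Lemma det_gmx_gt0 z : D z -> 0 < \det (gmx F i z).
Proof.
move=> Dz; have g0 := gmx00_gt0 Dz; rewrite det2 (gmx_sym 1 0 Dz).
set g00 := gmx F i z 0 0 in g0 *; set g01 := gmx F i z 0 1; set g11 := gmx F i z 1 1.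
(* On (-g01, g00) the quadratic form equals g00 det(g), and g00 > 0 is already known. *)
pose v : R2 := \row_a (if a == 0 then - g01 else g00).
have v0 : v != 0.
  apply/negP => /eqP/matrixP/(_ 0 1)/eqP; rewrite !mxE /=.
  by rewrite gt_eqF.
have := finsler_convex HF Dz v0.
rewrite quad2 (gmx_sym 1 0 Dz) -/g00 -/g01 -/g11 !mxE /=.
clearbody g00 g01 g11 => H.
have E : - g01 * - g01 * g00 + - g01 * g00 * (g01 + g01) + g00 * g00 * g11 =
  g00 * (g00 * g11 - g01 * g01) by ring.
by move: H; rewrite E pmulr_rgt0.
Qed.

Lemma quad_euler0 (p00 p01 p10 p11 q0 q1 y0 y1 : R) : p10 = p01 ->
  q0 * y0 + q1 * y1 = 0 -> p00 * y0 + p10 * y1 = q0 -> p01 * y0 + p11 * y1 = q1 ->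
  y0 * y0 * (2^-1 * p00) + y0 * y1 * (2^-1 * p01 + 2^-1 * p10) + y1 * y1 * (2^-1 * p11) = 0.
Proof.
move=> -> H1 H2 H3.
transitivity (2^-1 * ((p00 * y0 + p01 * y1) * y0 + (p01 * y0 + p11 * y1) * y1)).
  by ring.
by rewrite H2 H3 H1 mulr0.
Qed.

(** [finsler] grants only F >= 0. Two uses of Euler's identity give g_y(y, y) = F^2, so a zero of F
    at y != 0 would contradict positive definiteness. *)
Lemma locF_gt0 z : D z -> 0 < f z.
Proof.
move=> Dz; rewrite lt_neqAle locF_ge0 andbT eq_sym; apply/eqP => f0.
have E0 : energy z = 0 by rewrite /energy f0 expr0n.
have H1 := euler_dy energy_smooth energy_homogeneous Dz.
have hd a := homogeneous_dy a energy_smooth energy_homogeneous.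
have sd a := smooth_dy a energy_smooth.
have H2 a := euler_dy (sd a) (hd a) Dz.
have := finsler_convex HF Dz Dz.2.
rewrite quad2.
rewrite !gmxE.
have C := @dydyC energy 1 0 z energy_smooth Dz.
have H20 := etrans (H2 0) (mul1r _); have H21 := etrans (H2 1) (mul1r _).
rewrite E0 mulr0 in H1.
by rewrite (quad_euler0 C H1 H20 H21) ltxx.
Qed.

End ChartFinsler.

(** * Chart independence of the first two coframe forms *)

Section CanonicalForms.
Context {R : realType} {M : topologicalType} (S : surface R M).
Local Notation R2 := 'rV[R]_2.
Local Notation R4 := ('rV[R]_2 * 'rV[R]_2)%type.
Variables (F : TM S -> R) (HF : finsler F).
Implicit Types (i j : idx S) (z v : R4).

(** As a vertical derivative of F, omega2 inherits its invariance from the linearity of chart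
    changes on fibres. *)
Lemma omega2E i z v : tdom i z -> omega2 F i z v = 'D_((0, v.1) : R4) (loc i F) z.
Proof.
move=> Dz; rewrite (derive_dy v.1 (smooth_diff (@locF_smooth _ _ _ _ HF i) Dz)).
by rewrite /omega2; apply: eq_bigr => a _; rewrite mulrC.
Qed.

Lemma omega2_form : is_one_form (omega2 F).
Proof.
split.
- move=> i z _ a u v; rewrite /omega2 !sum2 /= !mxE /GRing.scale /=.
  move: (dy 0 _ z) (dy 1 _ z) => A B; ring.
- move=> i v k; have oD := @open_tdom R M S i.
  apply: Ck_sum => // a; apply: Ck_mul => //; last exact: Ck_cst.
  by apply: smooth_dy; exact: locF_smooth.
- move=> i j z v Dz jz.
  have ij : overlap i j z.1 by apply/overlapP; split=> //; case: Dz.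
  have E := derive_vertical_ttrans v.1 ij (fun y yij => loc_ttrans F yij).
  have E2 := f_equal (fun w => 'D_((0, w) : R4) (loc j F) (ttrans i j z)) (derive_ttrans1 v ij).
  exact: etrans (omega2E v Dz)
    (etrans E (esym (etrans (omega2E _ (tdom_ttrans ij Dz)) E2))).
Qed.

Lemma derive_comb2 (V : normedModType R) (A B : V -> R) (a b : R) (x v : V) :
  differentiable A x -> differentiable B x ->
  'D_v (fun y => a * A y + b * B y) x = a * 'D_v A x + b * 'D_v B x.
Proof.
move=> dA dB; have dA' := diff_derivable (v := v) dA; have dB' := diff_derivable (v := v) dB.
rewrite [LHS](deriveD (derivableZ (k := a) dA') (derivableZ (k := b) dB')).
by rewrite (deriveZ a dA') (deriveZ b dB').
Qed.

Lemma energy_ttrans i j z : overlap i j z.1 -> energy F i z = energy F j (ttrans i j z).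
Proof. by move=> ij; rewrite /energy (loc_ttrans _ ij). Qed.

Lemma bilinear_comb (X X0 X1 : R) (u w : R2) (p : 'I_2 -> 'I_2 -> R) :
  X = w 0 0 * X0 + w 0 1 * X1 -> X0 = u 0 0 * p 0 0 + u 0 1 * p 1 0 ->
  X1 = u 0 0 * p 0 1 + u 0 1 * p 1 1 ->
  X = \sum_(c < 2) \sum_(d < 2) u 0 c * w 0 d * p c d.
Proof. by move=> -> -> ->; rewrite !sum2; ring. Qed.

Lemma bilinear_half (X : R) (u w : R2) (p q : 'I_2 -> 'I_2 -> R) :
  X = \sum_(c < 2) \sum_(d < 2) u 0 c * w 0 d * p c d ->
  (forall c d, q c d = 2^-1 * p c d) ->
  2^-1 * X = \sum_(c < 2) \sum_(d < 2) u 0 c * w 0 d * q c d.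
Proof. by move=> -> E; rewrite !sum2 !E; ring. Qed.

Lemma vertical_hessian j (u w : R2) z : tdom j z ->
  'D_((0, u) : R4) (fun y => 'D_((0, w) : R4) (energy F j) y) z =
  \sum_(c < 2) \sum_(d < 2) u 0 c * w 0 d * dy c (dy d (energy F j)) z.
Proof.
move=> Dz; have oD := @open_tdom R M S j.
have es := @energy_smooth _ _ _ _ HF j.
have ds d := smooth_dy d es.
have ee y : tdom j y -> 'D_((0, w) : R4) (energy F j) y =
    w 0 0 * dy 0 (energy F j) y + w 0 1 * dy 1 (energy F j) y.
  by move=> Dy; rewrite (derive_dy w (smooth_diff es Dy)) sum2.
have -> : 'D_((0, u) : R4) (fun y => 'D_((0, w) : R4) (energy F j) y) z =
   'D_((0, u) : R4) (fun y => w 0 0 * dy 0 (energy F j) y + w 0 1 * dy 1 (energy F j) y) z.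
  by apply: near_eq_derive; exact: near_open oD Dz ee.
have d0 := smooth_diff (ds 0) Dz; have d1 := smooth_diff (ds 1) Dz.
have E := derive_comb2 (w 0 0) (w 0 1) ((0, u) : R4) d0 d1.
have E0 := derive_dy u d0; have E1 := derive_dy u d1.
rewrite sum2 in E0; rewrite sum2 in E1.
exact (bilinear_comb (p := fun c d => dy c (dy d (energy F j)) z) E E0 E1).
Qed.

Definition dtrans i j (x : R2) (a : 'I_2) : R2 := 'D_(delta_mx 0 a) (trans i j) x.

Lemma gmx_ttrans i j z a b : overlap i j z.1 -> tdom i z ->
  let w := dtrans i j z.1 in
  gmx F i z a b = \sum_(c < 2) \sum_(d < 2) w a 0 c * w b 0 d * gmx F j (ttrans i j z) c d.
Proof.
move=> ij Dz w; refine (etrans (gmxE F i z a b) _).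
have E : dy a (dy b (energy F i)) z =
    'D_((0, w a) : R4) (fun y => 'D_((0, w b) : R4) (energy F j) y) (ttrans i j z).
  apply: derive_same_line => h.
  have e1 : (h *: ((0, delta_mx 0 a) : R4) + z).1 = z.1 by rewrite /= scaler0 add0r.
  have ij' : overlap i j (h *: ((0, delta_mx 0 a) : R4) + z).1 by rewrite e1.
  have E' := derive_vertical_ttrans (delta_mx 0 b) ij' (fun y yij => energy_ttrans yij).
  rewrite e1 (ttrans_vertical (delta_mx 0 a) h ij) in E'.
  exact E'.
refine (etrans (f_equal (fun r => 2^-1 * r) E) _).
exact (bilinear_half (vertical_hessian (w a) (w b) (tdom_ttrans ij Dz))
  (fun c d => gmxE F j (ttrans i j z) c d)).
Qed.

Lemma det_trans_gt0 i j x : overlap i j x ->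
  0 < dtrans i j x 0 0 0 * dtrans i j x 1 0 1 - dtrans i j x 0 0 1 * dtrans i j x 1 0 0.
Proof.
move=> ij; have [ix jx] := (overlapP i j x).1 ij.
have := trans_oriented (dom_chartV ix) jx; rewrite chartVK // -/(trans i j) det2.
have E a b : jacobian (trans i j) x a b = dtrans i j x a 0 b.
  by rewrite /dtrans (deriveEjacobian _ (trans_diff ij)) -rowE [RHS]mxE.
by rewrite !E.
Qed.

Definition area (i : idx S) (z : R4) : R := Num.sqrt (\det (gmx F i z)) / loc i F z.

Lemma area_smooth i : smooth_on (@tdom R M S i) (area i).
Proof.
move=> k; have oD := @open_tdom R M S i.
apply: Ck_mul => //; last first.
  apply: Ck_inv => //; last exact: locF_smooth.
  by move=> z Dz; rewrite gt_eqF // locF_gt0.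
apply: Ck_sqrt => //; first by move=> z; exact: det_gmx_gt0.
apply: (Ck_eq oD (fun z _ => det2 (gmx F i z))).
by apply: Ck_sub_fun => //; apply: Ck_mul => //; exact: gij_smooth.
Qed.

Lemma area_gt0 i z : tdom i z -> 0 < area i z.
Proof. by move=> Dz; rewrite divr_gt0 ?locF_gt0 // sqrtr_gt0 det_gmx_gt0. Qed.

Lemma omega1E i z v : omega1 F i z v =
  area i z * (z.2 0 1 * v.1 0 0 - z.2 0 0 * v.1 0 1).
Proof. by []. Qed.

Lemma comb2_coord (a : 'I_2 -> R) (u : 'I_2 -> R2) b :
  (\sum_(j < 2) a j *: u j) 0 b = a 0 * u 0 0 b + a 1 * u 1 0 b.
Proof. by rewrite sum2 !mxE. Qed.

Lemma derive_transE i j (x w : R2) b : overlap i j x ->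
  ('D_w (trans i j) x) 0 b = w 0 0 * dtrans i j x 0 0 b + w 0 1 * dtrans i j x 1 0 b.
Proof.
move=> ij; refine (etrans (f_equal (fun u : R2 => u 0 b) (derive_rV w (trans_diff ij))) _).
exact (comb2_coord (fun a => w 0 a) (dtrans i j x) b).
Qed.

(** From det A = J^2 det B the root gives |J|. The oriented atlas supplies J > 0; for J < 0 the form
    omega1 would change sign from one chart to the other. *)
Lemma sqrt_det_change (w : 'I_2 -> R2) (A B : 'M[R]_2) :
  0 < w 0 0 0 * w 1 0 1 - w 0 0 1 * w 1 0 0 ->
  (forall a b, A a b = \sum_(c < 2) \sum_(d < 2) w a 0 c * w b 0 d * B c d) ->
  Num.sqrt (\det A) = (w 0 0 0 * w 1 0 1 - w 0 0 1 * w 1 0 0) * Num.sqrt (\det B).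
Proof.
move=> J0 gE; set J := _ - _.
have -> : \det A = J ^+ 2 * \det B.
  rewrite !det2 !gE !sum2 /J.
  move: (B 0 0) (B 0 1) (B 1 0) (B 1 1) (w 0 0 0) (w 0 0 1) (w 1 0 0) (w 1 0 1).
  by move=> *; ring.
by rewrite sqrtrM ?sqr_ge0 // sqrtr_sqr gtr0_norm.
Qed.

Lemma area_ttrans i j z : overlap i j z.1 -> tdom i z ->
  area i z = (dtrans i j z.1 0 0 0 * dtrans i j z.1 1 0 1
    - dtrans i j z.1 0 0 1 * dtrans i j z.1 1 0 0) * area j (ttrans i j z).
Proof.
move=> ij Dz; rewrite /area (loc_ttrans F ij) mulrA; congr (_ / _).
exact (sqrt_det_change (det_trans_gt0 ij) (fun a b => gmx_ttrans a b ij Dz)).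
Qed.

Lemma area_form_change (A A' p q r s y0 y1 v0 v1 Y0 Y1 V0 V1 : R) :
  A = (p * s - q * r) * A' ->
  Y0 = y0 * p + y1 * r -> Y1 = y0 * q + y1 * s ->
  V0 = v0 * p + v1 * r -> V1 = v0 * q + v1 * s ->
  A * (y1 * v0 - y0 * v1) = A' * (Y1 * V0 - Y0 * V1).
Proof. by move=> -> -> -> -> ->; ring. Qed.

Lemma omega1_form : is_one_form (omega1 F).
Proof.
split.
- move=> i z _ a u v; rewrite !omega1E /= !mxE /GRing.scale /=.
  move: (area i z) => A; ring.
- move=> i v k; have oD := @open_tdom R M S i.
  have sy a : Ck k (@tdom R M S i) (fun z => z.2 0 a).
    by apply: Ck_coord => //; apply: Ck_snd => //; exact: Ck_id.
  apply: Ck_mul => //; first exact: area_smooth.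
  by apply: Ck_sub_fun => //; apply: Ck_mul => //; exact: Ck_cst.
- move=> i j z v Dz jz.
  have ij : overlap i j z.1 by apply/overlapP; split=> //; case: Dz.
  rewrite !omega1E derive_ttrans1 //.
  exact (area_form_change (area_ttrans ij Dz) (derive_transE z.2 0 ij) (derive_transE z.2 1 ij)
    (derive_transE v.1 0 ij) (derive_transE v.1 1 ij)).
Qed.

End CanonicalForms.

Section ProductRules.
Context {R : realType} {V : normedModType R}.
Implicit Types (A B : V -> R) (x v : V).

Lemma derive_mul A B x v : differentiable A x -> differentiable B x ->
  'D_v (fun y => A y * B y) x = A x * 'D_v B x + B x * 'D_v A x.
Proof. by move=> dA dB; exact: (deriveM (diff_derivable dA) (diff_derivable dB)). Qed.

Lemma derive_sub A B x v : differentiable A x -> differentiable B x ->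
  'D_v (fun y => A y - B y) x = 'D_v A x - 'D_v B x.
Proof. by move=> dA dB; exact: (deriveB (diff_derivable dA) (diff_derivable dB)). Qed.

Lemma derive_half A x v : differentiable A x ->
  'D_v (fun y => 2^-1 * A y) x = 2^-1 * 'D_v A x.
Proof. by move=> dA; exact: (deriveZ 2^-1 (diff_derivable dA)). Qed.

Lemma derive_square A x v : differentiable A x ->
  'D_v (fun y => A y ^+ 2) x = 2 * A x * 'D_v A x.
Proof.
move=> dA; refine (etrans (derive_mul v dA dA) _).
by move: (A x) ('D_v A x) => p q; ring.
Qed.

End ProductRules.

Lemma half_eq (R : realType) (p q : R) : p = q -> 2^-1 * p = 2^-1 * q.
Proof. by move=> ->. Qed.

Lemma spray_sum (R : realType) (y : 'rV[R]_2) (s A B : 'I_2 -> R) :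
  \sum_(a < 2) y 0 a * A a + \sum_(a < 2) (\row_b - s b) 0 a * B a =
  y 0 0 * A 0 + y 0 1 * A 1 - (s 0 * B 0 + s 1 * B 1).
Proof. by rewrite !sum2 !mxE; ring. Qed.

Lemma half_sums (R : realType) (X : R) (p q A A' B B' : 'I_2 -> R) :
  X = \sum_(a < 2) p a * A a + \sum_(b < 2) q b * B b ->
  (forall a, A' a = 2^-1 * A a) -> (forall b, B' b = 2^-1 * B b) ->
  2^-1 * X = \sum_(a < 2) p a * A' a + \sum_(b < 2) q b * B' b.
Proof. by move=> -> A2 B2; rewrite !sum2 !A2 !B2; ring. Qed.

Lemma sum22 (R : realType) (p q : 'rV[R]_2) (A B : 'I_2 -> R) :
  \sum_(a < 2) p 0 a * A a + \sum_(b < 2) q 0 b * B b =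
  p 0 0 * A 0 + p 0 1 * A 1 + (q 0 0 * B 0 + q 0 1 * B 1).
Proof. by rewrite !sum2. Qed.

Lemma omega2_sum (R : realType) (A : 'I_2 -> R) (v : 'rV[R]_2) :
  \sum_(a < 2) A a * v 0 a = v 0 0 * A 0 + v 0 1 * A 1.
Proof. by rewrite sum2 mulrC [X in _ + X]mulrC. Qed.

(** [X0], [X1] and [Y0], [Y1] are the derivatives of dF/dy along u = (T, U) and along the spray. By
    the geodesic equation the latter equal dL/dx; Euler's identities turn y.X into 2 T.Lx + U.q, and
    the difference T.Lx + U.q vanishes since u is tangent to the indicatrix. *)
Lemma ext_d_omega2_algebra (R : realType) (y T U : 'rV[R]_2) (H Lx q : 'I_2 -> R)
  (g qx : 'I_2 -> 'I_2 -> R) (X0 X1 Y0 Y1 : R) :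
  X0 = T 0 0 * qx 0 0 + T 0 1 * qx 1 0 + (U 0 0 * g 0 0 + U 0 1 * g 1 0) ->
  X1 = T 0 0 * qx 0 1 + T 0 1 * qx 1 1 + (U 0 0 * g 0 1 + U 0 1 * g 1 1) ->
  Y0 = y 0 0 * qx 0 0 + y 0 1 * qx 1 0 - (H 0 * g 0 0 + H 1 * g 1 0) ->
  Y1 = y 0 0 * qx 0 1 + y 0 1 * qx 1 1 - (H 0 * g 0 1 + H 1 * g 1 1) ->
  g 1 0 = g 0 1 ->
  g 0 0 * H 0 + g 0 1 * H 1 = qx 0 0 * y 0 0 + qx 1 0 * y 0 1 - Lx 0 ->
  g 1 0 * H 0 + g 1 1 * H 1 = qx 0 1 * y 0 0 + qx 1 1 * y 0 1 - Lx 1 ->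
  qx 0 0 * y 0 0 + qx 0 1 * y 0 1 = 2 * Lx 0 ->
  qx 1 0 * y 0 0 + qx 1 1 * y 0 1 = 2 * Lx 1 ->
  g 0 0 * y 0 0 + g 0 1 * y 0 1 = q 0 ->
  g 1 0 * y 0 0 + g 1 1 * y 0 1 = q 1 ->
  T 0 0 * Lx 0 + T 0 1 * Lx 1 + (U 0 0 * q 0 + U 0 1 * q 1) = 0 ->
  y 0 0 * X0 + y 0 1 * X1 - (T 0 0 * Y0 + T 0 1 * Y1) = 0.
Proof.
move=> -> -> -> -> g_sym G0 G1 Q0 Q1 <- <- TU.
have -> : y 0 0 * qx 0 0 + y 0 1 * qx 1 0 - (H 0 * g 0 0 + H 1 * g 1 0) = Lx 0.
  rewrite g_sym; have -> : Lx 0 = qx 0 0 * y 0 0 + qx 1 0 * y 0 1 - (g 0 0 * H 0 + g 0 1 * H 1).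
    by rewrite G0; ring.
  ring.
have -> : y 0 0 * qx 0 1 + y 0 1 * qx 1 1 - (H 0 * g 0 1 + H 1 * g 1 1) = Lx 1.
  rewrite -g_sym; have -> : Lx 1 = qx 0 1 * y 0 0 + qx 1 1 * y 0 1 - (g 1 0 * H 0 + g 1 1 * H 1).
    by rewrite G1; ring.
  ring.
rewrite -[RHS]TU.
transitivity (T 0 0 * (qx 0 0 * y 0 0 + qx 0 1 * y 0 1) + T 0 1 * (qx 1 0 * y 0 0 + qx 1 1 * y 0 1)
  + (U 0 0 * (g 0 0 * y 0 0 + g 0 1 * y 0 1) + U 0 1 * (g 1 0 * y 0 0 + g 1 1 * y 0 1))
  - (T 0 0 * Lx 0 + T 0 1 * Lx 1)); first by ring.
by rewrite Q0 Q1; ring.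
Qed.

(** Differentiate det(g) = A^2 F^2 along the spray, where F^2 (here [e]) is 1 and has derivative 0:
    then 2 A DA equals 2 d tr = 2 A^2 tr. *)
Lemma area_spray_algebra (R : realType) (D0 DA DE A e tr d : R) (g Dg sg : 'I_2 -> 'I_2 -> R) :
  D0 = g 0 0 * Dg 1 1 + g 1 1 * Dg 0 0 - (g 0 1 * Dg 1 0 + g 1 0 * Dg 0 1) ->
  D0 = A ^+ 2 * DE + e * (2 * A * DA) ->
  Dg 0 0 = sg 0 0 -> Dg 0 1 = sg 0 1 -> Dg 1 0 = sg 1 0 -> Dg 1 1 = sg 1 1 ->
  DE = 0 -> e = 1 ->
  sg 0 0 * g 1 1 + g 0 0 * sg 1 1 - (sg 0 1 * g 1 0 + g 0 1 * sg 1 0) = 2 * d * tr ->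
  d = A ^+ 2 -> A != 0 -> DA = A * tr.
Proof.
move=> E1 E2 g00 g01 g10 g11 DE0 e1 SD dA A0.
apply: (mulfI (_ : 2 * A != 0)); first by rewrite mulf_neq0.
have -> : 2 * A * (A * tr) = 2 * d * tr by rewrite dA; ring.
rewrite -SD -g00 -g01 -g10 -g11.
have -> : 2 * A * DA = D0 by rewrite E2 DE0 e1; ring.
by rewrite E1; ring.
Qed.

(** With the matrix C^a_j = c^a_{jk} y^k one has U = lam T - CT, s = Cy and DA = A tr(C). Everything
    except the lam term cancels by the 2 x 2 identity tr(C) y^T = (Cy)^T + y^(CT). *)
Lemma ext_d_omega1_algebra (R : realType) (A DA DA' lam : R) (y T U : 'rV[R]_2)
  (s : 'I_2 -> R) (c : 'I_2 -> 'I_2 -> 'I_2 -> R) :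
  DA = A * \sum_(a < 2) \sum_(k < 2) c a a k * y 0 k ->
  U 0 0 + \sum_(j < 2) \sum_(k < 2) T 0 j * y 0 k * c 0 j k = lam * T 0 0 ->
  U 0 1 + \sum_(j < 2) \sum_(k < 2) T 0 j * y 0 k * c 1 j k = lam * T 0 1 ->
  s 0 = \sum_(j < 2) \sum_(k < 2) c 0 j k * y 0 j * y 0 k ->
  s 1 = \sum_(j < 2) \sum_(k < 2) c 1 j k * y 0 j * y 0 k ->
  A * ((\row_a - s a) 0 1 * T 0 0 - (\row_a - s a) 0 0 * T 0 1)
    + (y 0 1 * T 0 0 - y 0 0 * T 0 1) * DA
  - (A * (U 0 1 * y 0 0 - U 0 0 * y 0 1) + (y 0 1 * y 0 0 - y 0 0 * y 0 1) * DA')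
  = lam * (A * (y 0 1 * T 0 0 - y 0 0 * T 0 1)).
Proof.
move=> -> H0 H1 s0 s1; rewrite !mxE s0 s1.
have -> : U 0 0 = lam * T 0 0 - \sum_(j < 2) \sum_(k < 2) T 0 j * y 0 k * c 0 j k by rewrite -H0 addrK.
have -> : U 0 1 = lam * T 0 1 - \sum_(j < 2) \sum_(k < 2) T 0 j * y 0 k * c 1 j k by rewrite -H1 addrK.
rewrite !sum2; ring.
Qed.

Lemma omega3_algebra (R : realType) (E1 E2 I s1 s2 s3 u1 u2 u3 lam : R) :
  E2 = 0 -> E1 = lam * u1 -> E2 = - (u1 * s3 - s1 * u3) ->
  E1 = - I * (s1 * u3 - u1 * s3) + (s2 * u3 - u2 * s3) ->
  s1 = 0 -> s2 = 1 -> u2 = 0 -> u1 != 0 -> u3 = lam * u1.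
Proof.
move=> -> -> H1 H2 s10 s21 u20 u1n0; move: H1 H2; rewrite s10 s21 u20.
rewrite !mul0r subr0 mul1r sub0r subr0 => /esym/eqP.
rewrite oppr_eq0 mulf_eq0 (negbTE u1n0) /= => /eqP -> ->.
by rewrite mulr0 oppr0 mulr0 add0r.
Qed.

Lemma spray_g2 (R : realType) gi gx gy (y : 'I_2 -> R) a b : spray_g gi gx gy y a b =
  y 0 * gx 0 a b + y 1 * gx 1 a b
  - (spray_ gi gx gy y 0 * gy 0 a b + spray_ gi gx gy y 1 * gy 1 a b).
Proof. by rewrite /spray_g !sum2. Qed.

(** * Exterior derivatives of the coframe along the geodesic spray *)

Section GeodesicSpray.
Context {R : realType} {M : topologicalType} (S : surface R M).
Local Notation R2 := 'rV[R]_2.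
Local Notation R4 := ('rV[R]_2 * 'rV[R]_2)%type.
Variables (F : TM S -> R) (HF : finsler F) (i : idx S) (z : R4).
Local Notation D := (@tdom R M S i).
Hypothesis Dz : D z.
Local Notation f := (loc i F).
Local Notation E := (energy F i).

(** From here to [spray], the abstract data of the Chern algebra are given their values at z, in
    such a form that [chern_] at these values is convertible to [chern F i] at z. *)
Definition yc (a : 'I_2) : R := z.2 0 a.
Definition gc (a b : 'I_2) : R := gmx F i z a b.
Definition gic (a b : 'I_2) : R := ginv F i a b z.
Definition gxc (c a b : 'I_2) : R := dx c (gij F i a b) z.
Definition gyc (c a b : 'I_2) : R := dy c (gij F i a b) z.
Definition qc (a : 'I_2) : R := 2^-1 * dy a E z.
Definition qxc (c a : 'I_2) : R := 2^-1 * dx c (dy a E) z.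
Definition Lxc (c : 'I_2) : R := 2^-1 * dx c E z.
Definition spray (a : 'I_2) : R := spray_ gic gxc gyc yc a.

Let oD : open D := @open_tdom R M S i.
Let Es : smooth_on D E := @energy_smooth _ _ _ _ HF i.
Let Eh : homogeneous i 2 E := @energy_homogeneous _ _ _ _ HF i.
Arguments oD : clear implicits.
Arguments Es : clear implicits.

Lemma gyc_half c a b : gyc c a b = 2^-1 * dy c (dy a (dy b E)) z.
Proof.
refine (etrans (dy_eq c (fun w _ => gmxE F i w a b) Dz) _).
exact: derive_half (smooth_diff (smooth_dy a (smooth_dy b Es)) Dz).
Qed.

Lemma gxc_half c a b : gxc c a b = 2^-1 * dx c (dy a (dy b E)) z.
Proof.
refine (etrans (dx_eq c (fun w _ => gmxE F i w a b) Dz) _).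
exact: derive_half (smooth_diff (smooth_dy a (smooth_dy b Es)) Dz).
Qed.

Lemma gc_sym : gc 1 0 = gc 0 1.
Proof. exact: gmx_sym. Qed.

Lemma gxc_sym c : gxc c 1 0 = gxc c 0 1.
Proof. by apply: dx_eq Dz => w Dw; exact: gmx_sym. Qed.

Lemma gyc_sym c : gyc c 1 0 = gyc c 0 1.
Proof. by apply: dy_eq Dz => w Dw; exact: gmx_sym. Qed.

(** Total symmetry of the third y-derivatives of F^2. It exchanges the direction of differentiation,
    where Euler's identity acts, with an index of g, where [gy_y] wants it. *)
Lemma gyc_swap c a b : gyc c a b = gyc b a c.
Proof.
refine (etrans (gyc_half c a b) (etrans _ (esym (gyc_half b a c)))).
apply: half_eq.
refine (etrans (dy_eq c (fun w Dw => dydyC a b Es Dw) Dz) _).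
refine (etrans (dydyC c b (smooth_dy a Es) Dz) _).
exact (dy_eq b (fun w Dw => dydyC c a Es Dw) Dz).
Qed.

Lemma gij_homogeneous a b : homogeneous i 0 (gij F i a b).
Proof.
move=> w c Dw c0.
have H := homogeneous_dy a (smooth_dy b Es) (homogeneous_dy b Es Eh) Dw c0.
refine (etrans (gmxE F i _ a b) (etrans (half_eq H) _)).
by rewrite expr0 !mul1r; exact (esym (gmxE F i w a b)).
Qed.

Lemma gyc_y c a : gyc c a 0 * yc 0 + gyc c a 1 * yc 1 = 0.
Proof.
rewrite (gyc_swap c a 0) (gyc_swap c a 1).
exact: etrans (euler_dy (@gij_smooth _ _ _ _ HF i a c) (gij_homogeneous a c) Dz) (mul0r _).
Qed.

Lemma half_comb (p0 p1 r0 r1 s n : R) : p0 * r0 + p1 * r1 = n * s ->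
  2^-1 * p0 * r0 + 2^-1 * p1 * r1 = n * (2^-1 * s).
Proof. by move=> H; rewrite -!mulrA -mulrDr H; ring. Qed.

Lemma qc_g a : gc a 0 * yc 0 + gc a 1 * yc 1 = qc a.
Proof.
have H := euler_dy (smooth_dy a Es) (homogeneous_dy a Es Eh) Dz.
have G b : gc a b = 2^-1 * dy b (dy a E) z.
  have G1 := half_eq (dydyC a b Es Dz).
  have G2 := gmxE F i z a b.
  exact (etrans G2 G1).
rewrite (G 0) (G 1); exact: etrans (half_comb H) (mul1r _).
Qed.

Lemma gxc_y c a : gxc c a 0 * yc 0 + gxc c a 1 * yc 1 = qxc c a.
Proof.
have H := euler_dy (smooth_dx c (smooth_dy a Es))
  (homogeneous_dx c (smooth_dy a Es) (homogeneous_dy a Es Eh)) Dz.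
have G b : gxc c a b = 2^-1 * dy b (dx c (dy a E)) z.
  refine (etrans (gxc_half c a b) (half_eq _)).
  refine (etrans (dx_eq c (fun w Dw => dydyC a b Es Dw) Dz) _).
  exact (dxdyC c b (smooth_dy a Es) Dz).
rewrite (G 0) (G 1); exact: etrans (half_comb H) (mul1r _).
Qed.

Lemma qxc_y c : qxc c 0 * yc 0 + qxc c 1 * yc 1 = 2 * Lxc c.
Proof.
have H := euler_dy (smooth_dx c Es) (homogeneous_dx c Es Eh) Dz.
have G b : qxc c b = 2^-1 * dy b (dx c E) z.
  exact: (half_eq (dxdyC c b Es Dz)).
by rewrite (G 0) (G 1); exact: half_comb H.
Qed.

Definition detc := gc 0 0 * gc 1 1 - gc 0 1 * gc 0 1.

Lemma detcE : \det (gmx F i z) = detc.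
Proof. by rewrite det2 /detc -[X in _ = _ - _ * X]gc_sym. Qed.

Lemma detc_gt0 : 0 < detc.
Proof. by rewrite -detcE det_gmx_gt0. Qed.

Lemma inv2 (A B : 'M[R]_2) : A *m B = 1%:M -> \det A != 0 ->
  [/\ B 0 0 = A 1 1 / \det A, B 0 1 = - A 0 1 / \det A,
      B 1 0 = - A 1 0 / \det A & B 1 1 = A 0 0 / \det A].
Proof.
move=> /matrixP AB; rewrite det2 => d0.
have := (AB 0 0, AB 0 1, AB 1 0, AB 1 1); rewrite !mxE !sum2 /=.
move: d0; move: (A 0 0) (A 0 1) (A 1 0) (A 1 1) (B 0 0) (B 0 1) (B 1 0) (B 1 1).
move=> p q r s b00 b01 b10 b11 d0 [[[H00 H01] H10] H11].
split; apply: (mulIf d0); rewrite mulfVK //.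
- have -> : b00 * (p * s - q * r) = s * (p * b00 + q * b10) - q * (r * b00 + s * b10) by ring.
  by rewrite H00 H10 mulr1 mulr0 subr0.
- have -> : b01 * (p * s - q * r) = s * (p * b01 + q * b11) - q * (r * b01 + s * b11) by ring.
  by rewrite H01 H11 mulr1 mulr0 sub0r.
- have -> : b10 * (p * s - q * r) = p * (r * b00 + s * b10) - r * (p * b00 + q * b10) by ring.
  by rewrite H00 H10 mulr1 mulr0 sub0r.
- have -> : b11 * (p * s - q * r) = p * (r * b01 + s * b11) - r * (p * b01 + q * b11) by ring.
  by rewrite H01 H11 mulr1 mulr0 subr0.
Qed.

Lemma gicE : [/\ gic 0 0 = gc 1 1 / detc, gic 0 1 = - gc 0 1 / detc,
  gic 1 0 = - gc 0 1 / detc & gic 1 1 = gc 0 0 / detc].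
Proof.
have d0 : \det (gmx F i z) != 0 by rewrite gt_eqF // det_gmx_gt0.
have U : gmx F i z \in unitmx by rewrite unitmxE unitfE.
have := inv2 (mulmxV U) d0.
by rewrite detcE -/(gc 1 0) gc_sym.
Qed.

Definition spray_vec : R4 := (z.2, \row_a - spray a).

Lemma derive_spray h : differentiable h z -> 'D_spray_vec h z =
  yc 0 * dx 0 h z + yc 1 * dx 1 h z - (spray 0 * dy 0 h z + spray 1 * dy 1 h z).
Proof.
move=> dh; refine (etrans (derive_dxdy spray_vec dh) _).
exact (spray_sum z.2 spray (fun a => dx a h z) (fun a => dy a h z)).
Qed.

Lemma spray_gE a b : 'D_spray_vec (gij F i a b) z = spray_g gic gxc gyc yc a b.
Proof.
refine (etrans (derive_spray (smooth_diff (@gij_smooth _ _ _ _ HF i a b) Dz)) _).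
exact (esym (spray_g2 gic gxc gyc yc a b)).
Qed.

Hypothesis f1 : f z = 1.

Lemma locF_diff : differentiable f z.
Proof. exact: smooth_diff (@locF_smooth _ _ _ _ HF i) Dz. Qed.

Lemma derive_energy v : 'D_v E z = 2 * 'D_v f z.
Proof.
refine (etrans (derive_square v locF_diff) _).
by rewrite f1 mulr1.
Qed.

Lemma dy_locF a : dy a f z = qc a.
Proof.
have H := derive_energy (0, delta_mx 0 a).
by rewrite /qc /dy H mulKf.
Qed.

Lemma dx_locF a : dx a f z = Lxc a.
Proof.
have H := derive_energy (delta_mx 0 a, 0).
by rewrite /Lxc /dx H mulKf.
Qed.

Lemma spray_tangent : 'D_spray_vec f z = 0.
Proof.
refine (etrans (derive_spray locF_diff) _).
have [g00 g01 g10 g11] := gicE.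
have d0 : detc != 0 by rewrite gt_eqF // detc_gt0.
have H := spray_L (gy := gyc) gc_sym gxc_sym gyc_y d0 g00 g01 g10 g11 qc_g gxc_y qxc_y.
rewrite (dx_locF 0) (dx_locF 1) (dy_locF 0) (dy_locF 1).
rewrite -[RHS]H /spray; congr (_ - _).
  by rewrite mulrC [X in _ + X]mulrC.
by rewrite mulrC [X in _ + X]mulrC.
Qed.

(** Differentiate dL/dy^a = F dF/dy^a: where F = 1 and u(F) = 0 this leaves the derivative of
    dF/dy^a. For tangent vectors the nondegenerate Hessian g thus replaces the degenerate Hessian of
    F. *)
Lemma derive_dy_tangent u a : 'D_u f z = 0 ->
  'D_u (dy a f) z = \sum_(c < 2) u.1 0 c * qxc c a + \sum_(b < 2) u.2 0 b * gc b a.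
Proof.
move=> fu.
have ds := smooth_dy a (@locF_smooth _ _ _ _ HF i).
have dd := smooth_diff ds Dz.
have H : 'D_u (dy a E) z = 2 * 'D_u (dy a f) z.
  have H1 : forall w, D w -> dy a E w = 2 * (f w * dy a f w).
    move=> w Dw; refine (etrans (derive_square (0, delta_mx 0 a) (smooth_diff (@locF_smooth _ _ _ _ HF i) Dw)) _).
    exact: esym (mulrA _ _ _).
  have H2 : 'D_u (dy a E) z = 'D_u (fun w => 2 * (f w * dy a f w)) z.
    by apply: near_eq_derive; exact: near_open oD Dz H1.
  have dp : differentiable (fun w => f w * dy a f w) z by exact: differentiableM locF_diff dd.
  refine (etrans H2 (etrans (deriveZ 2 (diff_derivable (v := u) dp)) _)).
  have H3 := derive_mul u locF_diff dd.
  refine (f_equal (fun r => 2 * r) (etrans H3 _)).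
  by rewrite fu f1 mulr0 addr0 mul1r.
have H4 := derive_dxdy u (smooth_diff (smooth_dy a Es) Dz).
have -> : 'D_u (dy a f) z = 2^-1 * 'D_u (dy a E) z by rewrite H mulKf.
exact (half_sums H4 (fun c => erefl (qxc c a)) (fun b => gmxE F i z b a)).
Qed.

Lemma derive_omega2 u v :
  'D_u (fun w => omega2 F i w v) z =
  v.1 0 0 * 'D_u (dy 0 f) z + v.1 0 1 * 'D_u (dy 1 f) z.
Proof.
have ds a := smooth_diff (smooth_dy a (@locF_smooth _ _ _ _ HF i)) Dz.
have -> : (fun w => omega2 F i w v) = (fun w => v.1 0 0 * dy 0 f w + v.1 0 1 * dy 1 f w).
  by apply/funext => w; exact (omega2_sum (fun a => dy a f w) v.1).
exact: derive_comb2.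
Qed.

Lemma ext_d_omega2_spray u : 'D_u f z = 0 -> ext_d (omega2 F) i z u spray_vec = 0.
Proof.
move=> fu; have fS := spray_tangent.
have [g00 g01 g10 g11] := gicE.
have d0 : detc != 0 by rewrite gt_eqF // detc_gt0.
have G := g_spray gc_sym gxc_sym gyc_y d0 g00 g01 g10 g11 gxc_y qxc_y.
have fu' : u.1 0 0 * Lxc 0 + u.1 0 1 * Lxc 1 + (u.2 0 0 * qc 0 + u.2 0 1 * qc 1) = 0.
  rewrite -(dx_locF 0) -(dx_locF 1) -(dy_locF 0) -(dy_locF 1).
  exact: etrans (esym (sum22 u.1 u.2 (fun a => dx a f z) (fun a => dy a f z)))
    (etrans (esym (derive_dxdy u locF_diff)) fu).
have Hu a := etrans (derive_dy_tangent a fu) (sum22 u.1 u.2 (fun c => qxc c a) (fun c => gc c a)).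
have HS a := etrans (derive_dy_tangent a fS) (spray_sum z.2 spray (fun c => qxc c a) (fun c => gc c a)).
refine (etrans (f_equal2 (fun p q => p - q) (derive_omega2 u spray_vec) (derive_omega2 spray_vec u)) _).
exact (ext_d_omega2_algebra (g := gc) (qx := qxc) (H := spray) (Lx := Lxc) (q := qc)
  (y := z.2) (T := u.1) (U := u.2) (Hu 0) (Hu 1) (HS 0) (HS 1) gc_sym (G 0) (G 1) (qxc_y 0) (qxc_y 1)
  (qc_g 0) (qc_g 1) fu').
Qed.

Lemma area_diff : differentiable (area F i) z.
Proof. exact: smooth_diff (@area_smooth _ _ _ _ HF i) Dz. Qed.

Lemma derive_omega1 u v : 'D_u (fun w => omega1 F i w v) z =
  area F i z * (u.2 0 1 * v.1 0 0 - u.2 0 0 * v.1 0 1)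
  + (z.2 0 1 * v.1 0 0 - z.2 0 0 * v.1 0 1) * 'D_u (area F i) z.
Proof.
pose l (w : R4) : R := w.2 0 1 * v.1 0 0 - w.2 0 0 * v.1 0 1.
have sl : smooth_on D l.
  move=> k; have sy a : Ck k D (fun w : R4 => w.2 0 a).
    by apply: Ck_coord => //; apply: Ck_snd => //; exact: Ck_id.
  by apply: Ck_sub_fun => //; apply: Ck_mul => //; exact: Ck_cst.
have lu : 'D_u l z = u.2 0 1 * v.1 0 0 - u.2 0 0 * v.1 0 1.
  apply: derive_affine; near=> h.
  by rewrite /l /= !mxE /GRing.scale /=; ring.
refine (etrans (derive_mul u area_diff (smooth_diff sl Dz)) _).
by rewrite lu.
Unshelve. all: by end_near. Qed.

Definition chernc (a j k : 'I_2) : R := chern_ gic gxc gyc yc a j k.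

Lemma derive_area_spray : 'D_spray_vec (area F i) z =
  area F i z * \sum_(a < 2) \sum_(k < 2) chernc a a k * yc k.
Proof.
have [g00 g01 g10 g11] := gicE.
have d0 : detc != 0 by rewrite gt_eqF // detc_gt0.
have SD := spray_det yc gc_sym gxc_sym gyc_sym d0 g00 g01 g10 g11.
have gd a b := smooth_diff (@gij_smooth _ _ _ _ HF i a b) Dz.
have E1 : 'D_spray_vec (fun w => \det (gmx F i w)) z =
    gc 0 0 * 'D_spray_vec (gij F i 1 1) z + gc 1 1 * 'D_spray_vec (gij F i 0 0) z
    - (gc 0 1 * 'D_spray_vec (gij F i 1 0) z + gc 1 0 * 'D_spray_vec (gij F i 0 1) z).
  have -> : (fun w => \det (gmx F i w)) =
      (fun w => gij F i 0 0 w * gij F i 1 1 w - gij F i 0 1 w * gij F i 1 0 w).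
    by apply/funext => w; exact: det2.
  have dm a b c d := differentiableM (gd a b) (gd c d).
  refine (etrans (derive_sub spray_vec (dm 0 0 1 1) (dm 0 1 1 0)) _).
  exact (f_equal2 (fun p q => p - q) (derive_mul spray_vec (gd 0 0) (gd 1 1))
    (derive_mul spray_vec (gd 0 1) (gd 1 0))).
(* Stated on the whole chart domain, because it is differentiated; hence the factor E = F^2 that
   compensates the division by F in [area]. *)
have H w : D w -> \det (gmx F i w) = area F i w ^+ 2 * E w.
  move=> Dw; rewrite /area /energy expr_div_n divfK ?expf_neq0 ?gt_eqF ?locF_gt0 //.
  by rewrite sqr_sqrtr // ltW // det_gmx_gt0.
have dA2 : differentiable (fun w => area F i w ^+ 2) z by exact: differentiableM area_diff area_diff.
have E2 : 'D_spray_vec (fun w => \det (gmx F i w)) z =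
    area F i z ^+ 2 * 'D_spray_vec E z + E z * (2 * area F i z * 'D_spray_vec (area F i) z).
  refine (etrans (near_eq_derive _ (near_open oD Dz H)) _).
  refine (etrans (derive_mul spray_vec dA2 (smooth_diff Es Dz)) _).
  exact (f_equal (fun r => _ + E z * r) (derive_square spray_vec area_diff)).
have E3 : 'D_spray_vec E z = 0.
  by refine (etrans (derive_energy spray_vec) _); rewrite spray_tangent mulr0.
have Ez : E z = 1 by rewrite /energy f1 expr1n.
have dz : detc = area F i z ^+ 2 by rewrite -detcE (H _ Dz) Ez mulr1.
have An0 : area F i z != 0 by rewrite gt_eqF // area_gt0.
exact (area_spray_algebra (g := gc) (Dg := fun a b => 'D_spray_vec (gij F i a b) z)
  (sg := spray_g gic gxc gyc yc) E1 E2 (spray_gE 0 0) (spray_gE 0 1) (spray_gE 1 0) (spray_gE 1 1)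
  E3 Ez SD dz An0).
Qed.

(** The hypothesis is D_T^(N) N = lam T for a curve (gamma, N) with velocity u at z. *)
Lemma ext_d_omega1_spray (u : R4) lam :
  (forall a, u.2 0 a + \sum_(j < 2) \sum_(k < 2) u.1 0 j * z.2 0 k * chern F i a j k z
     = lam * u.1 0 a) ->
  ext_d (omega1 F) i z spray_vec u = lam * omega1 F i z u.
Proof.
move=> Hu.
have CS a := chern_spray gic gxc gyc_y a.
have CS' a : spray a = \sum_(j < 2) \sum_(k < 2) chernc a j k * yc j * yc k.
  exact (esym (CS a)).
refine (etrans (f_equal2 (fun p q => p - q) (derive_omega1 spray_vec u) (derive_omega1 u spray_vec)) _).
exact (ext_d_omega1_algebra (s := spray) (c := chernc) (y := z.2) (T := u.1) (U := u.2) ('D_u (area F i) z)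
  derive_area_spray (Hu 0) (Hu 1) (CS' 0) (CS' 1)).
Qed.

Lemma omega1_spray : omega1 F i z spray_vec = 0.
Proof. by rewrite omega1E /= (mulrC (z.2 0 1)) subrr mulr0. Qed.

Lemma omega2_spray : omega2 F i z spray_vec = 1.
Proof.
have fh : homogeneous i 1 f by move=> w c [iw _] c0; exact: locF_homog.
have H := euler_dy (@locF_smooth _ _ _ _ HF i) fh Dz.
refine (etrans (omega2_sum (fun a => dy a f z) z.2) _).
rewrite -[RHS]f1 -[RHS]mul1r -[RHS]H.
exact: (f_equal2 (fun p q => p + q) (mulrC _ _) (mulrC _ _)).
Qed.

(* d omega2 (spray, u) = 0 gives omega3(spray) = 0; then d omega1 (spray, u) is
   omega3(u). *)
Lemma omega3_point (w3 : one_form S) (I J K : TM S -> R) (u : R4) lam :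
  finsler_coframe F w3 I J K -> 'D_u f z = 0 ->
  omega2 F i z u = 0 -> omega1 F i z u != 0 ->
  (forall a, u.2 0 a + \sum_(j < 2) \sum_(k < 2) u.1 0 j * z.2 0 k * chern F i a j k z
     = lam * u.1 0 a) ->
  w3 i z u = lam * omega1 F i z u.
Proof.
move=> HC fu u2 u1 Hu.
have zI : indicatrix F i z by split.
have fS := spray_tangent.
have d2 := coframe_d2 HC zI fu fS.
have d1 := coframe_d1 HC zI fS fu.
rewrite /wedge_form in d1; rewrite /wedge_form in d2.
exact (omega3_algebra (ext_d_omega2_spray fu) (ext_d_omega1_spray Hu) d2 d1
  omega1_spray omega2_spray u2 u1).
Qed.

End GeodesicSpray.

(** * Pullbacks of one-forms *)

Lemma sub_sum_cancel (V : zmodType) (p q r s : V) : r = s -> p + r - (q + s) = p - q.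
Proof. by move=> ->; rewrite opprD addrACA subrr addr0. Qed.

Section Pull.
Context {R : realType} {M : topologicalType} (S : surface R M).
Local Notation R2 := 'rV[R]_2.
Local Notation R4 := ('rV[R]_2 * 'rV[R]_2)%type.
Variables (F : TM S -> R) (HF : finsler F).
Variables (V : normedModType R) (fV : findim V) (U : set V) (oU : open U) (G : V -> TM S).
Hypotheses (GS : smooth_map U G) (GF : forall x, U x -> F (G x) = 1).

(** A zero vector would satisfy F = 2 F by homogeneity, hence 1 = 2; unit vectors therefore stay in
    the domain where forms are meaningful. *)
Lemma tdom_unit i (P : TM S) : dom i P.1 -> F P = 1 ->
  tdom i (tcoord i P) /\ loc i F (tcoord i P) = 1.
Proof.
move=> iP P1; have lP : loc i F (tcoord i P) = 1 by rewrite /loc tcoordK.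
split=> //; split; first exact: tcoord_img.
apply/eqP => z0.
have := @locF_homog _ _ _ _ HF i (tcoord i P) 2 (tcoord_img iP) (ltr0n _ 2).
have -> : ((tcoord i P).1, 2 *: (tcoord i P).2) = tcoord i P.
  by rewrite z0 scaler0 -z0 -surjective_pairing.
by rewrite lP mulr1 => /eqP; rewrite eq_sym (eqr_nat R 2 1).
Qed.

Definition region (i : idx S) : set V := U `&` [set x | dom i (G x).1].

Lemma open_region i : open (region i).
Proof.
rewrite openE => x [Ux ix].
have N1 : nbhs x U by exact: open_nbhs_nbhs.
have N2 : nbhs x [set x | dom i (G x).1].
  by apply: (GS.1 _ Ux); apply: open_nbhs_nbhs; split=> //; exact: dom_open.
by apply: filterS2 N1 N2 => y Uy iy; split.
Qed.
Arguments open_region : clear implicits.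

Lemma region_smooth i : smooth_on (region i) (fun x => tcoord i (G x)).
Proof. exact: GS.2. Qed.

Lemma region_diff i x : region i x -> differentiable (fun x => tcoord i (G x)) x.
Proof. by move=> ix; apply: (Ck_differentiable (region_smooth i 1) ix). Qed.

Lemma region_tdom i x : region i x -> tdom i (tcoord i (G x)).
Proof. by move=> [Ux ix]; have [] := tdom_unit ix (GF Ux). Qed.

Lemma region_indicatrix i x : region i x -> indicatrix F i (tcoord i (G x)).
Proof. by move=> [Ux ix]; have [] := tdom_unit ix (GF Ux). Qed.

Lemma region_tangent i x v : region i x ->
  indicatrix_tangent F i (tcoord i (G x)) ('D_v (fun x => tcoord i (G x)) x).
Proof.
move=> ix; have Dz := region_tdom ix.
have dF := smooth_diff (@locF_smooth _ _ _ _ HF i) Dz.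
have dc := derive_comp v (region_diff ix) dF.
rewrite /indicatrix_tangent /=; refine (etrans (esym dc) _).
refine (etrans (near_eq_derive _ (near_open (open_region i) ix _)) (derive_cst (1 : R) x v)).
by move=> y [Uy iy]; have [] := tdom_unit iy (GF Uy).
Qed.

(** One definition serves curves, with V = R, and variations, with V = R * R. *)
Definition pull (w : one_form S) (v : V) (x : V) : R :=
  let i := chart_at (G x).1 in w i (tcoord i (G x)) ('D_v (fun x' => tcoord i (G x')) x).

Lemma region_chart_at x : U x -> region (chart_at (G x).1) x.
Proof. by move=> Ux; split=> //; exact: dom_chart_at. Qed.

(** The chart in [pull] jumps with the point. Invariance of [w] and the chain rule for [ttrans]
    allow one fixed chart on a whole neighbourhood, as every differentiation below requires. *)
Lemma pullE w v i x : is_one_form w -> region i x ->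
  pull w v x = w i (tcoord i (G x)) ('D_v (fun x' => tcoord i (G x')) x).
Proof.
move=> [_ _ winv] [Ux ix]; rewrite /pull; set j := chart_at _.
have jx : region j x by exact: region_chart_at.
have ij : dom i (chartV j (tcoord j (G x)).1) by rewrite /= chartK //; exact: jx.2.
have ov : overlap j i (tcoord j (G x)).1 by exact: overlap_chart jx.2 ix.
refine (etrans (winv j i _ _ (region_tdom jx) ij) _).
have E1 : tcoord i (G x) = ttrans j i (tcoord j (G x)) by apply: tcoord_ttrans => //; exact: jx.2.
have E2 : 'D_v (fun x' => tcoord i (G x')) x =
    'D_('D_v (fun x' => tcoord j (G x')) x) (ttrans j i) (tcoord j (G x)).
  refine (etrans _ (derive_comp v (region_diff jx) (ttrans_diff ov))).
  apply: near_eq_derive.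
  apply: near_open (openI (open_region i) (open_region j)) _ _.
    by split=> //; split.
  by move=> y [[_ iy] [_ jy]]; exact: tcoord_ttrans.
by rewrite E1 E2.
Qed.

Lemma form_expand (w : one_form S) i z n (e : 'I_n -> R4) (l : 'I_n -> {linear R4 -> R}) :
  is_one_form w -> tdom i z -> (forall v, v = \sum_a l a v *: e a) ->
  forall v, w i z v = \sum_a l a v * w i z (e a).
Proof.
move=> [wl _ _] Dz lE v.
pose L : {linear R4 -> R} := HB.pack (w i z : R4 -> R) (GRing.isLinear.Build _ _ _ _ _ (wl i z Dz)).
transitivity (L (\sum_a l a v *: e a)); first by rewrite /= -lE.
by rewrite linear_sum; apply: eq_bigr => a _; rewrite linearZ.
Qed.

(** [is_one_form] gives smoothness in z for a fixed vector; linearity reduces the moving vector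
    [Y x] to finitely many fixed ones. *)
Lemma form_Ck (w : one_form S) i k (A : set V) (Z Y : V -> R4) :
  is_one_form w -> open A -> (forall x, A x -> tdom i (Z x)) ->
  Ck k A Z -> Ck k A Y -> Ck k A (fun x => w i (Z x) (Y x)).
Proof.
move=> Hw oA AD Zk Yk; have [n [e [l [lc lE]]]] := @findim4 R.
apply: (Ck_eq oA (fun x Ax => form_expand Hw (AD x Ax) lE (Y x))).
apply: Ck_sum => // a; apply: Ck_mul => //; first exact: Ck_post.
apply: (@Ck_compR _ _ _ _ _ (@tdom R M S i) Z (fun z => w i z (e a))) => //.
  exact: findim4.
by case: Hw => _ ws _; exact: ws.
Qed.

Lemma pull_smooth w v : is_one_form w -> smooth_on U (pull w v).
Proof.
move=> Hw k; apply: Ck_local => x Ux; have ix := region_chart_at Ux.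
set i := chart_at _ in ix.
exists (region i), (fun x => w i (tcoord i (G x)) ('D_v (fun x' => tcoord i (G x')) x)).
split; [exact: open_region|exact: ix| |move=> y iy; exact (pullE v Hw iy)].
apply: form_Ck; [exact: Hw|exact: open_region|by move=> y; exact: region_tdom|exact: region_smooth|].
exact: (Ck_derive v (region_smooth i k.+1)).
Qed.

Lemma smooth_fun_comp (f : TM S -> R) : smooth_fun f -> smooth_on U (fun x => f (G x)).
Proof.
move=> fs k; apply: Ck_local => x Ux; have ix := region_chart_at Ux.
set i := chart_at _ in ix.
exists (region i), (fun x => loc i f (tcoord i (G x))).
split; [exact: open_region|exact: ix| |by move=> y [_ iy]; rewrite /loc tcoordK].
apply: (@Ck_compR _ _ _ _ _ (@tdom R M S i) (fun x => tcoord i (G x)) (loc i f)) => //.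
- exact: findim4.
- exact: open_region.
- by move=> y; exact: region_tdom.
- exact: region_smooth.
- exact: fs.
Qed.

Lemma derive_smooth_fun (f : TM S -> R) i x v : smooth_fun f -> region i x ->
  'D_v (fun x => f (G x)) x = 'D_('D_v (fun x' => tcoord i (G x')) x) (loc i f) (tcoord i (G x)).
Proof.
move=> fs ix.
have df : differentiable (loc i f) (tcoord i (G x)) by exact: smooth_diff (fs i) (region_tdom ix).
refine (etrans _ (derive_comp v (region_diff ix) df)).
apply: near_eq_derive; apply: near_open (open_region i) ix _ => y [_ iy].
by rewrite /= /loc tcoordK.
Qed.

Lemma derive_bigsum (W : normedModType R) n (h : 'I_n -> W -> R) x v :
  (forall a, differentiable (h a) x) ->
  'D_v (fun y => \sum_a h a y) x = \sum_a 'D_v (h a) x.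
Proof.
move=> dh; have -> : (fun y => \sum_a h a y) = \sum_a h a.
  by apply/funext => y; rewrite fct_sumE.
by apply: derive_sum => a; apply: diff_derivable; exact: dh.
Qed.

Lemma schwarz_vec (W X : normedModType R) (A : set W) (f : W -> X) x u v :
  findim X -> open A -> A x -> Ck 2 A f ->
  'D_u (fun y => 'D_v f y) x = 'D_v (fun y => 'D_u f y) x.
Proof.
move=> [n [e [l [lc lE]]]] oA Ax fk.
have E u' v' a : l a ('D_u' (fun y => 'D_v' f y) x) =
    'D_u' (fun y => 'D_v' (fun y => l a (f y)) y) x.
  have /CkS[df /(_ v')/CkS[ddf _]] := fk.
  have [_ E1] := derive_linear_post u' (lc a) (ddf _ Ax).
  refine (etrans (esym E1) _).
  apply: near_eq_derive; apply: near_open oA Ax _ => y Ay.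
  by have [_ E2] := derive_linear_post v' (lc a) (df _ Ay); exact: esym E2.
have sep p q : (forall a, l a p = l a q) -> p = q.
  by move=> pq; rewrite (lE p) (lE q); apply: eq_bigr => a _; rewrite pq.
apply: sep => a.
refine (etrans (E u v a) (etrans _ (esym (E v u a)))).
exact (schwarz u v oA Ax (Ck_post oA (lc a) fk)).
Qed.

Lemma derive_form (w : one_form S) i x (Z Y : V -> R4) v :
  is_one_form w -> (\forall y \near x, tdom i (Z y)) ->
  differentiable Z x -> differentiable Y x ->
  'D_v (fun y => w i (Z y) (Y y)) x =
  'D_('D_v Z x) (fun z => w i z (Y x)) (Z x) + w i (Z x) ('D_v Y x).
Proof.
move=> Hw Dn dZ dY; have [n [e [l [lc lE]]]] := @findim4 R.
have Dx := nbhs_singleton Dn.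
have [_ ws _] := Hw.
have dw a : differentiable (fun z => w i z (e a)) (Z x) by exact: smooth_diff (ws i (e a)) Dx.
have dwZ a : differentiable (fun y => w i (Z y) (e a)) x.
  exact: (differentiable_comp (g := fun z => w i z (e a)) dZ (dw a)).
have dl a := derive_linear_post v (lc a) dY.
have dm a : differentiable (fun y => l a (Y y) * w i (Z y) (e a)) x.
  exact: differentiableM (dl a).1 (dwZ a).
have -> : 'D_v (fun y => w i (Z y) (Y y)) x =
    'D_v (fun y => \sum_a l a (Y y) * w i (Z y) (e a)) x.
  by apply: near_eq_derive; apply: filterS Dn => y Dy; exact: form_expand.
have E1 : 'D_('D_v Z x) (fun z => w i z (Y x)) (Z x) =
    \sum_a l a (Y x) * 'D_('D_v Z x) (fun z => w i z (e a)) (Z x).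
  have -> : 'D_('D_v Z x) (fun z => w i z (Y x)) (Z x) =
      'D_('D_v Z x) (fun z => \sum_a l a (Y x) * w i z (e a)) (Z x).
    apply: near_eq_derive; apply: near_open (@open_tdom R M S i) Dx _ => z Dz.
    exact: form_expand.
  have dc a : differentiable (fun z => l a (Y x) * w i z (e a)) (Z x).
    exact: differentiableZ (dw a).
  refine (etrans (derive_bigsum _ dc) _); apply: eq_bigr => a _.
  exact: deriveZ (diff_derivable (dw a)).
refine (etrans (derive_bigsum _ dm) _).
refine (etrans _ (f_equal2 (fun p q => p + q) (esym E1) (esym (form_expand Hw Dx lE ('D_v Y x))))).
rewrite -big_split; apply: eq_bigr => a _.
refine (etrans (derive_mul v (dl a).1 (dwZ a)) _).
refine (f_equal2 (fun p q => p + q) _ _).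
  exact: (f_equal (fun r => _ * r) (derive_comp v dZ (dw a))).
refine (etrans (f_equal (fun r => _ * r) (dl a).2) _).
exact: mulrC.
Qed.

(** [u] and [v] are constant fields on V, hence commute, so no bracket term appears; the values of
    [w] on the second derivatives of the map cancel by Schwarz's theorem. *)
Lemma cartan_formula (w : one_form S) i x u v : is_one_form w -> region i x ->
  'D_u (pull w v) x - 'D_v (pull w u) x =
  ext_d w i (tcoord i (G x)) ('D_u (fun x' => tcoord i (G x')) x)
    ('D_v (fun x' => tcoord i (G x')) x).
Proof.
move=> Hw ix; set Z := fun x' => tcoord i (G x').
have Zs : smooth_on (region i) Z by exact: region_smooth.
have E p q : 'D_p (pull w q) x =
    'D_('D_p Z x) (fun z => w i z ('D_q Z x)) (Z x) + w i (Z x) ('D_p (fun y => 'D_q Z y) x).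
  have -> : 'D_p (pull w q) x = 'D_p (fun y => w i (Z y) ('D_q Z y)) x.
    by apply: near_eq_derive; apply: near_open (open_region i) ix _ => y iy; exact: pullE.
  apply: derive_form => //.
  - by apply: near_open (open_region i) ix _ => y; exact: region_tdom.
  - exact: region_diff.
  - exact: (Ck_differentiable (Ck_derive q (Zs 2)) ix).
have SW := schwarz_vec u v (@findim4 R) (open_region i) ix (Zs 2).
refine (etrans (f_equal2 (fun p q => p - q) (E u v) (E v u)) _).
exact (sub_sum_cancel _ _ (f_equal (fun r => w i (Z x) r) SW)).
Qed.

End Pull.

(** * Integrals over compact intervals *)

Section Integrals.
Context {R : realType}.
Local Notation mu := (@lebesgue_measure R).
Implicit Types (f g Psi : R -> R) (t : R).

Definition continuous_icc f t0 t1 := forall t, t0 <= t <= t1 -> {for t, continuous f}.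

Lemma within_continuous_icc f t0 t1 :
  continuous_icc f t0 t1 -> {within `[t0, t1], continuous f}.
Proof.
move=> fc; apply: continuous_in_subspaceT => t; rewrite inE /= in_itv /= => tI.
exact: fc.
Qed.

Lemma integrable_icc f t0 t1 : continuous_icc f t0 t1 ->
  mu.-integrable `[t0, t1] (EFin \o f).
Proof.
move=> fc; apply: continuous_compact_integrable; first exact: segment_compact.
exact: within_continuous_icc.
Qed.

Lemma Rintegral_FTC f Psi t0 t1 : t0 < t1 -> continuous_icc f t0 t1 ->
  (forall t, t0 <= t <= t1 -> derivable Psi t 1 /\ 'D_1 Psi t = f t) ->
  \int[mu]_(t in `[t0, t1]) f t = Psi t1 - Psi t0.
Proof.
move=> t01 fc H.
have c t : t0 <= t <= t1 -> {for t, continuous Psi}.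
  by move=> /H[/derivable1_diffP d _]; exact: differentiable_continuous.
rewrite /Rintegral (@continuous_FTC2 _ f Psi) //.
- exact: within_continuous_icc.
- split.
  + by move=> t; rewrite in_itv /= => /andP[a b]; apply: (H t _).1; rewrite !ltW.
  + by apply: cvg_at_right_filter; apply: c; rewrite lexx ltW.
  + by apply: cvg_at_left_filter; apply: c; rewrite lexx ltW.
- move=> t; rewrite in_itv /= => /andP[a b]; rewrite derive1E.
  by apply: (H t _).2; rewrite !ltW.
Qed.

Lemma Rintegral_gt0 f t0 t1 s : continuous_icc f t0 t1 -> t0 < s < t1 ->
  (forall t, t0 <= t <= t1 -> 0 <= f t) -> 0 < f s ->
  0 < \int[mu]_(t in `[t0, t1]) f t.
Proof.
move=> fc /andP[t0s st1] f0 fs.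
have sI : t0 <= s <= t1 by rewrite !ltW.
have N1 := near_gt_continuous (fc s sI) (_ : f s / 2 < f s).
have /N1 {}N1 : f s / 2 < f s by rewrite ltr_pdivrMr // ltr_pMr // ltr1n.
have N2 : \forall t \near s, t0 < t by exact: lt_nbhsr.
have N3 : \forall t \near s, t < t1 by exact: lt_nbhsl.
have N : \forall t \near s, [/\ f s / 2 < f t, t0 < t & t < t1].
  by apply: filterS3 N1 N2 N3.
have /nbhs_ballP[r /= r0 Hr] := N.
(* Half the radius keeps this closed interval in the ball where f > f s / 2. So f dominates the step
   function [g], whose integral is (f s / 2) r. *)
pose P : set R := `[s - r / 2, s + r / 2]%classic.
have Pball t : P t -> ball s r t.
  rewrite /P /= in_itv /= => tI; rewrite -ball_normE /= distrC ltr_norml; lra.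
have PI t : P t -> (`[t0, t1]%classic : set R) t.
  by move=> /Pball/Hr[_ a b]; rewrite /= in_itv /= !ltW.
pose g : R -> R := (cst (f s / 2)) \_ P.
have mP : measurable P by exact: measurable_itv.
have mI : measurable (`[t0, t1]%classic : set R) by exact: measurable_itv.
have IP : `[t0, t1]%classic `&` P = P.
  by apply/seteqP; split=> [t []//|t Pt]; split=> //; exact: PI.
have gE : \int[mu]_(t in `[t0, t1]) g t = f s / 2 * r.
  rewrite /g -Rintegral_mkcondr IP Rintegral_cst // /P.
  have sr : s - r / 2 < s + r / 2 by lra.
  have E := lebesgue_measure_itv `[s - r / 2, s + r / 2].
  rewrite /= lte_fin sr in E.
  rewrite (f_equal fine E) -EFinB /=; congr (_ * _); lra.
have cgi : mu.-integrable P (EFin \o (cst (f s / 2) : R -> R)).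
  apply: integrable_icc => t _; exact: cst_continuous.
have gi : mu.-integrable `[t0, t1] (EFin \o g).
  have -> : EFin \o g = (EFin \o cst (f s / 2)) \_ P.
    by apply/funext => t; rewrite /g /= !patchE; case: ifP.
  apply: (@integrableS _ _ _ mu setT) => //.
  exact (proj1 (integrable_mkcond (mu := mu) _ mP) cgi).
apply: (@lt_le_trans _ _ (\int[mu]_(t in `[t0, t1]) g t)).
  by rewrite gE mulr_gt0 // divr_gt0.
apply: le_Rintegral => //; first exact: integrable_icc.
move=> t tI; rewrite /g patchE; case: ifPn => [|_].
  by rewrite inE => /Pball/Hr[a _ _]; exact: ltW.
by apply: f0; move: tI; rewrite /= in_itv.
Qed.

Lemma is_derive_of_cvg f (a l : R) :
  h^-1 *: (f (h + a) - f a) @[h --> 0^'] --> l -> is_derive a 1 f l.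
Proof.
move=> D.
have D' : h^-1 *: (f (h *: 1 + a) - f a) @[h --> 0^'] --> l.
  by under eq_fun do rewrite /GRing.scale /= mulr1.
apply: DeriveDef; first by apply/cvg_ex; exists l.
exact: (cvg_lim _ D').
Qed.

Lemma is_derive_fst (h : R * R -> R) (u t : R) : differentiable h (u, t) ->
  is_derive u (1 : R) (fun u : R => h (u, t)) ('D_((1, 0) : R * R) h (u, t)).
Proof.
have E s : (0, t) + s *: ((1, 0) : R * R) = (s, t).
  by congr pair; rewrite /= /GRing.scale /= ?mulr1 ?add0r // mulr0 addr0.
have := @is_derive_line R (R * R)%type h (0, t) (1, 0) u; rewrite E => H /H.
by under eq_fun do rewrite E.
Qed.

Lemma is_derive_snd (h : R * R -> R) (u t : R) : differentiable h (u, t) ->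
  is_derive t (1 : R) (fun t : R => h (u, t)) ('D_((0, 1) : R * R) h (u, t)).
Proof.
have E s : (u, 0) + s *: ((0, 1) : R * R) = (u, s).
  by congr pair; rewrite /= /GRing.scale /= ?mulr1 ?add0r // mulr0 addr0.
have := @is_derive_line R (R * R)%type h (u, 0) (0, 1) t; rewrite E => H /H.
by under eq_fun do rewrite E.
Qed.

(** Differentiation under the integral sign. The closed strip |u| <= e makes the parameter rectangle
    compact, and the maximum of the u-derivative over it is the dominating constant. *)
Lemma is_derive_Rintegral (h : R * R -> R) (U : set (R * R)) (e t0 t1 : R) :
  0 < e -> t0 < t1 -> smooth_on U h ->
  (forall u t, `|u| <= e -> t0 <= t <= t1 -> U (u, t)) ->
  is_derive (0 : R) 1 (fun u => \int[mu]_(t in `[t0, t1]) h (u, t))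
    (\int[mu]_(t in `[t0, t1]) 'D_((1, 0) : R * R) h (0, t)).
Proof.
move=> e0 t01 hs HU.
pose A : set (R * R) := `[- e, e]%classic `*` `[t0, t1]%classic.
have AU z : A z -> U z.
  by case: z => u t [] /=; rewrite !in_itv /= => uI tI; apply: HU => //; rewrite ler_norml.
have cA : compact A by apply: compact_setX; exact: segment_compact.
pose Dh z := `|'D_((1, 0) : R * R) h z|.
have cD : {within A, continuous Dh}.
  apply: continuous_in_subspaceT => z; rewrite inE => Az.
  apply: (@continuous_comp _ _ _ (fun z => 'D_((1, 0) : R * R) h z) (fun x : R => `|x|)).
    exact: (Ck_derive _ (hs 1)) (AU _ Az).
  exact: norm_continuous.
have A0 : A !=set0.
  by exists (0, t0); split; rewrite /= in_itv /= ?lexx ?ltW // oppr_lt0.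
have [c _ Hc] := compact_EVT_max A0 cA cD.
have hc u : `|u| <= e -> continuous_icc (fun t => h (u, t)) t0 t1.
  move=> ue t tI; apply: (@continuous_comp _ _ _ (fun t => (u, t) : R * R) h).
    by apply: for_continuous_pair => //; exact: cst_continuous.
  exact: (hs 0) (HU _ _ ue tI).
have mI : measurable (`[t0, t1]%classic : set R) by exact: measurable_itv.
have line (u t : R) : `|u| <= e -> t0 <= t <= t1 ->
    is_derive u (1 : R) (fun u : R => h (u, t)) ('D_((1, 0) : R * R) h (u, t)).
  by move=> ue tI; apply: is_derive_fst; exact: Ck_differentiable (hs 1) (HU _ _ ue tI).
have I0 : (`](- e), e[%classic : set R) 0 by rewrite /= in_itv /= oppr_lt0 e0.
have Ie u : (`](- e), e[%classic : set R) u -> `|u| <= e.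
  by rewrite /= in_itv /= => ue; rewrite ler_norml; lra.
have tI' t : (`[t0, t1]%classic : set R) t -> t0 <= t <= t1 by rewrite /= in_itv.
have bound u t : (`](- e), e[%classic : set R) u -> (`[t0, t1]%classic : set R) t ->
    `|partial1of2 (fun u t => h (u, t)) u t| <= Dh c.
  move=> Iu It; have [_ E] := line u t (Ie _ Iu) (tI' _ It).
  rewrite partial1of2E E; apply: (Hc (u, t)); rewrite inE; split=> //=.
  by have := Ie _ Iu; rewrite in_itv /= ler_norml.
have ci : mu.-integrable `[t0, t1] (EFin \o (fun=> Dh c)).
  by apply: integrable_icc => t _; exact: cst_continuous.
have D := @cvg_differentiation_under_integral R _ _ mu (fun u t => h (u, t)) `[t0, t1]%classic mI
  0 (- e) e I0 (fun u Iu => integrable_icc (hc u (Ie _ Iu)))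
  (fun u t Iu It => @ex_derive _ _ _ _ _ _ _ (line u t (Ie _ Iu) (tI' _ It)))
  (fun=> Dh c) (fun=> normr_ge0 _)
  ci bound.
have E : \int[mu]_(t in `[t0, t1]) partial1of2 (fun u t => h (u, t)) 0 t =
    \int[mu]_(t in `[t0, t1]) 'D_((1, 0) : R * R) h (0, t).
  apply: eq_Rintegral => t; rewrite inE => It; rewrite partial1of2E.
  by have [_ ->] := line 0 t (Ie _ I0) (tI' _ It).
rewrite E in D.
exact: is_derive_of_cvg D.
Qed.

End Integrals.

(** * The first variation *)

Lemma sigma_cancel (R : realType) (k s : R) : s != 0 -> - (k / s ^+ 2) * s = - k / s.
Proof. by move=> s0; field. Qed.

Lemma near_eq_continuous (T T' : topologicalType) (f g : T -> T') (x : T) :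
  (\forall y \near x, f y = g y) -> {for x, continuous f} -> {for x, continuous g}.
Proof.
move=> N fc; rewrite /prop_for /continuous_at -(nbhs_singleton N).
by apply: cvg_trans fc; exact: near_eq_cvg.
Qed.

Section Variation.
Context {R : realType} {M : topologicalType} (S : surface R M).
Local Notation R2 := 'rV[R]_2.
Local Notation R4 := ('rV[R]_2 * 'rV[R]_2)%type.
Local Notation mu := (@lebesgue_measure R).
Variables (F : TM S -> R) (HF : finsler F).
Variables (w3 : one_form S) (I J K : TM S -> R) (HC : finsler_coframe F w3 I J K).

Let w3_form : is_one_form w3. Proof. by case: HC. Qed.
Let I_smooth : smooth_fun I. Proof. by case: HC => _ []. Qed.

Lemma pullback_pull (w : one_form S) (c : R -> TM S) (t : R) :
  pullback w c t = pull c w 1 t.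
Proof. by rewrite /pullback /pull derive1E. Qed.

Lemma pullback_near_eq (w : one_form S) (c c' : R -> TM S) (t : R) :
  (\forall s \near t, c s = c' s) -> pullback w c t = pullback w c' t.
Proof.
move=> N; have E0 := nbhs_singleton N.
have E i : derive1 (fun s => tcoord i (c s)) t = derive1 (fun s => tcoord i (c' s)) t.
  by rewrite !derive1E; apply: near_eq_derive; apply: filterS N => s ->.
by rewrite /pullback E0 E.
Qed.

Lemma open_itvR (a b : R) : open (`]a, b[%classic : set R).
Proof. exact: interval_open. Qed.

Section Curve.
Variables (a b : R) (c : R -> TM S) (Hc : admissible F a b c).

Let cS : smooth_map `]a, b[ c. Proof. by case: Hc. Qed.
Let cF t : `]a, b[%classic t -> F (c t) = 1.
Proof. by rewrite /= in_itv /=; exact: admissible_unit Hc t. Qed.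

Lemma omega3_curve (k : R -> R) t : parallel_curvature F a b c k -> a < t < b ->
  pullback w3 c t = - k t / sigma F c t.
Proof.
move=> Hk tab; have It : (`]a, b[%classic : set R) t by rewrite /= in_itv.
have it := region_chart_at c It.
have sn := admissible_omega1 Hc tab; rewrite -/(sigma F c) in sn.
set i := chart_at _ in it; set Z := fun s => tcoord i (c s).
have dZ : differentiable Z t := region_diff cS it.
have uE : derive1 Z t = 'D_1 Z t by rewrite derive1E.
have z1 : loc i F (Z t) = 1 by have [] := region_indicatrix HF cF it.
have Dz := region_tdom HF cF it.
have u1 : derive1 (fun s => chart i (c s).1) t = (derive1 Z t).1.
  by rewrite uE derive1E (derive_pair _ dZ).
have u2 : derive1 (fun s => (tcoord i ((c s).1, (c s).2)).2) t = (derive1 Z t).2.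
  have -> : (fun s => (tcoord i ((c s).1, (c s).2)).2) = (fun s => (Z s).2).
    by apply/funext => s; rewrite -surjective_pairing.
  by rewrite uE derive1E (derive_pair _ dZ).
(* The definition of [k] in coordinates: the hypothesis of [omega3_point] with lam = - k /
   sigma^2. *)
have Hcov (d : 'I_2) : (derive1 Z t).2 0 d +
    \sum_(j < 2) \sum_(l < 2) (derive1 Z t).1 0 j * (Z t).2 0 l * chern F i d j l (Z t)
    = - (k t / sigma F c t ^+ 2) * (derive1 Z t).1 0 d.
  have := Hk t tab; rewrite /cov_deriv /velocity -/i u1 u2.
  rewrite -surjective_pairing -/(Z t).
  by move=> /matrixP/(_ 0 d); rewrite !mxE.
have tan0 := region_tangent HF (@open_itvR a b) cS cF (1 : R) it.
have tan : 'D_(derive1 Z t) (loc i F) (Z t) = 0.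
  by rewrite uE; exact tan0.
have H := omega3_point HF Dz z1 HC tan (admissible_omega2 Hc tab) sn Hcov.
exact (etrans H (sigma_cancel (k t) sn)).
Qed.

End Curve.

Section FirstVariation.
Variables (a b : R) (c : R -> TM S) (Hc : admissible F a b c).
Variables (e t0 t1 : R) (G : R -> R -> TM S).
Hypotheses (e0 : 0 < e) (at0 : a < t0) (t01 : t0 < t1) (t1b : t1 < b).
Hypothesis HG : smooth_variation F a b c e t0 t1 G.

Definition vdom : set (R * R) := [set ut : R * R | `|ut.1| < e /\ a < ut.2 < b].
Definition vmap (ut : R * R) : TM S := G ut.1 ut.2.

Let GS : smooth_map vdom vmap. Proof. by case: HG. Qed.
Let GF ut : vdom ut -> F (vmap ut) = 1.
Proof.
by move=> [ue tab]; exact: admissible_unit (variation_admissible HG ue) ut.2 tab.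
Qed.

Lemma open_vdom : open vdom.
Proof.
have oA : open [set u : R | `|u| < e].
  have -> : [set u : R | `|u| < e] = `](- e), e[%classic.
    by apply/seteqP; split=> u; rewrite /= in_itv /= ltr_norml.
  exact: open_itvR.
have oB : open [set t : R | a < t < b].
  have -> : [set t : R | a < t < b] = `]a, b[%classic.
    by apply/seteqP; split=> u; rewrite /= in_itv.
  exact: open_itvR.
apply: openI.
  by apply: (open_comp (f := fst)) oA => z _; exact: cvg_fst.
by apply: (open_comp (f := snd)) oB => z _; exact: cvg_snd.
Qed.

(** The field d/dt: parameter pairs are ordered (u, t). Correspondingly [eV] is d/du, whose image is
    the variation field. *)
Definition eT : R * R := (0, 1).
Definition eV : R * R := (1, 0).

Lemma vmap_pullback (w : one_form S) u t : pullback w (G u) t = pull vmap w eT (u, t).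
Proof.
have E i : derive1 (fun s => tcoord i (G u s)) t = 'D_eT (fun x => tcoord i (vmap x)) (u, t).
  rewrite derive1E; apply: derive_same_line => h.
  by rewrite /vmap /eT /= /GRing.scale /= mulr0 add0r.
exact (f_equal (fun v => w (chart_at (G u t).1) (tcoord (chart_at (G u t).1) (G u t)) v) (E _)).
Qed.

(** Since omega2 vanishes on all curves, d omega2 yields (omega2(V))' = v1 s3 - s1 v3. This is the
    factor of I in d omega1, so the I-term is I (omega2(V))', and the product rule moves the
    derivative onto I. *)
Lemma variation_algebra (X1 X2 Y1 Y2 Iz v1 v2 v3 s1 s2 s3 : R) :
  X1 - Y1 = - Iz * (v1 * s3 - s1 * v3) + (v2 * s3 - s2 * v3) ->
  X2 - Y2 = - (v1 * s3 - s1 * v3) -> X2 = 0 -> s2 = 0 ->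
  forall D DI, D = Y1 - (Iz * Y2 + v2 * DI) -> X1 = D + v2 * (DI + s3).
Proof.
move=> H1 H2 X20 s20 D DI ->; rewrite X20 sub0r in H2; have {}H2 := oppr_inj H2.
rewrite -H2 s20 mul0r subr0 in H1.
by rewrite -(subrK Y1 X1) H1; ring.
Qed.

Lemma variation_pointwise x : vdom x ->
  'D_eV (pull vmap (omega1 F) eT) x =
  'D_eT (fun y => pull vmap (omega1 F) eV y - I (vmap y) * pull vmap (omega2 F) eV y) x
  + pull vmap (omega2 F) eV x * ('D_eT (fun y => I (vmap y)) x + pull vmap w3 eT x).
Proof.
move=> Ux; have ix := region_chart_at vmap Ux.
set i := chart_at _ in ix.
have zI := region_indicatrix HF GF ix.
have tV := region_tangent HF open_vdom GS GF eV ix.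
have tT := region_tangent HF open_vdom GS GF eT ix.
have C1 := cartan_formula HF open_vdom GS GF eV eT (omega1_form HF) ix.
have C2 := cartan_formula HF open_vdom GS GF eV eT (omega2_form HF) ix.
have d1 := coframe_d1 HC zI tV tT.
have d2 := coframe_d2 HC zI tV tT.
have s2 y : vdom y -> pull vmap (omega2 F) eT y = 0.
  case: y => u t [/= ue tab]; rewrite -vmap_pullback.
  exact: admissible_omega2 (variation_admissible HG ue) t tab.
have X2 : 'D_eV (pull vmap (omega2 F) eT) x = 0.
  refine (etrans (near_eq_derive _ (near_open open_vdom Ux s2)) _).
  exact: derive_cst.
have dI : differentiable (fun y => I (vmap y)) x.
  exact: Ck_differentiable (smooth_fun_comp HF open_vdom GS GF I_smooth 1) Ux.
have dp w v : is_one_form w -> differentiable (pull vmap w v) x.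
  by move=> Hw; exact: Ck_differentiable (pull_smooth HF open_vdom GS GF v Hw 1) Ux.
have d1V := dp _ eV (omega1_form HF); have d2V := dp _ eV (omega2_form HF).
have E := derive_sub eT d1V (differentiableM dI d2V).
have E' := etrans E (f_equal (fun r => _ - r) (derive_mul eT dI d2V)).
have lI : loc i I (tcoord i (vmap x)) = I (vmap x) by exact (f_equal I (tcoordK (proj2 ix))).
rewrite /wedge_form lI in d1; rewrite /wedge_form in d2.
exact (variation_algebra (etrans C1 d1) (etrans C2 d2) X2 (s2 x Ux) E').
Qed.

Definition variation_omega2 (t : R) : R := pull vmap (omega2 F) eV (0, t).
Definition euler_lagrange (t : R) : R := 'D_1 (fun s => I (c s)) t + pullback w3 c t.

Let vdom0 t : a < t < b -> vdom (0, t). Proof. by move=> tab; split; rewrite /= ?normr0. Qed.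

Lemma pull_outside w t : is_one_form w -> a < t < b -> ~~ (t0 <= t <= t1) ->
  pull vmap w eV (0, t) = 0.
Proof.
move=> Hw tab nt; have ix := region_chart_at vmap (vdom0 tab).
set i := chart_at _ in ix.
refine (etrans (pullE HF open_vdom GS GF eV Hw ix) _).
have -> : 'D_eV (fun x' => tcoord i (vmap x')) (0, t) = 0.
  apply: derive_affine.
  have : \forall h \near (0 : R), `|h| < e.
    have : nbhs (0 : R) (ball 0 e) by exact: nbhsx_ballx.
    by apply: filterS => h; rewrite -ball_normE /= sub0r normrN.
  apply: filterS => h he; rewrite scaler0 addr0 /vmap /eV /=.
  rewrite /GRing.scale /= mulr1 mulr0 addr0 add0r.
  by rewrite !(variation_support HG) // normr0.
have [wl _ _] := Hw.
pose L : {linear R4 -> R} := HB.pack (w i (tcoord i (vmap (0, t))) : R4 -> R)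
  (GRing.isLinear.Build _ _ _ _ _ (wl i _ (region_tdom HF GF ix))).
exact: (linear0 L).
Qed.

Lemma continuous_zero (f : R -> R) (s : R) :
  {for s, continuous f} ->
  (forall d : R, 0 < d -> exists t : R, [/\ `|s - t| < d & f t = 0]) -> f s = 0.
Proof.
move=> fc H; apply/eqP; apply: contraT => fs; have fs' : 0 < `|f s| by rewrite normr_gt0.
have /cvgrPdist_lt/(_ _ fs')/nbhs_ballP[d /= d0 Hd] := fc.
have [t [st ft]] := H d d0.
have := Hd t; rewrite -ball_normE /= ft subr0 => /(_ st).
by rewrite ltxx.
Qed.

(** The support condition says nothing at t0 and t1 themselves; the values there are limits of zeros
    taken from outside [t0, t1], where the variation does not depend on u. *)
Lemma pull_boundary w : is_one_form w ->
  pull vmap w eV (0, t0) = 0 /\ pull vmap w eV (0, t1) = 0.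
Proof.
move=> Hw.
have cont t : a < t < b -> {for t, continuous (fun t => pull vmap w eV (0, t))}.
  move=> tab; apply: (@continuous_comp _ _ _ (fun t => (0, t) : R * R) (pull vmap w eV)).
    by apply: for_continuous_pair => //; exact: cst_continuous.
  exact: (pull_smooth HF open_vdom GS GF eV Hw 0) (vdom0 tab).
split.
  apply: (continuous_zero (f := fun t => pull vmap w eV (0, t))) => //.
    by apply: cont; rewrite at0 (lt_trans t01).
  (* t0 - r lies outside the support, within d of t0, and still to the right of a. *)
  move=> d d0; pose r := Num.min (d / 2) ((t0 - a) / 2).
  have r0 : 0 < r by rewrite lt_min !divr_gt0 // subr_gt0.
  have r1 : r <= d / 2 by rewrite ge_min lexx.
  have r2 : r <= (t0 - a) / 2 by rewrite ge_min lexx orbT.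
  clearbody r; exists (t0 - r); split.
    by rewrite opprB addrC subrK gtr0_norm //; lra.
  apply: pull_outside => //; first by apply/andP; split; move: at0 t01 t1b r0 r1 r2; lra.
  by rewrite negb_and -!ltNge; apply/orP; left; move: at0 t01 t1b r0 r1 r2; lra.
apply: (continuous_zero (f := fun t => pull vmap w eV (0, t))) => //.
  by apply: cont; rewrite t1b (lt_trans at0).
move=> d d0; pose r := Num.min (d / 2) ((b - t1) / 2).
have r0 : 0 < r by rewrite lt_min !divr_gt0 // subr_gt0.
have r1 : r <= d / 2 by rewrite ge_min lexx.
have r2 : r <= (b - t1) / 2 by rewrite ge_min lexx orbT.
clearbody r; exists (t1 + r); split.
  by rewrite opprD addrA subrr add0r normrN gtr0_norm //; lra.
apply: pull_outside => //; first by apply/andP; split; move: at0 t01 t1b r0 r1 r2; lra.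
  by rewrite negb_and -!ltNge; apply/orP; right; move: at0 t01 t1b r0 r1 r2; lra.
Qed.

Lemma first_variation :
  is_derive (0 : R) 1 (fun u => Phi F t0 t1 (G u)) (\int[mu]_(t in `[t0, t1]) (variation_omega2 t * euler_lagrange t)).
Proof.
have tab t : t0 <= t <= t1 -> a < t < b.
  by move=> /andP[h1 h2]; rewrite (lt_le_trans at0) // (le_lt_trans h2).
pose h := pull vmap (omega1 F) eT.
have hs : smooth_on vdom h := pull_smooth HF open_vdom GS GF eT (omega1_form HF).
(* The variation lives on the open strip |u| < e; the closed strip of half width lies inside it. *)
have e20 : 0 < e / 2 by rewrite divr_gt0.
have HU u t : `|u| <= e / 2 -> t0 <= t <= t1 -> vdom (u, t).
  by move=> ue /tab; split=> //=; apply: le_lt_trans ue _; rewrite ltr_pdivrMr // ltr_pMr // ltr1n.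
have D := is_derive_Rintegral e20 t01 hs HU.
have -> : (fun u => Phi F t0 t1 (G u)) = (fun u => \int[mu]_(t in `[t0, t1]) h (u, t)).
  by apply/funext => u; apply: eq_Rintegral => t _; exact: vmap_pullback.
pose psi y := pull vmap (omega1 F) eV y - I (vmap y) * pull vmap (omega2 F) eV y.
have psis : smooth_on vdom psi.
  move=> k; apply: Ck_sub_fun; [exact: open_vdom|exact (pull_smooth HF open_vdom GS GF eV (omega1_form HF) k)|].
  apply: Ck_mul; [exact: open_vdom|exact (smooth_fun_comp HF open_vdom GS GF I_smooth k)|].
  exact (pull_smooth HF open_vdom GS GF eV (omega2_form HF) k).
have pw t : a < t < b -> 'D_eV h (0, t) = 'D_eT psi (0, t) + variation_omega2 t * euler_lagrange t.
  move=> tI; refine (etrans (variation_pointwise (vdom0 tI)) _).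
  refine (f_equal (fun r => 'D_eT psi (0, t) + variation_omega2 t * r) _).
  have N : \forall s \near t, c s = G 0 s.
    apply: near_open (@open_itvR a b) _ _ => [|s]; first by rewrite /= in_itv.
    by rewrite /= in_itv /= => sI; rewrite (variation_init HG).
  refine (f_equal2 (fun p q => p + q) _ _).
    apply: derive_near_line.
    have : \forall h \near (0 : R), c (h *: (1 : R) + t) = G 0 (h *: (1 : R) + t).
      have ca : {for (0 : R), continuous (fun h : R => h *: (1 : R) + t)}.
        by apply: continuousD; [exact: scalel_continuous|exact: cst_continuous].
      by have := ca; rewrite /prop_for /continuous_at scale0r add0r => /(_ _ N).
    apply: filterS => h' E; rewrite E /vmap /eT /= /GRing.scale /=.
    by rewrite mulr0 add0r.
  by rewrite -vmap_pullback; exact (esym (pullback_near_eq w3 N)).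
have cont (g : R * R -> R) : smooth_on vdom g -> continuous_icc (fun t => g (0, t)) t0 t1.
  move=> gs t tI; apply: (@continuous_comp _ _ _ (fun t => (0, t) : R * R) g).
    by apply: for_continuous_pair => //; exact: cst_continuous.
  exact: (gs 0) (vdom0 (tab _ tI)).
have cD (g : R * R -> R) v : smooth_on vdom g -> continuous_icc (fun t => 'D_v g (0, t)) t0 t1.
  by move=> gs; apply: (cont (fun y => 'D_v g y)) => k; exact: (Ck_derive v (gs k.+1)).
have cpsi := cD psi eT psis.
(* Continuity is read off the pointwise identity: the product is a difference of two derivatives
   already known to be continuous. *)
have cq : continuous_icc (fun t => variation_omega2 t * euler_lagrange t) t0 t1.
  move=> t tI.
  have N : \forall s \near t, 'D_eV h (0, s) - 'D_eT psi (0, s) = variation_omega2 s * euler_lagrange s.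
    apply: near_open (@open_itvR a b) _ _ => [|s].
      by rewrite /= in_itv /=; exact: tab.
    by rewrite /= in_itv /= => /pw ->; rewrite addrC addKr.
  have cc : {for t, continuous (fun s => 'D_eV h (0, s) - 'D_eT psi (0, s))}.
    exact: continuousB (cD h eV hs t tI) (cpsi t tI).
  exact (near_eq_continuous N cc).
have E : \int[mu]_(t in `[t0, t1]) 'D_eV h (0, t) = \int[mu]_(t in `[t0, t1]) (variation_omega2 t * euler_lagrange t).
  have -> : \int[mu]_(t in `[t0, t1]) 'D_eV h (0, t) =
      \int[mu]_(t in `[t0, t1]) ('D_eT psi (0, t) + variation_omega2 t * euler_lagrange t).
    by apply: eq_Rintegral => t; rewrite inE /= in_itv /= => /tab; exact: pw.
  rewrite RintegralD //; [|exact: integrable_icc|exact: integrable_icc].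
  have psit t : t0 <= t <= t1 -> is_derive t (1 : R) (fun t => psi (0, t)) ('D_eT psi (0, t)).
    move=> tI.
    exact (is_derive_snd (Ck_differentiable (psis 1) (vdom0 (tab _ tI)))).
  have FT := Rintegral_FTC (Psi := fun t => psi (0, t)) t01 cpsi
    (fun t tI => conj (@ex_derive _ _ _ _ _ _ _ (psit t tI)) (@derive_val _ _ _ _ _ _ _ (psit t tI))).
  have [b10 b11] := pull_boundary (omega1_form HF).
  have [b20 b21] := pull_boundary (omega2_form HF).
  have p0 : psi (0, t0) = 0 by rewrite /psi b10 b20 mulr0 subr0.
  have p1 : psi (0, t1) = 0 by rewrite /psi b11 b21 mulr0 subr0.
  refine (etrans (f_equal (fun r => r + _) FT) _).
  by rewrite p0 p1 subr0 add0r.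
by rewrite E in D.
Qed.

End FirstVariation.
End Variation.

(** * Variations with prescribed normal component *)

Section LegendreInverse.
Context {R : realType} {M : topologicalType} (S : surface R M).
Local Notation R2 := 'rV[R]_2.
Local Notation R4 := ('rV[R]_2 * 'rV[R]_2)%type.
Variables (F : TM S -> R) (HF : finsler F) (i : idx S) (z0 : R4) (T0 : R2).
Local Notation D := (@tdom R M S i).
Local Notation f := (loc i F).
Hypotheses (Dz0 : D z0) (fz0 : f z0 = 1) (T00 : T0 != 0).
Hypothesis omega2_z0 : omega2 F i z0 (T0, 0) = 0.

Let fs : smooth_on D f := @locF_smooth _ _ _ _ HF i.
Arguments fs : clear implicits.

Lemma smooth_loc k (V : normedModType R) (U : set V) (Z : V -> R4) (h : R4 -> R) :
  open U -> (forall x, U x -> D (Z x)) -> smooth_on D h -> Ck k U Z ->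
  Ck k U (fun x => h (Z x)).
Proof. by move=> oU UD hs Zk; exact: (Ck_compR (@findim4 R) oU UD Zk (hs k)). Qed.

Lemma locF_homogeneous : homogeneous i 1 f.
Proof. by move=> w c [iw _] c0; exact: locF_homog. Qed.

Lemma dy_locF_homogeneous a z c : D z -> 0 < c -> dy a f (z.1, c *: z.2) = dy a f z.
Proof.
move=> Dz c0; refine (etrans (homogeneous_dy a fs locF_homogeneous Dz c0) _).
exact: mul1r.
Qed.

Lemma omega2_homogeneous z c v : D z -> 0 < c -> omega2 F i (z.1, c *: z.2) v = omega2 F i z v.
Proof.
move=> Dz c0; apply: eq_bigr => a _.
exact (f_equal (fun r => r * v.1 0 a) (dy_locF_homogeneous a Dz c0)).
Qed.

(** The covector dF/dy takes the value 1 on y by Euler's identity and 0 on v.1, so y and a nonzero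
    v.1 are not parallel. *)
Lemma omega12_free z (v : R4) : D z -> f z = 1 -> omega2 F i z v = 0 -> v.1 != 0 ->
  z.2 0 1 * v.1 0 0 - z.2 0 0 * v.1 0 1 != 0.
Proof.
move=> Dz fz w0; apply: contraNneq => zv.
have E := omega2_spray HF Dz fz.
have {}E : dy 0 f z * z.2 0 0 + dy 1 f z * z.2 0 1 = 1.
  exact: etrans (esym (sum2 (fun a => dy a f z * z.2 0 a))) E.
have {}w0 : dy 0 f z * v.1 0 0 + dy 1 f z * v.1 0 1 = 0.
  exact: etrans (esym (sum2 (fun a => dy a f z * v.1 0 a))) w0.
apply/eqP/rowP => a; rewrite mxE.
move: (dy 0 f z) (dy 1 f z) (z.2 0 0) (z.2 0 1) E w0 zv => p q y0 y1 E w0 zv.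
move: a; apply: forall_ord2.
  have -> : v.1 0 0 = v.1 0 0 * (p * y0 + q * y1) by rewrite E mulr1.
  have -> : v.1 0 0 * (p * y0 + q * y1) = q * (y1 * v.1 0 0 - y0 * v.1 0 1) + y0 * (p * v.1 0 0 + q * v.1 0 1) by ring.
  by rewrite zv w0 !mulr0 addr0.
have -> : v.1 0 1 = v.1 0 1 * (p * y0 + q * y1) by rewrite E mulr1.
have -> : v.1 0 1 * (p * y0 + q * y1) = y1 * (p * v.1 0 0 + q * v.1 0 1) - p * (y1 * v.1 0 0 - y0 * v.1 0 1) by ring.
by rewrite zv w0 !mulr0 subr0.
Qed.

(* The unit vector y over x with omega2_(x, y)(T, 0) = 0 is sought on the line
   z0.2 + s T0 and then normalized, so that only the scalar s is unknown. *)
Definition lray (p : R4 * R) : R4 := (p.1.1, z0.2 + p.2 *: T0).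
Definition lfun (p : R4 * R) : R := omega2 F i (lray p) (p.1.2, 0).
Definition ldom : set (R4 * R) := [set p | D (lray p)].

Lemma lray_Ck k (U : set (R4 * R)) : open U -> Ck k U lray.
Proof.
move=> oU; apply: Ck_pair => //; try exact: findim_rV.
  by apply: Ck_fst => //; apply: Ck_fst => //; exact: Ck_id.
apply: Ck_add => //; first exact: Ck_cst.
by apply: Ck_scale => //; apply: Ck_snd => //; exact: Ck_id.
Qed.

Lemma open_ldom : open ldom.
Proof.
apply: (open_comp (f := lray) (D := D)); last exact: open_tdom.
by move=> p _; exact: (lray_Ck 0 openT).
Qed.

Lemma lfun_smooth : smooth_on ldom lfun.
Proof.
move=> k; have oU := open_ldom.
apply: Ck_sum => // a; apply: Ck_mul => //.
  by apply: smooth_loc => //; [exact: smooth_dy|exact: lray_Ck].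
apply: Ck_coord => //=; apply: Ck_snd => //; apply: Ck_fst => //; exact: Ck_id.
Qed.

Lemma lray0 : lray ((z0.1, T0), 0) = z0.
Proof. by rewrite /lray /= scale0r addr0 -surjective_pairing. Qed.

(** Since (0, T0) is tangent to the indicatrix, this derivative is g(T0, T0) at z0, and strict
    convexity makes it positive. *)
Lemma lfun_derive_gt0 : 0 < 'D_((0, 1) : R4 * R) lfun ((z0.1, T0), 0).
Proof.
have Tf : 'D_((0, T0) : R4) f z0 = 0.
  exact: etrans (esym (omega2E HF (T0, 0) Dz0)) omega2_z0.
have E : 'D_((0, 1) : R4 * R) lfun ((z0.1, T0), 0) =
    'D_((0, T0) : R4) (fun z => omega2 F i z (T0, 0)) z0.
  apply: derive_same_line => r; rewrite /lfun /lray /=.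
  have -> : r *: ((0, T0) : R4) + z0 = (z0.1, z0.2 + r *: T0).
    by congr pair; rewrite /= ?scaler0 ?add0r // addrC.
  have E1 : r%:A = r :> R := mulr1 r.
  by rewrite !scaler0 !add0r addr0 E1.
rewrite E.
have E2 := derive_omega2 HF Dz0 ((0, T0) : R4) ((T0, 0) : R4).
have G a := derive_dy_tangent HF Dz0 fz0 a Tf.
have := finsler_convex HF Dz0 T00; rewrite quad2.
have {}G a : 'D_((0, T0) : R4) (dy a f) z0 = T0 0 0 * gmx F i z0 0 a + T0 0 1 * gmx F i z0 1 a.
  refine (etrans (G a) (etrans (f_equal2 (fun p q => p + q) _ (sum2 _)) (add0r _))).
  by apply: big1 => b _; rewrite mxE mul0r.
have E3 := etrans E2 (f_equal2 (fun p q => T0 0 0 * p + T0 0 1 * q) (G 0) (G 1)).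
rewrite E3; move: (gmx F i z0) => g.
have -> : T0 0 0 * T0 0 0 * g 0 0 + T0 0 0 * T0 0 1 * (g 0 1 + g 1 0) + T0 0 1 * T0 0 1 * g 1 1
  = T0 0 0 * (T0 0 0 * g 0 0 + T0 0 1 * g 1 0) + T0 0 1 * (T0 0 0 * g 0 1 + T0 0 1 * g 1 1) by ring.
by [].
Qed.

Lemma cramer2 (y : R2) (d := z0.2 0 1 * T0 0 0 - z0.2 0 0 * T0 0 1) : d != 0 ->
  y = ((y 0 1 * T0 0 0 - y 0 0 * T0 0 1) / d) *: z0.2 +
      ((z0.2 0 1 * y 0 0 - z0.2 0 0 * y 0 1) / d) *: T0.
Proof.
by move=> d0; apply/rowP; apply: forall_ord2; rewrite !mxE /d; field.
Qed.

(** [Zd] sends a point and a velocity to the unit vector normal to that velocity. The last clause is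
    local uniqueness: it makes the lift of the projection of a given curve equal to the curve
    itself, so that variations start at it. *)
Lemma legendre_inverse : exists (A : set R4) (Zd : R4 -> R4),
  [/\ open A, A (z0.1, T0), smooth_on A Zd,
    forall q, A q -> [/\ (Zd q).1 = q.1, D (Zd q), f (Zd q) = 1,
      omega2 F i (Zd q) (q.2, 0) = 0 & q.2 != 0] &
    \forall z \near z0, f z = 1 -> forall T, A (z.1, T) ->
      omega2 F i z (T, 0) = 0 -> Zd (z.1, T) = z].
Proof.
have D0 : ldom ((z0.1, T0), 0) by rewrite /ldom /= lray0.
have h0 : lfun ((z0.1, T0), 0) = 0 by rewrite /lfun lray0.
have [A [g [e [oA A0 e0 gs gP]]]] :=
  implicit_function (@findim4 R) open_ldom lfun_smooth D0 h0 lfun_derive_gt0.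
pose w (q : R4) : R4 := lray (q, g q).
pose Zd (q : R4) : R4 := (q.1, (f (w q))^-1 *: (w q).2).
(* Nonzero velocities are kept in the domain so that omega1 does not vanish on the lifted curves. *)
pose A' : set R4 := A `&` [set q | q.2 != 0].
have o2 : open [set q : R4 | q.2 != 0].
  have o0 : open [set v : R2 | v != 0].
    rewrite openE => v v0; apply/nbhs_ballP; exists `|v|; first by rewrite /= normr_gt0.
    by move=> u; rewrite -ball_normE /=; apply: contraTneq => ->; rewrite subr0 ltxx.
  by apply: (open_comp (f := snd)) o0 => z _; exact: cvg_snd.
have oA' : open A' by exact: openI.
have wD q : A q -> D (w q) by move=> /gP[].
have wk k : Ck k A' w.
  apply: Ck_pair => //; try exact: findim_rV.
    by apply: Ck_fst => //; exact: Ck_id.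
  apply: Ck_add => //; first exact: Ck_cst.
  by apply: Ck_scale => //; apply: Ck_sub (gs k) => q [].
have fw0 q : A q -> 0 < f (w q) by move=> /wD; exact: locF_gt0.
have ZE q : A q -> Zd q = ((w q).1, (f (w q))^-1 *: (w q).2) by [].
exists A', Zd; split => //.
- move=> k; apply: Ck_pair => //; try exact: findim_rV.
    by apply: Ck_fst => //; exact: Ck_id.
  apply: Ck_rV => // a.
  apply: (Ck_eq oA' (g := fun q => (f (w q))^-1 * (w q).2 0 a)).
    by move=> q _; rewrite mxE.
  apply: Ck_mul => //.
    apply: Ck_inv => //; first by move=> q [Aq _]; rewrite gt_eqF // fw0.
    by apply: smooth_loc => // q [/wD].
  by apply: Ck_coord => //; apply: Ck_snd.
- move=> q [Aq q20]; have Dw := wD _ Aq; have fw := fw0 _ Aq.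
  have fi : 0 < (f (w q))^-1 by rewrite invr_gt0.
  split=> //.
  + exact: tdomZ Dw fi.
  + by rewrite (ZE _ Aq) (locF_homog HF Dw.1 fi) mulVf // gt_eqF.
  + refine (etrans (omega2_homogeneous _ Dw fi) _).
    by have [_ _ H _] := gP _ Aq.
pose d := z0.2 0 1 * T0 0 0 - z0.2 0 0 * T0 0 1.
have d0 : d != 0 := omega12_free Dz0 fz0 omega2_z0 T00.
(* [al] and [be] are the coordinates of z.2 in the basis (z0.2, T0), near 1 and 0 when z is near z0.
   The ray of z.2 then meets the line z0.2 + s T0 at s = be / al, within the range |s| < e where the
   implicit solution is unique. *)
pose al (z : R4) := (z.2 0 1 * T0 0 0 - z.2 0 0 * T0 0 1) / d.
pose be (z : R4) := (z0.2 0 1 * z.2 0 0 - z0.2 0 0 * z.2 0 1) / d.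
have c2 a : Ck 0 setT (fun z : R4 => z.2 0 a).
  by apply: Ck_coord; [exact: openT|apply: Ck_snd; [exact: openT|exact: Ck_id]].
have alc : {for z0, continuous al}.
  have : Ck 0 setT al.
    by do !(first [exact: openT|exact: c2|exact: Ck_cst|apply: Ck_mul|apply: Ck_sub_fun]).
  by apply.
have bec : {for z0, continuous be}.
  have : Ck 0 setT be.
    by do !(first [exact: openT|exact: c2|exact: Ck_cst|apply: Ck_mul|apply: Ck_sub_fun]).
  by apply.
have al0 : al z0 = 1 by rewrite /al divff.
have be0 : be z0 = 0 by rewrite /be (mulrC (z0.2 0 1)) subrr mul0r.
have N1 : \forall z \near z0, 0 < al z by apply: near_gt_continuous => //; rewrite al0.
have N2 : \forall z \near z0, be z - e * al z < 0.
  apply: (near_lt_continuous (f := fun z => be z - e * al z)).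
    by apply: continuousB => //; apply: continuousM => //; exact: cst_continuous.
  by rewrite be0 al0 mulr1 sub0r oppr_lt0.
have N3 : \forall z \near z0, 0 < be z + e * al z.
  apply: (near_gt_continuous (f := fun z => be z + e * al z)).
    by apply: continuousD => //; apply: continuousM => //; exact: cst_continuous.
  by rewrite be0 al0 mulr1 add0r.
have N4 : \forall z \near z0, D z by exact: near_open (@open_tdom R M S i) Dz0 _.
have N : \forall z \near z0, [/\ 0 < al z, be z - e * al z < 0, 0 < be z + e * al z & D z].
  have N12 : \forall z \near z0, 0 < al z /\ be z - e * al z < 0 by apply: filterS2 N1 N2.
  by apply: filterS3 N12 N3 N4 => z [].
apply: filterS N => z [alz b1 b2 Dz] fz T [AT _] w20.
have yE := cramer2 z.2 d0; rewrite -/(al z) -/(be z) in yE.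
have ai : 0 < (al z)^-1 by rewrite invr_gt0.
have yE' : z0.2 + (be z / al z) *: T0 = (al z)^-1 *: z.2.
  by rewrite [in RHS]yE scalerDr !scalerA mulVf ?gt_eqF // scale1r mulrC.
have [_ _ _ uniq] := gP _ AT.
have lE : lray ((z.1, T), be z / al z) = (z.1, (al z)^-1 *: z.2) by rewrite /lray /= yE'.
have gE : be z / al z = g (z.1, T).
  apply: uniq.
    rewrite subr0 ltr_norml ltr_pdivlMr // ltr_pdivrMr //.
    by apply/andP; split; [rewrite mulNr -subr_gt0 opprK|rewrite -subr_lt0].
  have H := omega2_homogeneous (T, 0) Dz ai.
  rewrite /lfun lE /=; exact (etrans H w20).
have wE : w (z.1, T) = (z.1, (al z)^-1 *: z.2) by rewrite /w -gE.
rewrite /Zd wE (locF_homog HF Dz.1 ai) fz mulr1 invrK /= scalerA divff ?gt_eqF //.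
by rewrite scale1r -surjective_pairing.
Qed.

End LegendreInverse.

(** * Gluing and composing smooth maps into the tangent bundle *)

Section SmoothMaps.
Context {R : realType} {M : topologicalType} (S : surface R M).
Local Notation R2 := 'rV[R]_2.
Local Notation R4 := ('rV[R]_2 * 'rV[R]_2)%type.
Implicit Types V W : normedModType R.

Lemma smooth_map_local V (U : set V) (G : V -> TM S) :
  (forall x, U x -> exists A (H : V -> TM S),
    [/\ open A, A x, smooth_map A H & forall y, A y -> G y = H y]) ->
  smooth_map U G.
Proof.
move=> HU; split.
  move=> x /HU[A [H [oA Ax Hs GH]]].
  apply: (near_eq_continuous (f := fun y => (H y).1)).
    by apply: near_open oA Ax _ => y Ay; rewrite GH.
  by case: Hs => c _; exact: c.
move=> i k; apply: Ck_local => x [/HU[A [H [oA Ax Hs GH]]] ix].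
have ixH : region A H i x by split=> //; rewrite /= -GH.
exists (region A H i), (fun y => tcoord i (H y)); split.
- exact: (open_region oA Hs).
- exact: ixH.
- by case: Hs => _; apply.
- by move=> y [Ay _]; rewrite /= GH.
Qed.

Lemma smooth_map_tpoint V i (U : set V) (Z : V -> R4) : open U ->
  smooth_on U Z -> (forall x, U x -> (chart i @` dom i) (Z x).1) ->
  smooth_map U (fun x => tpoint i (Z x) : TM S).
Proof.
move=> oU Zs Zi.
have Z1c x : U x -> {for x, continuous (fun y => (Z y).1)}.
  by move=> Ux; exact: (Ck_fst oU (Zs 0)) Ux.
split.
  move=> x Ux; apply: (@continuous_comp _ _ _ (fun y => (Z y).1) (chartV i)); first exact: Z1c.
  by apply: chartV_continuous; exact: Zi.
move=> j k; set B := U `&` _.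
have BE x : B x <-> U x /\ overlap i j (Z x).1.
  split=> [[Ux jx]|[Ux /overlapP[_ jx]]]; split=> //.
  by apply/overlapP; split=> //; exact: Zi.
have oB : open B.
  rewrite openE => x /BE[Ux ox].
  have N1 : nbhs x U by exact: open_nbhs_nbhs.
  have N2 : nbhs x [set y | overlap i j (Z y).1].
    by apply: (Z1c _ Ux); apply: open_nbhs_nbhs; split=> //; exact: open_overlap.
  by apply: filterS2 N1 N2 => y Uy oy; apply/BE.
apply: (Ck_eq oB (g := fun x => ttrans i j (Z x))).
  move=> x [Ux jx]; rewrite /= (@tcoord_ttrans _ _ _ i j) //; last exact: tpoint_dom (Zi _ Ux).
  by rewrite tpointK //; exact: Zi.
apply: (Ck_comp (A := [set z : R4 | overlap i j z.1])) (ttrans_smooth i j k) => //.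
- exact: findim4.
- exact: findim4.
- by apply: open_fst_preimage; exact: open_overlap.
- by move=> x /BE[].
- by apply: Ck_sub (Zs k) => x [].
Qed.

Lemma smooth_map_comp V W (U : set V) (A : set W) (G : V -> TM S) (f : W -> V) :
  findim V -> open U -> open A -> smooth_map U G -> smooth_on A f ->
  (forall y, A y -> U (f y)) -> smooth_map A (fun y => G (f y)).
Proof.
move=> fV oU oA Gs fs AU; split.
  move=> y Ay; apply: (@continuous_comp _ _ _ f (fun x => (G x).1)).
    exact: (fs 0).
  by case: Gs => c _; apply: c; exact: AU.
move=> i k; set B := A `&` _.
have oB : open B.
  rewrite openE => y [Ay iy].
  have N1 : nbhs y A by exact: open_nbhs_nbhs.
  have N2 : nbhs y [set y | region U G i (f y)].
    apply: (fs 0 y Ay); apply: open_nbhs_nbhs; split; first exact: (open_region oU Gs).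
    by split=> //; exact: AU.
  by apply: filterS2 N1 N2 => y' Ay' [_ iy']; split.
apply: (Ck_comp (A := region U G i) (f := f) (g := fun x => tcoord i (G x))) => //.
- exact: findim4.
- exact: (open_region oU Gs).
- by move=> y [Ay iy]; split=> //; exact: AU.
- by apply: Ck_sub (fs k) => y [].
- by case: Gs => _; apply.
Qed.

End SmoothMaps.

Section VariationTools.
Context {R : realType}.
Implicit Types V W : normedModType R.

Lemma Ck_scale_fun V W k (U : set V) (f : V -> R) (g : V -> W) :
  findim W -> open U -> Ck k U f -> Ck k U g -> Ck k U (fun x => f x *: g x).
Proof.
move=> fW oU fk gk; apply: Ck_coords => // L Lc.
apply: (Ck_eq oU (g := fun x => f x * L (g x))); first by move=> x _; rewrite linearZ.
by apply: Ck_mul => //; exact: Ck_post.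
Qed.

Lemma open_rect (A B : set R) : open A -> open B ->
  open [set ut : R * R | A ut.1 /\ B ut.2].
Proof.
move=> oA oB; apply: openI.
  by apply: (open_comp (f := fst)) oA => z _; exact: cvg_fst.
by apply: (open_comp (f := snd)) oB => z _; exact: cvg_snd.
Qed.

Lemma open_dist (c r : R) : open [set t : R | `|t - c| < r].
Proof.
have -> : [set t : R | `|t - c| < r] = `](c - r), (c + r)[%classic.
  by apply/seteqP; split=> u; rewrite /= in_itv /= ltr_distl.
exact: (@open_itvR R).
Qed.

Lemma open_notin_icc (r s : R) : open [set t : R | ~~ (r <= t <= s)].
Proof.
have -> : [set t : R | ~~ (r <= t <= s)] = ~` `[r, s]%classic.
  by apply/seteqP; split=> u /=; rewrite in_itv /= => /negP.
by apply: closed_openC; exact: interval_closed.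
Qed.

End VariationTools.

(** * The Euler-Lagrange expression along a curve *)

Section EulerLagrange.
Context {R : realType} {M : topologicalType} (S : surface R M).
Variables (F : TM S -> R) (HF : finsler F).
Variables (w3 : one_form S) (I J K : TM S -> R) (HC : finsler_coframe F w3 I J K).
Variables (a b : R) (c : R -> TM S) (Hc : admissible F a b c).

Let w3_form : is_one_form w3. Proof. by case: HC. Qed.
Let I_smooth : smooth_fun I. Proof. by case: HC => _ []. Qed.
Let cS : smooth_map `]a, b[ c. Proof. by case: Hc. Qed.
Let cF t : `]a, b[%classic t -> F (c t) = 1.
Proof. by rewrite /= in_itv /=; exact: admissible_unit Hc t. Qed.

Lemma euler_lagrange_coframe (I1 I2 I3 : TM S -> R) t : coframe_derivatives F w3 I I1 I2 I3 ->
  a < t < b ->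
  euler_lagrange w3 I c t = I1 (c t) * sigma F c t + (I3 (c t) + 1) * pullback w3 c t.
Proof.
move=> HI tab; have It : (`]a, b[%classic : set R) t by rewrite /= in_itv.
have it := region_chart_at c It.
set i := chart_at _ in it.
have E := derive_smooth_fun HF (@open_itvR _ a b) cS cF (1 : R) I_smooth it.
have tan := region_tangent HF (@open_itvR _ a b) cS cF (1 : R) it.
have H := etrans E (HI i _ _ (region_indicatrix HF cF it) tan).
have w2 := admissible_omega2 Hc tab.
have P w : pullback w c t = w i (tcoord i (c t)) ('D_1 (fun s => tcoord i (c s)) t).
  exact (pullback_pull w c t).
have L f : loc i f (tcoord i (c t)) = f (c t) by rewrite /loc (tcoordK (proj2 it)).
rewrite -!P w2 !L in H.
refine (etrans (f_equal (fun r => r + _) H) _).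
by rewrite /sigma mulr0 addr0 mulrDl mul1r addrA.
Qed.

Lemma euler_lagrange_continuous t : a < t < b -> {for t, continuous (euler_lagrange w3 I c)}.
Proof.
move=> tab; have It : (`]a, b[%classic : set R) t by rewrite /= in_itv.
have oI := @open_itvR _ a b.
have Is := smooth_fun_comp HF oI cS cF I_smooth.
have ws := pull_smooth HF oI cS cF (1 : R) w3_form.
have E : euler_lagrange w3 I c = (fun s => 'D_1 (fun r => I (c r)) s + pull c w3 1 s).
  by apply/funext => s; rewrite /euler_lagrange pullback_pull.
rewrite E; apply: continuousD; first exact: (Ck_derive (1 : R) (Is 1)) It.
exact: (ws 0) It.
Qed.

End EulerLagrange.

(** * The lifted variation inside one chart *)

Section LocalVariation.
Context {R : realType} {M : topologicalType} (S : surface R M).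
Local Notation R2 := 'rV[R]_2.
Local Notation R4 := ('rV[R]_2 * 'rV[R]_2)%type.
Variables (F : TM S -> R) (HF : finsler F).
Variables (a b : R) (c : R -> TM S) (Hc : admissible F a b c).
Variables (i : idx S) (ts r : R).
Local Notation J := [set t : R | `|t - ts| < r].
Hypothesis HJ : forall t, J t -> a < t < b /\ dom i (c t).1.

Definition cvec (t : R) : R4 :=
  ((tcoord i (c t)).1, 'D_1 (fun s => (tcoord i (c s)).1) t).

Let cS : smooth_map `]a, b[ c. Proof. by case: Hc. Qed.
Let cF t : `]a, b[%classic t -> F (c t) = 1.
Proof. by rewrite /= in_itv /=; exact: admissible_unit Hc t. Qed.
Let oJ : open J := @open_dist R ts r.

Let JI t : J t -> region `]a, b[ c i t.
Proof. by move=> /HJ[tab it]; split=> //; rewrite /= in_itv. Qed.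

Lemma coord_smooth : smooth_on J (fun t => tcoord i (c t)).
Proof. by move=> k; exact (Ck_sub JI (region_smooth cS i k)). Qed.

Lemma cvec_smooth : smooth_on J cvec.
Proof.
move=> k; have x1 := Ck_fst oJ (coord_smooth k.+1).
apply: Ck_pair => //; try exact: findim_rV; first exact: CkW x1.
exact (Ck_derive (1 : R) x1).
Qed.

Variable phi : R -> R.
Hypothesis phis : smooth_on setT phi.
Variables (t0 t1 : R).
Hypothesis (HJ01 : forall t, t0 <= t <= t1 -> J t).
Hypothesis phi0 : forall t, ~~ (t0 <= t <= t1) -> phi t = 0.

(** phi N and its t-derivative. Point and velocity are affine in the displacement, so [cvec] + u
    [pvec] is exactly the point and velocity of the displaced curve, with no linearization. *)
Definition pvec (t : R) : R4 :=
  let py := fun s => phi s *: (tcoord i (c s)).2 in (py t, 'D_1 py t).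

Let py_smooth : smooth_on J (fun s => phi s *: (tcoord i (c s)).2).
Proof.
move=> k; apply: Ck_scale_fun => //; first exact: findim_rV.
  by apply: Ck_sub (phis k).
exact (Ck_snd oJ (coord_smooth k)).
Qed.

Lemma pvec_smooth : smooth_on J pvec.
Proof.
move=> k; apply: Ck_pair => //; try exact: findim_rV.
exact (Ck_derive (1 : R) (py_smooth k.+1)).
Qed.

Lemma pvec0 t : ~~ (t0 <= t <= t1) -> pvec t = 0.
Proof.
move=> nt; rewrite /pvec phi0 // scale0r; congr pair.
refine (etrans (near_eq_derive _ _) (derive_cst (0 : R2) t (1 : R))).
by apply: near_open (@open_notin_icc R t0 t1) nt _ => s ns; rewrite phi0 // scale0r.
Qed.

Definition qvec (ut : R * R) : R4 := cvec ut.2 + ut.1 *: pvec ut.2.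

Variables (A : set R4) (Zd : R4 -> R4) (e : R).
Hypotheses (oA : open A) (Zs : smooth_on A Zd).
Hypothesis ZA : forall q, A q -> [/\ (Zd q).1 = q.1, tdom i (Zd q), loc i F (Zd q) = 1,
      omega2 F i (Zd q) (q.2, 0) = 0 & q.2 != 0].
Hypothesis e0 : 0 < e.
Local Notation B := [set ut : R * R | `|ut.1| < e /\ J ut.2].
Hypothesis HqA : forall ut, B ut -> A (qvec ut).
Hypothesis Zc : forall t, J t -> Zd (cvec t) = tcoord i (c t).

(* The lift of the curve gamma + u phi N of the chart i; [qvec (u, t)] collects its
   point and velocity. *)
Definition bent (u t : R) : TM S :=
  if `|t - ts| < r then tpoint i (Zd (qvec (u, t))) else c t.

Let oB : open B.
Proof.
have oe : open [set u : R | `|u| < e].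
  have -> : [set u : R | `|u| < e] = [set u : R | `|u - 0| < e].
    by apply/seteqP; split=> u /=; rewrite subr0.
  exact: (@open_dist R).
exact (open_rect oe oJ).
Qed.

Lemma qvec_smooth : smooth_on B qvec.
Proof.
have s1 k : Ck k B (fun ut : R * R => ut.2) := Ck_snd oB (Ck_id k B).
have f4 := @findim4 R.
have fR := @findimR R.
have BJ (ut : R * R) : B ut -> J ut.2 by case.
move=> k; apply: Ck_add => //.
  exact (Ck_comp fR f4 oB oJ BJ (s1 k) (cvec_smooth k)).
apply: Ck_scale_fun => //; first exact (Ck_fst oB (Ck_id k B)).
exact (Ck_comp fR f4 oB oJ BJ (s1 k) (pvec_smooth k)).
Qed.

Lemma Zq_smooth : smooth_on B (fun ut => Zd (qvec ut)).
Proof.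
move=> k; exact (Ck_comp (@findim4 R) (@findim4 R) oB oA HqA (qvec_smooth k) (Zs k)).
Qed.

Lemma bent_in u t : J t -> bent u t = tpoint i (Zd (qvec (u, t))).
Proof. by rewrite /= /bent => ->. Qed.

(** The bump and its derivative vanish off [t0, t1], so there the lift is that of gamma itself,
    which [Zc] identifies with [c]. The two branches of [bent] thus agree on an open overlap, which
    makes the gluing smooth. *)
Lemma bent_out u t : a < t < b -> ~~ (t0 <= t <= t1) -> bent u t = c t.
Proof.
move=> tab nt; rewrite /bent; case: ifP => // Jt.
by rewrite /qvec /= pvec0 // scaler0 addr0 Zc // tcoordK //; case: (HJ Jt).
Qed.

Lemma bent0 t : bent 0 t = c t.
Proof.
rewrite /bent; case: ifP => // Jt.
by rewrite /qvec /= scale0r addr0 Zc // tcoordK //; case: (HJ Jt).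
Qed.

Lemma bent_tcoord ut : B ut -> tcoord i (bent ut.1 ut.2) = Zd (qvec ut).
Proof.
move=> But; rewrite bent_in ?tpointK -?surjective_pairing //; last by case: But.
by have [_ []] := ZA (HqA But).
Qed.

Let D := @vdom R a b e.

Let outE u t : D (u, t) -> ~ J t -> ~~ (t0 <= t <= t1).
Proof. by move=> _ nJ; apply/negP => /HJ01. Qed.

Lemma bent_smooth : smooth_map D (vmap bent).
Proof.
apply: smooth_map_local => -[u t] Dut.
have [Jt|nJ] := pselect (J t).
  exists B, (fun ut => tpoint i (Zd (qvec ut))); split.
  - exact: oB.
  - by split=> //; case: Dut.
  - apply: smooth_map_tpoint; [exact: oB|exact: Zq_smooth|].
    by move=> x Bx; have [_ []] := ZA (HqA Bx).
  - by move=> [u' t'] [_ Jt']; exact: bent_in.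
have oX : open (D `&` [set ut | ~~ (t0 <= ut.2 <= t1)]).
  apply: openI; first exact: open_vdom.
   apply: (open_comp (f := snd) (D := [set t : R | ~~ (t0 <= t <= t1)])).
     by move=> z _; exact: cvg_snd.
   exact: (@open_notin_icc R).
exists (D `&` [set ut | ~~ (t0 <= ut.2 <= t1)]), (fun ut => c ut.2); split.
- exact: oX.
- by split=> //; exact: outE Dut nJ.
- apply: (smooth_map_comp (U := `]a, b[%classic) (f := snd)) => //.
  + exact: findimR.
  + move=> k; apply: Ck_linear => z; exact: cvg_snd.
  + by move=> [u' t'] [[_ tab] _]; rewrite /= in_itv.
- by move=> [u' t'] [[_ tab] nt]; exact: bent_out.
Qed.

Lemma bent_unit ut : D ut -> F (vmap bent ut) = 1.
Proof.
case: ut => u t [/= ue tab].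
have [Jt|nJ] := pselect (J t).
  by rewrite /vmap /= bent_in //; have [_ _] := ZA (HqA (conj ue Jt : B (u, t))).
rewrite /vmap /= bent_out ?(admissible_unit Hc) //.
by apply: (@outE u) => //; split.
Qed.

Let BD ut : B ut -> region D (vmap bent) i ut.
Proof.
move=> But; case: (But) => ue Jt; split; first by split=> //; case: (HJ Jt).
rewrite /vmap /= bent_in // -surjective_pairing; apply: tpoint_dom.
by have [_ []] := ZA (HqA But).
Qed.

Lemma bent_pull w v ut : is_one_form w -> B ut ->
  pull (vmap bent) w v ut = w i (Zd (qvec ut)) ('D_v (fun ut => Zd (qvec ut)) ut).
Proof.
move=> Hw But.
refine (etrans (pullE HF (open_vdom (a := a) (b := b) (e := e)) bent_smooth bent_unit v Hw (BD But)) _).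
refine (f_equal2 (fun p q => w i p q) (bent_tcoord But) _).
by apply: near_eq_derive; apply: near_open oB But _ => y By; exact: bent_tcoord.
Qed.

Lemma derive_Zq1 v ut : B ut ->
  ('D_v (fun ut => Zd (qvec ut)) ut).1 = 'D_v (fun ut => (qvec ut).1) ut.
Proof.
move=> But.
have dZ : differentiable (fun ut => Zd (qvec ut)) ut := Ck_differentiable (Zq_smooth 1) But.
refine (etrans (f_equal fst (derive_pair v dZ)) _).
apply: near_eq_derive; apply: near_open oB But _ => y By.
by have [] := ZA (HqA By).
Qed.

(** The velocity fed to [Zd] is the true velocity of the projected curve; hence the condition built
    into [Zd] says that omega2 vanishes on the lift. *)
Lemma derive_Zq_eT ut : B ut ->
  ('D_(@eT R) (fun ut => Zd (qvec ut)) ut).1 = (qvec ut).2.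
Proof.
case: ut => u t But; have Jt := But.2; refine (etrans (derive_Zq1 _ But) _).
have dx : differentiable (fun s => (tcoord i (c s)).1) t.
  exact: Ck_differentiable (Ck_fst oJ (coord_smooth 1)) Jt.
have dp : differentiable (fun s => phi s *: (tcoord i (c s)).2) t.
  exact: Ck_differentiable (py_smooth 1) Jt.
have E : 'D_(@eT R) (fun ut => (qvec ut).1) (u, t) =
    'D_1 (fun s => (tcoord i (c s)).1 + u *: (phi s *: (tcoord i (c s)).2)) t.
  apply: derive_same_line => h; rewrite /qvec /eT /= /GRing.scale /=.
  by rewrite !mulr0 !add0r.
refine (etrans E _).
have du : differentiable (fun s => u *: (phi s *: (tcoord i (c s)).2)) t.
  exact: differentiableZ dp.
refine (etrans (deriveD (diff_derivable dx) (diff_derivable du)) _).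
have Z := deriveZ u (diff_derivable (v := (1 : R)) dp).
exact (f_equal (fun q => 'D_1 (fun s => (tcoord i (c s)).1) t + q) Z).
Qed.

Lemma derive_Zq_eV t : J t ->
  ('D_(@eV R) (fun ut => Zd (qvec ut)) (0, t)).1 = phi t *: (Zd (qvec (0, t))).2.
Proof.
move=> Jt; have B0 : B (0, t) by split; rewrite /= ?normr0.
refine (etrans (derive_Zq1 _ B0) _).
have -> : Zd (qvec (0, t)) = tcoord i (c t) by rewrite /qvec /= scale0r addr0; exact: Zc.
apply: derive_affine; near=> h.
have E1 : h%:A = h :> R := mulr1 h.
rewrite /qvec /eV /= E1 !addr0 scale0r addr0.
by rewrite /GRing.scale /= !mulr0 !add0r.
Unshelve. all: by end_near. Qed.

Lemma bent_admissible u : `|u| < e -> admissible F a b (bent u).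
Proof.
move=> ue; have Dt t : a < t < b -> D (u, t) by move=> tab; split.
have near_out t : a < t < b -> ~ J t -> \forall s \near t, bent u s = c s.
  move=> tab nJ; have nt := outE (Dt t tab) nJ.
  have It : (`]a, b[%classic : set R) t by rewrite /= in_itv.
  apply: near_open (openI (@open_itvR R a b) (@open_notin_icc R t0 t1)) _ _; first by split.
  by move=> s [/=]; rewrite in_itv /= => sab ns; exact: bent_out.
split.
- apply: (smooth_map_comp (U := D) (G := vmap bent) (f := fun t => (u, t))) => //.
  + exact: findim_prod (@findimR R) (@findimR R).
  + exact: open_vdom.
  + exact: bent_smooth.
  + move=> k; have oI := @open_itvR R a b.
    apply: Ck_pair => //; [exact: findimR|exact: findimR|exact: Ck_cst|exact: Ck_id].
- by move=> t tab; exact: (bent_unit (Dt t tab)).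
- move=> t tab; have [Jt|nJ] := pselect (J t); last first.
    exact: etrans (pullback_near_eq _ (near_out t tab nJ)) (admissible_omega2 Hc tab).
  have But : B (u, t) by split.
  rewrite vmap_pullback; refine (etrans (bent_pull _ (omega2_form HF) But) _).
  have [_ _ _ H _] := ZA (HqA But).
  refine (etrans _ H).
  exact (f_equal (fun v => omega2 F i (Zd (qvec (u, t))) (v, 0)) (derive_Zq_eT But)).
- move=> t tab; have [Jt|nJ] := pselect (J t); last first.
    by rewrite (pullback_near_eq _ (near_out t tab nJ)); exact: (admissible_omega1 Hc tab).
  have But : B (u, t) by split.
  have [_ Dz fz w2 q0] := ZA (HqA But).
  have E : pullback (omega1 F) (bent u) t = omega1 F i (Zd (qvec (u, t))) ((qvec (u, t)).2, 0).
    rewrite vmap_pullback; refine (etrans (bent_pull _ (omega1_form HF) But) _).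
    exact (f_equal (fun v => omega1 F i (Zd (qvec (u, t))) (v, 0)) (derive_Zq_eT But)).
  rewrite E omega1E; apply: mulf_neq0; first by rewrite gt_eqF // area_gt0.
  exact (omega12_free HF Dz fz w2 q0).
Qed.

Lemma bent_variation : smooth_variation F a b c e t0 t1 bent.
Proof.
split.
- exact: bent_smooth.
- exact: bent_admissible.
- by move=> t _; exact: bent0.
- by move=> u t _; exact: bent_out.
Qed.

(** The variation field projects to phi N, and dF/dy applied to N is F(N) = 1 by Euler's
    identity. *)
Lemma bent_omega2 t : J t -> variation_omega2 F bent t = phi t.
Proof.
move=> Jt; have B0 : B (0, t) by split; rewrite /= ?normr0.
have [_ Dz fz _ _] := ZA (HqA B0).
refine (etrans (bent_pull _ (omega2_form HF) B0) _).
have E : omega2 F i (Zd (qvec (0, t))) ('D_(@eV R) (fun ut => Zd (qvec ut)) (0, t)) =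
   omega2 F i (Zd (qvec (0, t))) (phi t *: (Zd (qvec (0, t))).2, 0).
  exact (f_equal (fun v => omega2 F i (Zd (qvec (0, t))) (v, 0)) (derive_Zq_eV Jt)).
refine (etrans E _).
have H := omega2_spray HF Dz fz.
rewrite -[RHS]mulr1 -[in RHS]H /omega2 !sum2 /= !mxE.
by move: (dy 0 _ _) (dy 1 _ _) => p q; ring.
Qed.

End LocalVariation.

(** * Existence of variations and the characterization of extremals *)

Section Extremals.
Context {R : realType} {M : topologicalType} (S : surface R M).
Local Notation R2 := 'rV[R]_2.
Local Notation R4 := ('rV[R]_2 * 'rV[R]_2)%type.
Variables (F : TM S -> R) (HF : finsler F).
Variables (a b : R) (c : R -> TM S) (Hc : admissible F a b c).

Let cS : smooth_map `]a, b[ c. Proof. by case: Hc. Qed.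
Let cF t : `]a, b[%classic t -> F (c t) = 1.
Proof. by rewrite /= in_itv /=; exact: admissible_unit Hc t. Qed.

Lemma region_cvec i t : region `]a, b[ c i t ->
  omega2 F i (tcoord i (c t)) ((cvec c i t).2, 0) = 0 /\ (cvec c i t).2 != 0.
Proof.
move=> it; have tab : a < t < b by move: it.1; rewrite /= in_itv.
have oI := @open_itvR R a b.
have dZ : differentiable (fun s => tcoord i (c s)) t := region_diff cS it.
have E1 : ('D_1 (fun s => tcoord i (c s)) t).1 = (cvec c i t).2.
  exact (f_equal fst (derive_pair (1 : R) dZ)).
have P w : is_one_form w ->
    pullback w c t = w i (tcoord i (c t)) ('D_1 (fun s => tcoord i (c s)) t).
  move=> Hw; rewrite pullback_pull; exact (pullE HF oI cS cF (1 : R) Hw it).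
have w2 := etrans (esym (P _ (omega2_form HF))) (admissible_omega2 Hc tab).
have w1 : omega1 F i (tcoord i (c t)) ('D_1 (fun s => tcoord i (c s)) t) != 0.
  by have := admissible_omega1 Hc tab; rewrite (P _ (omega1_form HF)).
split.
  refine (etrans _ w2).
  exact (f_equal (fun v => omega2 F i (tcoord i (c t)) (v, 0)) (esym E1)).
apply: contraNneq w1 => T0.
have -> : omega1 F i (tcoord i (c t)) ('D_1 (fun s => tcoord i (c s)) t) =
    omega1 F i (tcoord i (c t)) (0, 0).
  exact (f_equal (fun v => omega1 F i (tcoord i (c t)) (v, 0)) (etrans E1 T0)).
by rewrite omega1E /= !mxE !mulr0 subr0 mulr0.
Qed.

(** [d] confines the support to where the Euler-Lagrange expression keeps its sign. *)
Lemma variation_exists (ts d : R) : a < ts < b -> 0 < d ->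
  exists (t0 t1 e : R) (G : R -> R -> TM S),
  [/\ [/\ a < t0, t0 < ts, ts < t1 & t1 < b],
      forall t, t0 <= t <= t1 -> `|t - ts| < d,
      0 < e, smooth_variation F a b c e t0 t1 G
    & forall t, t0 <= t <= t1 -> variation_omega2 F G t = smooth_bump t0 t1 t].
Proof.
move=> tsab d0; have Its : (`]a, b[%classic : set R) ts by rewrite /= in_itv.
have its := region_chart_at c Its.
set i := chart_at _ in its.
have [w20 T00] := region_cvec its.
have [Dz0 fz0] := region_indicatrix HF cF its.
have [A [Zd [oA Aq0 Zs ZA Znear]]] := legendre_inverse HF Dz0 fz0 T00 w20.
have oreg := open_region (@open_itvR R a b) cS i.
have near_dist (P : R -> Prop) : (\forall t \near ts, P t) ->
    exists2 r : R, 0 < r & forall t, `|t - ts| < r -> P t.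
  move=> /nbhs_ballP[r r0 Hr]; exists r => // t tr; apply: Hr.
  by rewrite -ball_normE /= distrC.
have [r1 r10 Hr1] := near_dist _ (near_open oreg its (fun t it => it)).
have HJ1 t : `|t - ts| < r1 -> a < t < b /\ dom i (c t).1.
  by move=> /Hr1[tI it]; split=> //; move: tI; rewrite /= in_itv.
have J1ts : `|ts - ts| < r1 by rewrite subrr normr0.
have cc : {for ts, continuous (cvec c i)} :=
  (cvec_smooth Hc HJ1 0%N : forall t, _ -> _) ts J1ts.
have zc : {for ts, continuous (fun t => tcoord i (c t))} :=
  (coord_smooth Hc HJ1 0%N : forall t, _ -> _) ts J1ts.
have [rho rho0 Hrho] : exists2 rho : R, 0 < rho &
    forall q : R4, `|cvec c i ts - q| < rho -> A q.
  have /nbhs_ballP[rho rho0 H] : nbhs (cvec c i ts) A by apply: open_nbhs_nbhs.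
  by exists rho => // q qr; apply: H; rewrite -ball_normE.
(* For these t the uniqueness clause of the Legendre inverse applies to [c t]. *)
have [r2 r20 Hr2] := near_dist _ (zc _ Znear).
have rho20 : 0 < rho / 2 by rewrite divr_gt0.
have near3 : \forall t \near ts, `|cvec c i ts - cvec c i t| < rho / 2.
  by move/cvgrPdist_lt: cc; apply.
have [r3 r30 Hr3] := near_dist _ near3.
pose r := Num.min (Num.min r1 r2) (Num.min r3 d).
have r0 : 0 < r by rewrite !lt_min r10 r20 r30.
have rle t : `|t - ts| < r -> [/\ `|t - ts| < r1, `|t - ts| < r2, `|t - ts| < r3 & `|t - ts| < d].
  by rewrite !lt_min => /andP[/andP[-> ->] /andP[-> ->]].
clearbody r.
have HJ t : `|t - ts| < r -> a < t < b /\ dom i (c t).1 by move=> /rle[/HJ1].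
have Aq t : `|t - ts| < r -> A (cvec c i t).
  move=> /rle[_ _ /Hr3 H _]; apply: Hrho; apply: lt_trans H _.
  by rewrite ltr_pdivrMr // ltr_pMr // ltr1n.
have Zc t : `|t - ts| < r -> Zd (cvec c i t) = tcoord i (c t).
  move=> tr; have [t_1 t_2 _ _] := rle t tr.
  have it := Hr1 t t_1.
  have [_ fz] := region_indicatrix HF cF it.
  exact: Hr2 t t_2 fz _ (Aq t tr) (region_cvec it).1.
(* Half of r puts the closed support inside the open interval on which chart and lift are
   available. *)
pose t0 := ts - r / 2; pose t1 := ts + r / 2.
have t0E : t0 = ts - r / 2 by []. have t1E : t1 = ts + r / 2 by [].
clearbody t0 t1.
have HJ01 t : t0 <= t <= t1 -> `|t - ts| < r.
  by rewrite t0E t1E ltr_distl => /andP[h1 h2]; apply/andP; split; move: h1 h2 r0; lra.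
have t01 : t0 < t1 by rewrite t0E t1E; move: r0; lra.
have t0J : a < t0 < b by apply: (HJ _ _).1; apply: HJ01; rewrite lexx ltW.
have t1J : a < t1 < b by apply: (HJ _ _).1; apply: HJ01; rewrite lexx ltW.
pose phi := smooth_bump t0 t1.
have phis : smooth_on setT phi := bump_smooth t0 t1.
have phi0 t : ~~ (t0 <= t <= t1) -> phi t = 0.
  move=> nt; apply: bump_eq0; apply: contraNN nt => /andP[h1 h2].
  by rewrite !ltW.
have pc : continuous_icc (fun t => `|pvec c i phi t|) t0 t1.
  move=> t /HJ01 tJ.
  apply: (@continuous_comp _ _ _ (pvec c i phi) (fun q : R4 => `|q|)).
    exact: (pvec_smooth Hc HJ phis 0) tJ.
  exact: norm_continuous.
have [tm tmI Hm] := EVT_max (ltW t01) (within_continuous_icc pc).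
pose C := `|pvec c i phi tm|.
have C0 : 0 <= C := normr_ge0 _.
have pC t : `|pvec c i phi t| <= C.
  have [tI|nt] := boolP (t0 <= t <= t1); first by apply: Hm; rewrite in_itv.
  by rewrite (pvec0 c i phi0 nt) normr0.
(* For |u| < e the displacement |u [pvec]| is at most e C <= rho/2, and [cvec] itself moves by less
   than rho/2, so the sum stays in the ball contained in [A]. The summand 1 covers C = 0. *)
pose e := rho / 2 / (C + 1).
have C10 : 0 < C + 1 by rewrite ltr_wpDl.
have e0 : 0 < e by rewrite divr_gt0.
have HqA (ut : R * R) : `|ut.1| < e /\ `|ut.2 - ts| < r -> A (qvec c i phi ut).
  case: ut => u t /= [ue tr]; apply: Hrho; rewrite /qvec /= opprD addrA.
  apply: le_lt_trans (ler_normB _ _) _.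
  have h1 : `|cvec c i ts - cvec c i t| < rho / 2 by have [_ _ /Hr3] := rle t tr.
  rewrite [ltRHS](splitr rho); apply: ltr_leD => //.
  rewrite normrZ; apply: le_trans (ler_pM (normr_ge0 _) (normr_ge0 _) (ltW ue) (pC t)) _.
  rewrite /e mulrAC ler_pdivrMr // ler_pM2l // lerDl //.
exists t0, t1, e, (bent c i ts r phi Zd); split.
- split; [by case/andP: t0J|by rewrite t0E gtrBl divr_gt0|by rewrite t1E ltrDl divr_gt0|].
  by case/andP: t1J.
- by move=> t /HJ01 /rle[].
- exact: e0.
- exact (bent_variation HF Hc HJ phis HJ01 phi0 oA Zs ZA HqA Zc).
- move=> t tI; exact (bent_omega2 HF Hc HJ phis HJ01 phi0 oA Zs ZA e0 HqA Zc (HJ01 t tI)).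
Qed.

Variables (w3 : one_form S) (I J K : TM S -> R) (HC : finsler_coframe F w3 I J K).

Lemma extremal_euler_lagrange t : extremal F a b c -> a < t < b -> euler_lagrange w3 I c t = 0.
Proof.
move=> Hext tab; apply/eqP; apply: contraT => el0.
have elc s : a < s < b -> {for s, continuous (euler_lagrange w3 I c)} by exact (@euler_lagrange_continuous _ _ _ _ HF _ _ _ _ HC _ _ _ Hc s).
(* Multiplication by the constant value at t treats both signs at once: the product is positive near
   t, hence so is its integral against the bump. *)
have : \forall s \near t, 0 < euler_lagrange w3 I c s * euler_lagrange w3 I c t.
  apply: (near_gt_continuous (f := fun s => euler_lagrange w3 I c s * euler_lagrange w3 I c t)).
    by apply: continuousM; [exact: elc|exact: cst_continuous].
  by rewrite -expr2 exprn_even_gt0.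
move=> /nbhs_ballP[d d0 Hd].
have [t0 [t1 [e [G [[at0 t0t tt1 t1b] near_t e0 HG GE]]]]] := variation_exists tab d0.
have t01 := lt_trans t0t tt1.
have D := first_variation HF HC e0 at0 t01 t1b HG.
have D0 := Hext e t0 t1 G e0 at0 t01 t1b HG.
have I0 : \int[@lebesgue_measure R]_(s in `[t0, t1]) (variation_omega2 F G s * euler_lagrange w3 I c s) = 0.
  exact (etrans (esym (@derive_val _ _ _ _ _ _ _ D)) (@derive_val _ _ _ _ _ _ _ D0)).
have E : \int[@lebesgue_measure R]_(s in `[t0, t1]) (smooth_bump t0 t1 s * euler_lagrange w3 I c s) = 0.
  rewrite -[RHS]I0; apply: eq_Rintegral => s; rewrite inE /= in_itv /= => sI.
  by rewrite (GE s sI).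
have bc : continuous_icc (fun s => smooth_bump t0 t1 s * euler_lagrange w3 I c s) t0 t1.
  move=> s /andP[s0 s1]; apply: continuousM; first exact: (bump_smooth t0 t1 0).
  by apply: elc; rewrite (lt_le_trans at0) // (le_lt_trans s1).
have : 0 < \int[@lebesgue_measure R]_(s in `[t0, t1]) (smooth_bump t0 t1 s * euler_lagrange w3 I c s * euler_lagrange w3 I c t).
  apply: (Rintegral_gt0 (s := t)).
  - by move=> s sI; apply: continuousM; [exact: bc|exact: cst_continuous].
  - by rewrite t0t.
  - move=> s sI; rewrite -mulrA mulr_ge0 ?bump_ge0 // ltW //; apply: Hd.
    by rewrite -ball_normE /= distrC near_t.
  - rewrite -mulrA mulr_gt0 ?bump_gt0 ?t0t //; apply: Hd.
    exact: ballxx.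
rewrite RintegralZr //; last exact: integrable_icc.
by rewrite E mul0r ltxx.
Qed.

Lemma euler_lagrange_extremal : (forall t, a < t < b -> euler_lagrange w3 I c t = 0) -> extremal F a b c.
Proof.
move=> H e t0 t1 G e0 at0 t01 t1b HG.
have D := first_variation HF HC e0 at0 t01 t1b HG.
have E : \int[@lebesgue_measure R]_(s in `[t0, t1]) (variation_omega2 F G s * euler_lagrange w3 I c s) = 0.
  transitivity (\int[@lebesgue_measure R]_(s in `[t0, t1]) (0 : R)).
    apply: eq_Rintegral => s; rewrite inE /= in_itv /= => /andP[s0 s1].
    by rewrite H ?mulr0 // (lt_le_trans at0) // (le_lt_trans s1).
  by rewrite /Rintegral integral0.
by rewrite E in D.
Qed.

End Extremals.

(** The expression on the left is (p s^2 - (q + 1) k) / s, so dividing by sigma != 0 loses no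
    information. *)
Lemma euler_lagrange_algebra (R : realType) (p q s k : R) : s != 0 ->
  (p * s + (q + 1) * (- k / s) == 0) = ((q + 1) * k == p * s ^+ 2).
Proof.
move=> s0; have -> : p * s + (q + 1) * (- k / s) = (p * s ^+ 2 - (q + 1) * k) / s by field.
by rewrite mulf_eq0 invr_eq0 (negbTE s0) orbF subr_eq0 eq_sym.
Qed.

Theorem theorem5p3 (R : realType) (M : topologicalType) (S : surface R M)
  (F : TM S -> R) (HF : finsler F)
  (omega3 : one_form S) (I J K : TM S -> R)
  (Hcoframe : finsler_coframe F omega3 I J K)
  (I1 I2 I3 : TM S -> R)
  (HI : coframe_derivatives F omega3 I I1 I2 I3)
  (a b : R) (hab : a < b)
  (gam : R -> TM S) (Hgam : admissible F a b gam)
  (k : R -> R) (Hk : parallel_curvature F a b gam k) :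
  extremal F a b gam <->
  (forall t, a < t < b ->
     (I3 (gam t) + 1) * k t = I1 (gam t) * sigma F gam t ^+ 2).
Proof.
have EL t : a < t < b -> (euler_lagrange omega3 I gam t == 0) =
    ((I3 (gam t) + 1) * k t == I1 (gam t) * sigma F gam t ^+ 2).
  move=> tab; rewrite (euler_lagrange_coframe HF Hcoframe Hgam HI tab).
  rewrite (omega3_curve HF Hcoframe Hgam Hk tab); apply: euler_lagrange_algebra.
  exact: (admissible_omega1 Hgam tab).
split=> [Hext t tab|H].
  by apply/eqP; rewrite -EL //; apply/eqP; exact: (extremal_euler_lagrange HF Hgam Hcoframe).
by apply: (euler_lagrange_extremal HF Hcoframe) => t tab; apply/eqP; rewrite EL //; apply/eqP; exact: H.
Qed.
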